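(* Let $\alpha\ge2$, $a>0$ and $c\le1$. There exists a constant $C>0$, independent of the dimension $n$, such that the following holds for every $n\ge1$. Set $R_a=(an)^{1/\alpha}$ and let $\mu$ be a probability measure on $\mathbb R^n$ of the form $d\mu=\frac1Ze^{-V}dx$, with $Z$ a normalization constant and $V:\mathbb R^n\to\mathbb R$ of class $C^2$ satisfying $$V(x)=\frac{|x|^\alpha}{\alpha}\ \text{ if }|x|\le R_a,\qquad \mathrm{Hess}\,V(x)\ge c\,(an)^{1-\frac2\alpha}\ \text{ if }|x|\ge R_a.$$ Then $$\lambda_1(\mu)\ge C\,\min\Big(\frac1{4a},\frac12,c\Big)(an)^{1-\frac2\alpha}\quad\text{if }0<a\le1,$$ $$\lambda_1(\mu)\ge C\,\min\Big(\frac14,\,c\,a^{1-\frac2\alpha}\Big)n^{1-\frac2\alpha}\quad\text{if }a>1.$$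
   Context: $|x|$ is the Euclidean norm on $\mathbb R^n$. $\mathrm{Hess}\,V(x)\ge k$ means $\mathrm{Hess}\,V(x)\ge kI_n$ in the sense of quadratic forms. $\Delta_\mu$ is the non-negative self-adjoint operator on $L^2(\mathbb R^n,\mu)$ associated with the form $\int\nabla u\cdot\nabla v\,d\mu$ on $H^1(\mathbb R^n,\mu)$, and $\lambda_1(\mu)=\inf[\sigma(\Delta_\mu)\setminus\{0\}]$ is its spectral gap; equivalently, $\lambda_1(\mu)$ is the largest $\lambda\ge0$ such that $\lambda\int|u-\int u\,d\mu|^2d\mu\le\int|\nabla u|^2d\mu$ for all $u\in H^1(\mathbb R^n,\mu)$. *)

(* Defs.v *)
From HB Require Import structures.
From mathcomp Require Import all_boot all_order all_algebra.
From mathcomp Require Import all_classical all_reals all_analysis.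

Set Implicit Arguments.
Unset Strict Implicit.
Unset Printing Implicit Defensive.

Import Order.TTheory GRing.Theory Num.Theory.
Import numFieldNormedType.Exports.

Local Open Scope classical_set_scope.
Local Open Scope ring_scope.

(* R^n is 'rV[R]_n with its library topology; the library norm `|x| on row
   vectors is the sup norm, hence the separate Euclidean norm. *)
Definition enorm (R : realType) (n : nat) (x : 'rV[R]_n) : R :=
  Num.sqrt (\sum_(i < n) x ord0 i ^+ 2).

Section rV_measurable.
Variables (R : realType) (n : nat).

(* The sigma-algebra generated by the coordinates, as the library does for
   tuples; it is the Borel sigma-algebra of R^n. *)
Definition rV_coord (i : 'I_n) (x : 'rV[R]_n) : measurableTypeR R := x ord0 i.

Let rV_set0 : g_sigma_preimage rV_coord set0.
Proof. exact: sigma_algebra0. Qed.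

Let rV_setC A : g_sigma_preimage rV_coord A -> g_sigma_preimage rV_coord (~` A).
Proof. exact: sigma_algebraC. Qed.

Let rV_bigcup (F : _^nat) : (forall i, g_sigma_preimage rV_coord (F i)) ->
  g_sigma_preimage rV_coord (\bigcup_i (F i)).
Proof. exact: sigma_algebra_bigcup. Qed.

HB.instance Definition _ := @isMeasurable.Build default_measure_display
  'rV[R]_n (g_sigma_preimage rV_coord) rV_set0 rV_setC rV_bigcup.

Lemma measurable_rV_coord (i : 'I_n) :
  measurable_fun [set: 'rV[R]_n] (rV_coord i).
Proof.
move=> _ Y mY; rewrite setTI; apply: sub_sigma_algebra => /=.
rewrite -bigcup_seq/=; exists i => /=; first by rewrite mem_index_enum.
by exists Y => //; rewrite setTI.
Qed.

End rV_measurable.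

Lemma measurable_fun_rV (R : realType) (n : nat) d (T : measurableType d)
    (f : T -> 'rV[R]_n) :
  (forall i, measurable_fun [set: T] (rV_coord i \o f)) ->
  measurable_fun [set: T] f.
Proof.
move=> mf.
have sub : g_sigma_preimage (fun i => @rV_coord R n i \o f) `<=` measurable.
  apply: smallest_sub; first exact: sigma_algebra_measurable.
  case: n => [|n] in f mf *; first by rewrite big_ord0.
  rewrite -bigcup_mkord_ord; apply: bigcup_sub => i Ii.
  by move=> A [B mB <-]; exact: mf.
by move=> _ A mA; apply: sub; rewrite g_sigma_preimage_comp; exists A.
Qed.

Section lebesgue_rV.
Variable R : realType.

Section step.
Variable n : nat.

Definition rV_cons (p : measurableTypeR R * 'rV[R]_n) : 'rV[R]_n.+1 :=
  row_mx (const_mx p.1 : 'rV[R]_1) p.2.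

Definition rV_uncons (v : 'rV[R]_n.+1) : measurableTypeR R * 'rV[R]_n :=
  (v ord0 ord0, \row_j v ord0 (lift ord0 j)).

Lemma rV_cons0 p : rV_cons p ord0 ord0 = p.1.
Proof.
rewrite /rV_cons (_ : ord0 = lshift n (ord0 : 'I_1)); last exact/val_inj.
by rewrite (row_mxEl (const_mx p.1 : 'rV[R]_1)) mxE.
Qed.

Lemma rV_consS p j : rV_cons p ord0 (lift ord0 j) = p.2 ord0 j.
Proof.
rewrite /rV_cons (_ : lift ord0 j = rshift 1 j); last exact/val_inj.
by rewrite (row_mxEr (const_mx p.1 : 'rV[R]_1)).
Qed.

Lemma rV_consK : cancel rV_cons rV_uncons.
Proof.
move=> [a v]; rewrite /rV_uncons rV_cons0; congr pair.
by apply/rowP => j; rewrite mxE rV_consS.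
Qed.

Lemma measurable_rV_cons : measurable_fun setT rV_cons.
Proof.
apply: measurable_fun_rV => i; case: (unliftP ord0 i) => [j|] ->.
  rewrite (_ : _ \o _ = rV_coord j \o snd).
    by apply: measurableT_comp; [exact: measurable_rV_coord|].
  by apply/funext => p; rewrite /rV_coord/= rV_consS.
rewrite (_ : _ \o _ = fst)//.
by apply/funext => p; rewrite /rV_coord/= rV_cons0.
Qed.

Lemma measurable_rV_uncons : measurable_fun setT rV_uncons.
Proof.
apply: measurable_fun_pair => /=; first exact: (measurable_rV_coord ord0).
apply: measurable_fun_rV => i.
rewrite (_ : _ \o _ = rV_coord (lift ord0 i)); first exact: measurable_rV_coord.
by apply/funext => v; rewrite /rV_coord/= mxE.
Qed.

HB.instance Definition _ :=
  @isMeasurableFun.Build _ _ _ _ rV_cons measurable_rV_cons.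

Variable m : {sigma_finite_measure set 'rV[R]_n -> \bar R}.

Definition lebesgue_rVS : set 'rV[R]_n.+1 -> \bar R :=
  pushforward (@lebesgue_measure R \x m)%E rV_cons.

Let lebesgue_rVS0 : lebesgue_rVS set0 = 0%E.
Proof. exact: measure0. Qed.

Let lebesgue_rVS_ge0 A : (0 <= lebesgue_rVS A)%E.
Proof. exact: measure_ge0. Qed.

Let lebesgue_rVS_sigma_additive : semi_sigma_additive lebesgue_rVS.
Proof. exact: measure_semi_sigma_additive. Qed.

HB.instance Definition _ := isMeasure.Build _ _ _ lebesgue_rVS
  lebesgue_rVS0 lebesgue_rVS_ge0 lebesgue_rVS_sigma_additive.

Let lebesgue_rVS_sigma_finite : sigma_finite setT lebesgue_rVS.
Proof.
have /sigma_finiteP[F [FT ndF Foo]] := sigma_finiteT (@lebesgue_measure R).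
have /sigma_finiteP[G [GT ndG Goo]] := sigma_finiteT m.
exists (fun k => rV_uncons @^-1` (F k `*` G k)).
  apply/esym; rewrite -subTset => v _.
  have [k _ Fk] : (\bigcup_k F k) (rV_uncons v).1 by rewrite -FT.
  have [l _ Gl] : (\bigcup_k G k) (rV_uncons v).2 by rewrite -GT.
  exists (maxn k l) => //; split.
    exact: (subsetPset _ _ (ndF _ _ (leq_maxl k l))) Fk.
  exact: (subsetPset _ _ (ndG _ _ (leq_maxr k l))) Gl.
move=> k; have [mF Fk] := Foo k; have [mG Gk] := Goo k.
have mFG := measurableX mF mG; split.
  by rewrite -[X in measurable X]setTI; exact: measurable_rV_uncons.
rewrite /lebesgue_rVS /pushforward -comp_preimage.
rewrite (_ : _ \o _ = id); last by apply/funext => p; exact: rV_consK.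
rewrite [X in (X < _)%E](_ : _ = (lebesgue_measure (F k) * m (G k))%E).
  by rewrite lte_mul_pinfty// ge0_fin_numE.
exact: product_measure1E.
Qed.

HB.instance Definition _ :=
  Measure_isSigmaFinite.Build _ _ _ lebesgue_rVS lebesgue_rVS_sigma_finite.
End step.

(* Lebesgue measure on R^n, built along R^(n+1) = R x R^n. *)
Fixpoint lebesgue_rV (n : nat) : {sigma_finite_measure set 'rV[R]_n -> \bar R} :=
  match n with
  | 0 => \d_ (0 : 'rV[R]_0)
  | m.+1 => lebesgue_rVS (lebesgue_rV m)
  end.

Lemma lebesgue_rV_box (n : nat) (a b : 'rV[R]_n) :
  (forall i, a ord0 i <= b ord0 i) ->
  lebesgue_rV n [set x | forall i, a ord0 i <= x ord0 i <= b ord0 i] =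
  (\prod_(i < n) (b ord0 i - a ord0 i))%:E.
Proof.
elim: n a b => [|n IHn] a b ab.
  by rewrite big_ord0 /= diracE mem_set// => -[].
set a' := (rV_uncons a).2; set b' := (rV_uncons b).2.
set B := [set x : 'rV[R]_n | forall i, a' ord0 i <= x ord0 i <= b' ord0 i].
have mB : measurable B.
  rewrite (_ : B = \bigcap_(i in [set: 'I_n])
      (@rV_coord R n i @^-1` `[a' ord0 i, b' ord0 i])).
    apply: fin_bigcap_measurable => // i _.
    by rewrite -[X in measurable X]setTI; exact: measurable_rV_coord.
  apply/seteqP; split => x /= h i; first by move=> _; rewrite /= in_itv; exact: h.
  by have := h i I; rewrite /= in_itv.
transitivity ((@lebesgue_measure R \x lebesgue_rV n)%E
    ((`[a ord0 ord0, b ord0 ord0]%classic : set (measurableTypeR R)) `*` B)).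
  rewrite /= /lebesgue_rVS /pushforward; congr product_measure1.
  apply/seteqP; split => -[x v] /=.
    move=> h; split; first by have := h ord0; rewrite rV_cons0 in_itv.
    by move=> i; have := h (lift ord0 i); rewrite rV_consS !mxE.
  rewrite in_itv => -[h0 hS] i; case: (unliftP ord0 i) => [j|] ->.
    by have := hS j; rewrite rV_consS !mxE.
  by rewrite rV_cons0.
rewrite product_measure1E//.
rewrite IHn => [|i]; last by rewrite !mxE.
transitivity ((b ord0 ord0 - a ord0 ord0)%:E *
    (\prod_(i < n) (b' ord0 i - a' ord0 i))%:E)%E; last first.
  by rewrite -EFinM big_ord_recl; under eq_bigr do rewrite !mxE.
congr (_ * _)%E.
rewrite [LHS]lebesgue_measure_itv/= lte_fin.
have := ab ord0; rewrite le_eqVlt => /predU1P[->|->].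
  by rewrite ltxx subrr.
by rewrite -EFinB.
Qed.

End lebesgue_rV.

Section calculus.
Variables (R : realType) (n : nat).
Implicit Types (f V : 'rV[R]_n -> R).

Definition partial (i : 'I_n) f : 'rV[R]_n -> R :=
  fun x => 'D_(delta_mx ord0 i) f x.

(* [Ck k f]: all iterated partial derivatives of f of order at most k exist and
   are continuous on the whole space. *)
Fixpoint Ck (k : nat) f : Prop :=
  continuous f /\
  match k with
  | 0 => True
  | k'.+1 => forall i : 'I_n,
      (forall x, derivable f x (delta_mx ord0 i)) /\ Ck k' (partial i f)
  end.

Definition hessian V (x : 'rV[R]_n) : 'M[R]_n :=
  \matrix_(i, j) partial i (partial j V) x.

(* A >= k I_n in the sense of quadratic forms. *)
Definition form_ge (A : 'M[R]_n) (k : R) : Prop :=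
  forall v : 'rV[R]_n, k * enorm v ^+ 2 <= (v *m A *m v^T) ord0 ord0.

Definition test_function f : Prop :=
  (forall k, Ck k f) /\ compact (closure [set x | f x != 0]).

Definition locally_integrable_rV f : Prop :=
  forall K : set 'rV[R]_n, compact K ->
    (lebesgue_rV R n).-integrable K (EFin \o f).

(* g is the i-th partial derivative of u in the sense of distributions. *)
Definition weak_partial (i : 'I_n) (u g : 'rV[R]_n -> R) : Prop :=
  [/\ locally_integrable_rV u, locally_integrable_rV g &
    forall phi, test_function phi ->
      \int[lebesgue_rV R n]_x (u x * partial i phi x) =
      - \int[lebesgue_rV R n]_x (g x * phi x)].

End calculus.

Section spectral_gap.
Variables (R : realType) (n : nat) (mu : probability 'rV[R]_n R).

(* u belongs to H^1(R^n, mu), with weak gradient g. *)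
Definition H1_grad (u : 'rV[R]_n -> R) (g : 'rV[R]_n -> 'rV[R]_n) : Prop :=
  u \in Lfun mu 2%:E /\
  forall i, (fun x => g x ord0 i) \in Lfun mu 2%:E /\
            weak_partial i u (fun x => g x ord0 i).

Definition poincare (l : R) : Prop :=
  forall u g, H1_grad u g ->
    (l%:E * \int[mu]_x ((u x - \int[mu]_y u y) ^+ 2)%:E <=
     \int[mu]_x (enorm (g x) ^+ 2)%:E)%E.

(* The largest l >= 0 for which the Poincare inequality holds. *)
Definition lambda1 : \bar R :=
  ereal_sup [set l%:E | l in [set l : R | 0 <= l /\ poincare l]].

End spectral_gap.

(* dmu = Z^-1 exp(- V) dx *)
Definition has_gibbs_density (R : realType) (n : nat)
    (mu : probability 'rV[R]_n R) (V : 'rV[R]_n -> R) (Z : R) : Prop :=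
  forall A : set 'rV[R]_n, measurable A ->
    mu A = (\int[lebesgue_rV R n]_(x in A) (Z^-1 * expR (- V x))%:E)%E.

(* Main.v *)
From HB Require Import structures.
Require Import Defs.
From mathcomp Require Import all_boot all_order all_algebra.
From mathcomp Require Import all_classical all_reals all_analysis.
From mathcomp Require Import measurable_realfun ring lra.
Set Implicit Arguments.
Unset Strict Implicit.
Unset Printing Implicit Defensive.
Import Order.TTheory GRing.Theory Num.Theory.
Import numFieldNormedType.Exports.
Local Open Scope classical_set_scope.
Local Open Scope ring_scope.

(** Let [c > 0]. The measure is uniformly log-concave, with curvature of order
[n^(1 - 2 / alpha)], except near the origin, where the Hessian of
[|x|^alpha / alpha] degenerates when [alpha > 2]. The proof repairs [V] near the
origin and then pays for the repair.

Let [rho] be a small multiple of [n^(1 / alpha)], with [rho <= Ra], and let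
[r = rho / 4]. On the ball of radius [r], replace [V] by a paraboloid of curvature
[K], of order [n^(1 - 2 / alpha)], that lies above [V] and meets it on the sphere
of radius [r]. The resulting [W] (the function [convexified]) satisfies
[W >= V], [W = V] outside the small ball, and [W - K |x|^2 / 2] is convex. The
Prekopa-Leindler inequality then gives a Poincare inequality for the measure
[exp (V - W) mu] with constant of order [1 / K] ([weighted_poincare]): apply it to
[exp (t f - W)] and [exp (- t f - W)] and expand to second order in [t].

Since [exp (V - W) <= 1], the gradient term is harmless, but the weight must be
removed from the left-hand side on the ball of radius [r]. Integrate by parts
along the field [x], cut off at radius [rho]: its divergence with respect to [mu]
is [n - x . grad V = n - |x|^alpha >= n / 2], because [rho^alpha <= n / 2]. This
bounds [n] times the integral of [(f - m)^2] over the small ball by its integral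
over the shell between [r] and [rho], where the weight is [1], plus
[rho^2 / n] times the integral of [|grad f|^2] ([hardy_pointwise]). As
[rho^2 / n^2] is of order [n^(2 / alpha - 1)], like [1 / K], the two estimates
combine into a Poincare inequality of the right order for [C^1] functions of
bounded support ([c1_poincare]), and the dimension has disappeared from the
constant.

It extends to [H^1(mu)] by approximation: truncate and mollify a Sobolev function
([H1_approximation]). The mollification converges in [L^2] by continuity of
translations ([translate_L2]), and its gradient is the mollified weak gradient
([mollify_has_grad]).

For [c <= 0] the claimed bound is nonpositive, while [lambda1 mu] is nonnegative. *)

(** * Brunn-Minkowski and the layer-cake formula on the line *)

Section line_measure.
Variable R : realType.
Let lam : {measure set (measurableTypeR R) -> \bar R} := @lebesgue_measure R.

Lemma measurable_affine (k b : R) :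
  measurable_fun [set: measurableTypeR R]
    ((fun x => k * x + b) : measurableTypeR R -> measurableTypeR R).
Proof. by apply: measurable_funD => //; apply: measurable_funM. Qed.

(** Both sides are measures in [C] that agree on intervals. *)
Lemma lebesgue_affine (k b : R) (C : set (measurableTypeR R)) : 0 < k ->
  measurable C -> (k%:E * lam ((fun x => k * x + b)%R @^-1` C) = lam C)%E.
Proof.
move=> k0 mC.
pose phi : measurableTypeR R -> measurableTypeR R := fun x => k * x + b.
have mphi : measurable_fun [set: measurableTypeR R] phi.
  exact: measurable_affine.
pose push : {measure set (measurableTypeR R) -> \bar R} := pushforward lam phi.
pose mu : {measure set (measurableTypeR R) -> \bar R} :=
  mscale (NngNum (ltW k0)) (push mphi).
transitivity (mu C); first by [].
symmetry; apply: lebesgue_measure_unique => // _ [[u v]] /= _ <-.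
rewrite /mu /= /mscale /= /pushforward.
rewrite (_ : phi @^-1` `]u, v]%classic = `](u - b) / k, (v - b) / k]%classic).
  rewrite /lam !lebesgue_measure_itv /= !lte_fin ltr_pM2r ?invr_gt0// ltrD2r.
  case: ifP => _; last by rewrite mule0.
  rewrite -!EFinB -EFinM; congr EFin; field; lra.
apply/seteqP; split => x /=; rewrite !in_itv/= /phi ltr_pdivrMr// ler_pdivlMr//
  ltrBlDr lerBrDr [x * k]mulrC//.
Qed.

(** One-dimensional Brunn-Minkowski. Cut [A] just below its supremum at [a] and
[B] just above its infimum at [b]: the translates [(A + b) / 2] and
[(a + B) / 2] sit in [C] on either side of [(a + b) / 2]. *)
Lemma brunn_minkowski1 (k : R) (A B C : set (measurableTypeR R)) :
  measurable A -> measurable B -> measurable C ->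
  A !=set0 -> B !=set0 ->
  (forall x, A x -> `|x| <= k) -> (forall x, B x -> `|x| <= k) ->
  (forall x y, A x -> B y -> C ((x + y) / 2)) ->
  (lam A + lam B <= 2%:E * lam C)%E.
Proof.
move=> mA mB mC A0 B0 Ak Bk ABC.
have hsA : has_sup A.
  by split => //; exists k => x /Ak; rewrite ler_norml => /andP[].
have hiB : has_inf B.
  by split => //; exists (- k) => x /Bk; rewrite ler_norml => /andP[].
apply/lee_addgt0Pr => e e0.
have e20 : 0 < e / 2 by rewrite divr_gt0.
have [a Aa aA] := sup_adherent e20 hsA.
have [b Bb bB] := inf_adherent e20 hiB.
pose A1 := A `&` `]-oo, a]%classic; pose B1 := B `&` `]b, +oo[%classic.
have mA1 : measurable A1 by apply: measurableI => //; exact: measurable_itv.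
have mB1 : measurable B1 by apply: measurableI => //; exact: measurable_itv.
pose m := (a + b) / 2.
pose C1 := C `&` `]-oo, m]%classic; pose C2 := C `&` `]m, +oo[%classic.
have mC1 : measurable C1 by apply: measurableI => //; exact: measurable_itv.
have mC2 : measurable C2 by apply: measurableI => //; exact: measurable_itv.
have pre c (D : set (measurableTypeR R)) : measurable D ->
    (lam ((fun x => 2^-1 * x + c)%R @^-1` D) = 2%:E * lam D)%E.
  move=> mD; rewrite -(@lebesgue_affine 2^-1 c D)// ?invr_gt0//.
  by rewrite muleA -EFinM mulfV// mul1e.
have mpre c (D : set (measurableTypeR R)) : measurable D ->
    measurable ((fun x : measurableTypeR R => 2^-1 * x + c : measurableTypeR R) @^-1` D).
  by move=> mD; rewrite -[X in measurable X]setTI; exact: measurable_affine.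
have lA1 : (lam A1 <= 2%:E * lam C1)%E.
  rewrite -(pre (b / 2))//; apply: le_measure; rewrite ?inE//; first exact: mpre.
  move=> x [Ax]; rewrite /= in_itv/= => xa; split.
    by have := ABC _ _ Ax Bb; congr C; lra.
  by rewrite /= in_itv/= /m; lra.
have lB1 : (lam B1 <= 2%:E * lam C2)%E.
  rewrite -(pre (a / 2))//; apply: le_measure; rewrite ?inE//; first exact: mpre.
  move=> x [Bx]; rewrite /= in_itv/= andbT => xb; split.
    by have := ABC _ _ Aa Bx; congr C; lra.
  by rewrite /= in_itv/= /m andbT; lra.
have lA : (lam A <= lam A1 + (e / 2)%:E)%E.
  have -> : ((e / 2)%:E = lam (`]a, (a + e / 2)%R]%classic))%E.
    rewrite [RHS]lebesgue_measure_itv/= lte_fin ltrDl e20 -EFinB.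
    by congr EFin; lra.
  apply: (le_trans _ (measureU2 lam mA1 _)); last exact: measurable_itv.
  apply: le_measure; rewrite ?inE//.
    by apply: measurableU => //; exact: measurable_itv.
  move=> x Ax; have [xa|ax] := leP x a; first by left; split => //=; rewrite in_itv.
  right; rewrite /= in_itv/= ax/=.
  have : x <= sup A by apply: sup_upper_bound.
  by lra.
have lB : (lam B <= lam B1 + (e / 2)%:E)%E.
  have -> : ((e / 2)%:E = lam (`[(b - e / 2)%R, b]%classic))%E.
    rewrite [RHS]lebesgue_measure_itv/= lte_fin ifT; last by lra.
    by rewrite -EFinB; congr EFin; lra.
  apply: (le_trans _ (measureU2 lam mB1 _)); last exact: measurable_itv.
  apply: le_measure; rewrite ?inE//.
    by apply: measurableU => //; exact: measurable_itv.
  move=> x Bx; have [xb|bx] := leP x b; last first.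
    by left; split => //=; rewrite in_itv/= bx.
  right; rewrite /= in_itv/= xb andbT.
  have : inf B <= x by apply: inf_lbound => //; case: hiB.
  by lra.
apply: (le_trans (leeD lA lB)).
rewrite addeACA -EFinD (_ : e / 2 + e / 2 = e); last by lra.
rewrite leeD2r//; apply: (le_trans (leeD lA1 lB1)).
rewrite -muleDr ?ge0_adde_def ?inE//.
rewrite lee_pmul2l// -measureU//; last first.
  rewrite /C1 /C2 -subset0 => x [] [_] /=; rewrite !in_itv/= andbT => xm [_].
  by rewrite ltNge xm.
apply: le_measure; rewrite ?inE//; first exact: measurableU.
by move=> x [] [].
Qed.

End line_measure.

(** The layer-cake formula is Tonelli for the region below the graph; for
functions bounded by [1] only the levels in [0, 1] matter. *)
Lemma layer_cake d (T : measurableType d) (R : realType)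
    (m : {sigma_finite_measure set T -> \bar R}) (f : T -> R) :
  measurable_fun setT f -> (forall x, 0 <= f x <= 1) ->
  (\int[m]_x (f x)%:E =
   \int[@lebesgue_measure R]_(s in `]0%R, 1%R[) m [set x | (s < f x)%R])%E.
Proof.
move=> mf f01.
pose g (p : measurableTypeR R * T) : \bar R :=
  (\1_[set q : measurableTypeR R * T | 0 < q.1 < f q.2] p)%:E.
have mS : measurable [set q : measurableTypeR R * T | 0 < q.1 < f q.2].
  rewrite [X in measurable X](_ : _ =
    (fun q : measurableTypeR R * T => 0 < q.1) @^-1` [set true] `&`
    (fun q : measurableTypeR R * T => q.1 < f q.2) @^-1` [set true]); last first.
    by apply/seteqP; split => q /= => [/andP[]//|[-> ->]].
  apply: measurableI; rewrite -[X in measurable X]setTI.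
    by apply: measurable_fun_ltr => //.
  apply: measurable_fun_ltr => //.
  exact: measurableT_comp.
have mg : measurable_fun setT g.
  by apply/measurable_EFinP; exact: measurable_indic.
transitivity (\int[m]_x \int[@lebesgue_measure R]_s g (s, x))%E.
  apply: eq_integral => x _.
  rewrite (_ : (fun s => g (s, x)) = (fun s => (\1_(`]0, (f x)[%classic) s)%:E)).
    rewrite integral_indic// setIT [RHS]lebesgue_measure_itv/= lte_fin.
    by rewrite -EFinB subr0; case: ltP => // fx0; congr EFin; have := f01 x; lra.
  by apply/funext => s; rewrite /g !indicE; congr (_%:R%:E).
rewrite -(@fubini_tonelli _ _ _ _ _ (@lebesgue_measure R) m g mg); last first.
  by move=> p; rewrite lee_fin.
rewrite [RHS]integral_mkcond; apply: eq_integral => s _.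
rewrite patchE; case: ifPn => [|].
  rewrite inE/= in_itv/= => /andP[s0 s1].
  rewrite (_ : (fun y => g (s, y)) = (fun y => (\1_[set x | s < f x] y)%:E)).
    rewrite integral_indic// ?setIT//.
    rewrite -[X in measurable X]setTI.
    rewrite (_ : [set x | s < f x] = (fun x => s < f x) @^-1` [set true]).
      by apply: measurable_fun_ltr.
    by apply/seteqP; split => q.
  apply/funext => y; rewrite /g !indicE; congr (_%:R%:E).
  by congr nat_of_bool; apply/idP/idP => /set_mem /=; rewrite ?s0 => h; apply/mem_set => /=; rewrite ?s0.
move=> s01; rewrite integral0_eq// => y _; rewrite /g indicE memNset//=.
move=> /andP[s0 sy]; move/negP: s01; apply; rewrite inE/= in_itv/= s0/=.
by rewrite (lt_le_trans sy)//; case/andP: (f01 y).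
Qed.

(** * The Prekopa-Leindler inequality on the line *)

Section prekopa_leindler_line.
Variable R : realType.
Let lam : {measure set (measurableTypeR R) -> \bar R} := @lebesgue_measure R.
Implicit Types (F G : measurableTypeR R -> R) (H : measurableTypeR R -> \bar R).

(** When both functions have supremum [1] every superlevel set below height [1]
is nonempty, so Brunn-Minkowski applies to each of them; the layer-cake formula
integrates the resulting inequalities. *)
Lemma prekopa_leindler_sup1 (k : R) F G H :
  measurable_fun setT F -> measurable_fun setT G -> measurable_fun setT H ->
  (forall x, 0 <= F x <= 1) -> (forall x, 0 <= G x <= 1) ->
  (forall x, (0 <= H x)%E) ->
  (forall x, F x != 0 -> `|x| <= k) -> (forall x, G x != 0 -> `|x| <= k) ->
  (forall s, s < 1 -> exists x, s < F x) ->
  (forall s, s < 1 -> exists x, s < G x) ->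
  (forall x y, ((F x * G y)%:E <= H ((x + y) / 2)%R * H ((x + y) / 2)%R)%E) ->
  (\int[lam]_x (F x)%:E + \int[lam]_x (G x)%:E <= 2%:E * \int[lam]_x H x)%E.
Proof.
move=> mF mG mH F01 G01 H0 Fk Gk F1 G1 FGH.
pose K x := fine (mine (H x) 1%:E).
have mK : measurable_fun setT K.
  apply: (measurableT_comp (fine_measurable measurableT)).
  by apply: measurable_mine => //; exact: measurable_cst.
have KE x : (K x)%:E = mine (H x) 1%:E.
  rewrite /K fineK// ge0_fin_numE.
    by rewrite gt_min ltry orbT.
  by rewrite le_min H0 lee_fin ler01.
have K01 x : 0 <= K x <= 1.
  rewrite -!lee_fin KE le_min H0 lee_fin ler01/=.
  by rewrite ge_min lexx orbT.
have KH : (\int[lam]_x (K x)%:E <= \int[lam]_x H x)%E.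
  apply: ge0_le_integral => //.
  - by move=> x _; rewrite lee_fin; case/andP: (K01 x).
  - exact/measurable_EFinP.
  - by move=> x _; rewrite KE ge_min lexx.
apply: (@le_trans _ _ (2%:E * \int[lam]_x (K x)%:E)%E); last by rewrite lee_pmul2l.
rewrite !layer_cake//.
have mset (f : measurableTypeR R -> R) (s : R) : measurable_fun setT f ->
    measurable [set x | s < f x].
  move=> mf; rewrite -[X in measurable X]setTI.
  rewrite (_ : [set x | s < f x] = (fun x => s < f x) @^-1` [set true]).
    by apply: measurable_fun_ltr.
  by apply/seteqP; split => q.
have mlev (f : measurableTypeR R -> R) : measurable_fun setT f ->
    measurable_fun (`]0%R, 1%R[%classic : set (measurableTypeR R))
      (fun s : measurableTypeR R => lam [set x | s < f x]).
  move=> mf; apply: measurable_funTS => /=.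
  have mS : measurable [set q : measurableTypeR R * measurableTypeR R | q.1 < f q.2].
    rewrite [X in measurable X](_ : _ =
      (fun q : measurableTypeR R * measurableTypeR R => q.1 < f q.2) @^-1` [set true]);
      last by apply/seteqP; split => q.
    rewrite -[X in measurable X]setTI.
    apply: measurable_fun_ltr => //.
    exact: measurableT_comp.
  have := measurable_fun_xsection lam mS.
  apply: eq_measurable_fun => s _ /=; congr (lam _).
  by apply/seteqP; split => x; rewrite /xsection /= inE.
rewrite -ge0_integralZl//; last exact: mlev.
rewrite -ge0_integralD//; [|exact: mlev|exact: mlev].
apply: ge0_le_integral => //=.
- by move=> x _; apply: adde_ge0.
- by apply: emeasurable_funD; exact: mlev.
- by apply: measurable_funeM; exact: mlev.
move=> s; rewrite in_itv/= => /andP[s0 s1].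
apply: (@brunn_minkowski1 _ k); try exact: mset.
- by have [x sx] := F1 _ s1; exists x.
- by have [x sx] := G1 _ s1; exists x.
- by move=> x /= sx; apply: Fk; rewrite gt_eqF// (lt_trans s0).
- by move=> x /= sx; apply: Gk; rewrite gt_eqF// (lt_trans s0).
move=> x y /= sF sG.
rewrite -lte_fin KE lt_min lte_fin s1 andbT.
rewrite ltNge; apply/negP => Hs.
have := FGH x y; apply/negP; rewrite -ltNge.
apply: (@le_lt_trans _ _ (s%:E * s%:E)%E); first exact: lee_pmul.
by rewrite -EFinM lte_fin; nra.
Qed.

(** Rescale [F] and [G] by their suprema [p] and [q]. The additive inequality
for [F / p] and [G / q] reads [I t + J / t <= 2 L] with [t = sqrt (q / p)],
and the arithmetic-geometric mean inequality makes it multiplicative. *)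
Lemma prekopa_leindler_bounded (k M : R) F G H :
  measurable_fun setT F -> measurable_fun setT G -> measurable_fun setT H ->
  (forall x, 0 <= F x <= M) -> (forall x, 0 <= G x <= M) ->
  (forall x, (0 <= H x)%E) ->
  (forall x, F x != 0 -> `|x| <= k) -> (forall x, G x != 0 -> `|x| <= k) ->
  (forall x y, ((F x * G y)%:E <= H ((x + y) / 2)%R * H ((x + y) / 2)%R)%E) ->
  (\int[lam]_x (F x)%:E * \int[lam]_x (G x)%:E <=
   \int[lam]_x H x * \int[lam]_x H x)%E.
Proof.
move=> mF mG mH F0 G0 H0 Fk Gk FGH.
have IH0 : (0 <= \int[lam]_x H x)%E by exact: integral_ge0.
have fin (f : measurableTypeR R -> R) : measurable_fun setT f -> (forall x, 0 <= f x <= M) ->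
    (forall x, f x != 0 -> `|x| <= k) ->
    (\int[lam]_x (f x)%:E \is a fin_num)%E.
  move=> mf f0 fk; rewrite ge0_fin_numE; last first.
    by apply: integral_ge0 => x _; rewrite lee_fin; case/andP: (f0 x).
  apply: (@le_lt_trans _ _ (\int[lam]_x (M%:E * (\1_(`[(- k)%R, k]%classic) x)%:E)))%E.
    apply: ge0_le_integral => //.
    - by move=> x _; rewrite lee_fin; case/andP: (f0 x).
    - exact/measurable_EFinP.
    - by apply: measurable_funeM; apply/measurable_EFinP; exact: measurable_indic.
    - move=> x _; rewrite -EFinM lee_fin indicE.
      case/andP: (f0 x) => fx0 fxM.
      have [fx|/fk xk] := eqVneq (f x) 0; first by rewrite fx mulr_ge0// (le_trans fx0).
      by rewrite mem_set ?mulr1//= in_itv/= -ler_norml.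
  rewrite ge0_integralZl//; last 2 first.
  - by apply/measurable_EFinP; exact: measurable_indic.
  - by rewrite lee_fin; case/andP: (f0 0) => /le_trans; apply.
  rewrite integral_indic// setIT [X in (_ * X)%E]lebesgue_measure_itv/=.
  by case: ifP => _; rewrite ?mule0 ?ltry// -EFinB -EFinM ltry.
have zero (f : measurableTypeR R -> R) : (forall x, 0 <= f x <= M) -> (~ exists x, 0 < f x) ->
    (\int[lam]_x (f x)%:E = 0)%E.
  move=> f0 nf; apply: integral0_eq => x _.
  case/andP: (f0 x) => fx0 _.
  move: fx0; rewrite le_eqVlt => /orP[/eqP <-//|fx].
  by case: nf; exists x.
have [[x0 Fx0]|nF] := pselect (exists x, 0 < F x); last first.
  by rewrite (zero F)// mul0e mule_ge0.
have [[y0 Gy0]|nG] := pselect (exists x, 0 < G x); last first.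
  by rewrite (zero G)// mule0 mule_ge0.
pose p := sup (range F); pose q := sup (range G).
have sF : has_sup (range F).
  by split; [exists (F x0), x0|exists M => _ [x _ <-]; case/andP: (F0 x)].
have sG : has_sup (range G).
  by split; [exists (G y0), y0|exists M => _ [x _ <-]; case/andP: (G0 x)].
have Fp x : F x <= p by apply: ub_le_sup; [case: sF|exists x].
have Gq x : G x <= q by apply: ub_le_sup; [case: sG|exists x].
have p0 : 0 < p := lt_le_trans Fx0 (Fp _).
have q0 : 0 < q := lt_le_trans Gy0 (Gq _).
have [HI|HI] := eqVneq (\int[lam]_x H x)%E +oo%E.
  by rewrite HI mulyy leey.
(* the factor of [H] is the geometric mean of those of [F] and [G] *)
pose w := Num.sqrt (p * q).
have w0 : 0 < w by rewrite sqrtr_gt0 mulr_gt0.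
have ww : w * w = p * q by rewrite -expr2 sqr_sqrtr// mulr_ge0 ?ltW.
have := @prekopa_leindler_sup1 k (fun x => p^-1 * F x) (fun x => q^-1 * G x)
  (fun x => (w^-1)%:E * H x)%E.
have iF : (\int[lam]_x (p^-1 * F x)%:E = (p^-1)%:E * \int[lam]_x (F x)%:E)%E.
  under eq_integral do rewrite EFinM.
  rewrite ge0_integralZl//.
  - exact/measurable_EFinP.
  - by move=> x _; rewrite lee_fin; case/andP: (F0 x).
  - by rewrite lee_fin invr_ge0 ltW.
have iG : (\int[lam]_x (q^-1 * G x)%:E = (q^-1)%:E * \int[lam]_x (G x)%:E)%E.
  under eq_integral do rewrite EFinM.
  rewrite ge0_integralZl//.
  - exact/measurable_EFinP.
  - by move=> x _; rewrite lee_fin; case/andP: (G0 x).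
  - by rewrite lee_fin invr_ge0 ltW.
rewrite iF iG ge0_integralZl//; last by rewrite lee_fin invr_ge0 ltW.
have := fin _ mF F0 Fk; have := fin _ mG G0 Gk.
have : (\int[lam]_x H x \is a fin_num)%E by rewrite ge0_fin_numE// ltey.
have I0 : (0 <= \int[lam]_x (F x)%:E)%E.
  by apply: integral_ge0 => x _; rewrite lee_fin; case/andP: (F0 x).
have J0 : (0 <= \int[lam]_x (G x)%:E)%E.
  by apply: integral_ge0 => x _; rewrite lee_fin; case/andP: (G0 x).
move: IH0 I0 J0.
move: (\int[lam]_x H x)%E (\int[lam]_x (F x)%:E)%E (\int[lam]_x (G x)%:E)%E.
move=> [L||] [I||] [J||]//=; rewrite !lee_fin => L0 I0 J0 _ _ _ key.
have {key} : p^-1 * I + q^-1 * J <= 2 * (w^-1 * L).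
  rewrite -lee_fin EFinD !EFinM; apply: key.
  - exact: measurable_funM.
  - exact: measurable_funM.
  - exact: measurable_funeM.
  - move=> x; case/andP: (F0 x) => Fx _; apply/andP; split.
      by rewrite mulr_ge0// invr_ge0 ltW.
    by rewrite mulrC ler_pdivrMr// mul1r.
  - move=> x; case/andP: (G0 x) => Gx _; apply/andP; split.
      by rewrite mulr_ge0// invr_ge0 ltW.
    by rewrite mulrC ler_pdivrMr// mul1r.
  - by move=> x; rewrite mule_ge0// lee_fin invr_ge0 ltW.
  - by move=> x; rewrite mulf_eq0 negb_or => /andP[_]; exact: Fk.
  - by move=> x; rewrite mulf_eq0 negb_or => /andP[_]; exact: Gk.
  - move=> s s1; have e0 : 0 < (1 - s) * p by rewrite mulr_gt0// subr_gt0.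
    have [_ [x _ <-]] := sup_adherent e0 sF; rewrite -/p => h; exists x.
    by rewrite mulrC ltr_pdivlMr//; lra.
  - move=> s s1; have e0 : 0 < (1 - s) * q by rewrite mulr_gt0// subr_gt0.
    have [_ [x _ <-]] := sup_adherent e0 sG; rewrite -/q => h; exists x.
    by rewrite mulrC ltr_pdivlMr//; lra.
  move=> x y /=; rewrite muleACA -EFinM -invfM ww mulrACA -invfM EFinM.
  by rewrite lee_pmul2l// lte_fin invr_gt0 mulr_gt0.
move=> key; suff : I * J <= L * L by rewrite -lee_fin.
have wE : w = Num.sqrt p * Num.sqrt q by rewrite /w sqrtrM// ltW.
have P0 : 0 < Num.sqrt p by rewrite sqrtr_gt0.
have Q0 : 0 < Num.sqrt q by rewrite sqrtr_gt0.
have pE : p = Num.sqrt p ^+ 2 by rewrite sqr_sqrtr// ltW.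
have qE : q = Num.sqrt q ^+ 2 by rewrite sqr_sqrtr// ltW.
move: (Num.sqrt p) (Num.sqrt q) P0 Q0 wE pE qE => P Q P0 Q0 wE pE qE.
move: key; rewrite wE pE qE.
have PQ0 : 0 < P^-1 /\ 0 < Q^-1 by rewrite !invr_gt0.
move=> key.
have {key} : I * (Q / P) + J * (P / Q) <= 2 * L.
  have := @ler_wpM2l _ (P * Q) (mulr_ge0 (ltW P0) (ltW Q0)) _ _ key.
  by congr (_ <= _); field; rewrite ?gt_eqF.
have t0 : 0 < Q / P by rewrite divr_gt0.
rewrite -[P / Q]invf_div; move: (Q / P) t0 => t t0 key.
have e : (I * t) * (J / t) = I * J by field; rewrite gt_eqF.
rewrite -e.
have : 0 <= I * t by rewrite mulr_ge0// ltW.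
have : 0 <= J / t by rewrite divr_ge0// ltW.
move: key; move: (I * t) (J / t) => a b ab b0 a0.
have h1 := sqr_ge0 (a - b).
have h2 : 0 <= (2 * L - (a + b)) * (2 * L + (a + b)) by rewrite mulr_ge0; lra.
by nra.
Qed.

(** Truncate in height and in space, and pass to the limit by monotone
convergence. *)
Lemma prekopa_leindler1 (F G H : measurableTypeR R -> \bar R) :
  measurable_fun setT F -> measurable_fun setT G -> measurable_fun setT H ->
  (forall x, (0 <= F x)%E) -> (forall x, (0 <= G x)%E) ->
  (forall x, (0 <= H x)%E) ->
  (forall x y, (F x * G y <= H ((x + y) / 2)%R * H ((x + y) / 2)%R)%E) ->
  (\int[lam]_x F x * \int[lam]_x G x <= \int[lam]_x H x * \int[lam]_x H x)%E.
Proof.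
move=> mF mG mH F0 G0 H0 FGH.
pose I k : set (measurableTypeR R) := `[(- k)%R, k]%classic.
pose tr (f : measurableTypeR R -> \bar R) (k : nat) x :=
  fine (mine (f x) k%:R%:E) * \1_(I k%:R) x.
have fE (f : measurableTypeR R -> \bar R) (k : nat) x : (0 <= f x)%E ->
    (fine (mine (f x) k%:R%:E))%:E = mine (f x) k%:R%:E.
  move=> f0; rewrite fineK// ge0_fin_numE; last by rewrite le_min f0 lee_fin ler0n.
  by rewrite gt_min ltry orbT.
have trE (f : measurableTypeR R -> \bar R) (k : nat) x : (0 <= f x)%E ->
    (tr f k x)%:E = (mine (f x) k%:R%:E * (\1_(I k%:R) x)%:E)%E.
  by move=> f0; rewrite /tr EFinM fE.
have trb (f : measurableTypeR R -> \bar R) (k : nat) x : (0 <= f x)%E -> 0 <= tr f k x <= k%:R.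
  move=> f0; have : 0 <= fine (mine (f x) k%:R%:E) <= k%:R.
    rewrite -!lee_fin fE// le_min f0/= lee_fin ler0n/=.
    by rewrite ge_min lexx orbT.
  rewrite /tr indicE; case: (x \in I k%:R); rewrite ?mulr1// ?mulr0 lexx.
  by rewrite ler0n.
have trle (f : measurableTypeR R -> \bar R) (k : nat) x : (0 <= f x)%E -> ((tr f k x)%:E <= f x)%E.
  move=> f0; rewrite trE// indicE; case: (x \in I k%:R); last by rewrite mule0.
  by rewrite mule1 ge_min lexx.
have mtr (f : measurableTypeR R -> \bar R) k : measurable_fun setT f -> measurable_fun setT (tr f k).
  move=> mf; apply: measurable_funM; last first.
    by apply: measurable_indic; exact: measurable_itv.
  apply: (measurableT_comp (fine_measurable measurableT)).
  by apply: measurable_mine => //; exact: measurable_cst.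
have cvgtr (f : measurableTypeR R -> \bar R) : measurable_fun setT f -> (forall x, 0 <= f x)%E ->
    (\int[lam]_x (tr f k x)%:E)%E @[k --> \oo] --> (\int[lam]_x f x)%E.
  move=> mf f0.
  have nd : forall x : measurableTypeR R, setT x ->
      nondecreasing_seq (fun k => (tr f k x)%:E).
    move=> x _ i j ij; rewrite !trE//.
    apply: lee_pmul => //.
    - by rewrite le_min f0 lee_fin ler0n.
    - rewrite le_min ge_min lexx/= ge_min lee_fin ler_nat ij orbT//.
    rewrite lee_fin !indicE ler_nat.
    case: (boolP (x \in I i%:R)) => //; rewrite inE /I /= in_itv/= => /andP[h1 h2].
    rewrite mem_set//= in_itv/=.
    have : i%:R <= j%:R :> R by rewrite ler_nat.
    by lra.
  have := @cvg_monotone_convergence _ _ _ lam setT measurableT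
    (fun k x => (tr f k x)%:E) _ _ nd.
  have -> : (fun x => limn (fun k => (tr f k x)%:E)) = f.
    apply/funext => x; apply/cvg_lim => //.
    have : mine (f x) k%:R%:E @[k --> \oo] --> f x.
      have := f0 x; case: (f x) => [r||]//= r0; last first.
        rewrite (_ : (fun k => _) = (fun k => k%:R%:E)); first by apply/cvgenyP; exact: cvg_id.
        by apply/funext => k; rewrite min_r// leey.
      apply: cvg_near_cst; near=> k; rewrite min_l// lee_fin.
      by near: k; exact: nbhs_infty_ger.
    apply: cvg_trans; apply: near_eq_cvg; near=> k.
    rewrite trE// indicE mem_set ?mule1// /I/= in_itv/= -ler_norml.
    by near: k; exact: nbhs_infty_ger.
  apply.
  - by move=> n; apply/measurable_EFinP; exact: mtr.
  - by move=> n x _; rewrite lee_fin; case/andP: (trb f n x (f0 x)).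
have IF0 : (0 <= \int[lam]_x F x)%E by exact: integral_ge0.
have IG0 : (0 <= \int[lam]_x G x)%E by exact: integral_ge0.
have IH0 : (0 <= \int[lam]_x H x)%E by exact: integral_ge0.
have [->|nF] := eqVneq (\int[lam]_x F x)%E 0%E; first by rewrite mul0e mule_ge0.
have [->|nG] := eqVneq (\int[lam]_x G x)%E 0%E; first by rewrite mule0 mule_ge0.
have def : (\int[lam]_x F x *? \int[lam]_x G x)%E.
  by apply: neq0_mule_def; rewrite mule_eq0 negb_or nF nG.
apply: (cvge_to_le (cvgeM def (cvgtr F mF F0) (cvgtr G mG G0))).
apply: nearW => k.
apply: (@prekopa_leindler_bounded k%:R k%:R) => //.
- exact: mtr.
- exact: mtr.
- by move=> x; exact: trb.
- by move=> x; exact: trb.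
- move=> x; rewrite /tr mulf_eq0 negb_or => /andP[_].
  rewrite indicE pnatr_eq0 eqb0 negbK inE /I /= in_itv/= => ?.
  by rewrite ler_norml.
- move=> x; rewrite /tr mulf_eq0 negb_or => /andP[_].
  rewrite indicE pnatr_eq0 eqb0 negbK inE /I /= in_itv/= => ?.
  by rewrite ler_norml.
move=> x y; apply: le_trans (FGH x y); rewrite EFinM; apply: lee_pmul.
- by rewrite lee_fin; case/andP: (trb F k x (F0 x)).
- by rewrite lee_fin; case/andP: (trb G k y (G0 y)).
- exact: trle.
- exact: trle.
Unshelve. all: by end_near. Qed.

End prekopa_leindler_line.

(** * Borel sets, Tonelli and Prekopa-Leindler in dimension n *)

Section rV_borel.
Variables (R : realType) (n : nat).
Implicit Types (x y : 'rV[R]_n).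

Lemma rV_ballP x (e : R) y : 0 < e ->
  ball x e y <-> forall i, `|x ord0 i - y ord0 i| < e.
Proof.
move=> e0; split; first by move=> [_ h] i; exact: (h ord0 i).
by move=> h; split => // i j; rewrite (ord1 i); exact: h.
Qed.

(** Rational cubes form a countable base, so the coordinate sigma-algebra
contains the open sets. *)
Lemma measurable_open_rV (U : set 'rV[R]_n) : open U -> measurable U.
Proof.
move=> oU.
pose cube (p : 'rV[rat]_n * nat) : set 'rV[R]_n :=
  [set x | forall i, `|ratr (p.1 ord0 i) - x ord0 i| < p.2.+1%:R^-1].
have mcube p : measurable (cube p).
  rewrite (_ : cube p = \bigcap_(i in [set: 'I_n]) (@rV_coord R n i @^-1`
      (`](ratr (p.1 ord0 i) - p.2.+1%:R^-1), (ratr (p.1 ord0 i) + p.2.+1%:R^-1)[%classic))).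
    apply: fin_bigcap_measurable => // i _.
    by rewrite -[X in measurable X]setTI; apply: measurable_rV_coord => //;
      exact: measurable_itv.
  apply/seteqP; split => x /= h i; [move=> _; have := h i|have := h i I];
    by rewrite /= in_itv/= distrC ltr_distl.
rewrite (_ : U = \bigcup_p (if `[< cube p `<=` U >] then cube p else set0)).
  apply: countable_bigcupT_measurable; first exact: countableP.
  by move=> p; case: ifP.
apply/seteqP; split => [x Ux|x [p _]]; last by case: asboolP => // pU /pU.
have /nbhs_ballP[e /= e0 eU] : nbhs x U by apply: open_nbhs_nbhs.
have [N Ne] : exists N : nat, N.+1%:R^-1 < e / 2.
  have e20 : 0 < e / 2 by rewrite divr_gt0.
  exists (Num.truncn (e / 2)^-1).
  by rewrite invf_plt ?posrE// truncnS_gt.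
have /choice[q qx] : forall i, exists q : rat, `|ratr q - x ord0 i| < N.+1%:R^-1.
  move=> i; have h : x ord0 i - N.+1%:R^-1 < x ord0 i + N.+1%:R^-1.
    by rewrite ltrD2l gt0_cp// invr_gt0.
  have [q] := rat_in_itvoo h; rewrite in_itv/= => qh; exists q.
  by rewrite ltr_distl.
exists (\row_i q i, N) => //=; rewrite asboolT.
  by move=> i; rewrite mxE; exact: qx.
move=> y /= hy; apply: eU; apply/rV_ballP => // i.
have := hy i; rewrite mxE => h1; have := qx i; rewrite distrC => h2.
move: (N.+1%:R^-1) Ne h1 h2 => d Ne h1 h2.
rewrite (_ : x ord0 i - y ord0 i =
  (x ord0 i - ratr (q i)) + (ratr (q i) - y ord0 i)); last by lra.
by rewrite (le_lt_trans (ler_normD _ _))//; lra.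
Qed.

Lemma continuous_measurable_rV (f : 'rV[R]_n -> R) :
  continuous f -> measurable_fun setT (f : 'rV[R]_n -> measurableTypeR R).
Proof.
move=> cf; apply: (measurability _ (RGenOpens.measurableE R)).
move=> _ [_ [a [b ->] <-]]; rewrite setTI; apply: measurable_open_rV.
by apply: open_comp; [move=> x _; exact: cf|exact: interval_open].
Qed.

End rV_borel.

Section lebesgue_rV_theory.
Variable R : realType.
Let lam : {measure set (measurableTypeR R) -> \bar R} := @lebesgue_measure R.
Implicit Types n : nat.

Lemma rV_consU n (v : 'rV[R]_n.+1) : v = rV_cons (rV_uncons v).
Proof.
apply/rowP => i; case: (unliftP ord0 i) => [j|] ->.
  by rewrite rV_consS mxE.
by rewrite rV_cons0.
Qed.

Lemma rV_consD n (a b : R) (v w : 'rV[R]_n) :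
  rV_cons (a, v) + rV_cons (b, w) = rV_cons (a + b, v + w).
Proof.
apply/rowP => i; rewrite mxE; case: (unliftP ord0 i) => [j|] ->.
  by rewrite !rV_consS mxE.
by rewrite !rV_cons0.
Qed.

Lemma rV_consZ n (k a : R) (v : 'rV[R]_n) :
  k *: rV_cons (a, v) = rV_cons (k * a, k *: v).
Proof.
apply/rowP => i; rewrite mxE; case: (unliftP ord0 i) => [j|] ->.
  by rewrite !rV_consS mxE.
by rewrite !rV_cons0.
Qed.

Section tonelli.
Variables (n : nat) (F : 'rV[R]_n.+1 -> \bar R).
Hypotheses (mF : measurable_fun setT F) (F0 : forall x, (0 <= F x)%E).

Lemma measurable_rV_cons_section (a : measurableTypeR R) :
  measurable_fun setT (fun v : 'rV[R]_n => F (rV_cons (a, v))).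
Proof.
by apply: measurableT_comp => //; apply: measurableT_comp.
Qed.

Lemma lebesgue_rVS_tonelli : (\int[lebesgue_rV R n.+1]_x F x =
  \int[lam]_a \int[lebesgue_rV R n]_v F (rV_cons (a, v)))%E.
Proof.
transitivity (\int[pushforward (@lebesgue_measure R \x lebesgue_rV R n)
   (@rV_cons R n)]_x F x)%E; first by [].
rewrite ge0_integral_pushforward//.
rewrite preimage_setT fubini_tonelli1//.
  apply: measurableT_comp => //; exact: measurable_rV_cons.
by move=> x /=.
Qed.

Lemma measurable_rV_cons_integral : measurable_fun setT
  (fun a : measurableTypeR R => \int[lebesgue_rV R n]_v F (rV_cons (a, v)))%E.
Proof.
apply: (@measurable_fun_fubini_tonelli_F _ _ _ _ _ (lebesgue_rV R n)
  (fun p => F (rV_cons p))).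
- apply: measurableT_comp => //; exact: measurable_rV_cons.
- by move=> x /=.
Qed.

End tonelli.

(** Tensorization: by the one-dimensional inequality, integrating out all but
one coordinate preserves the hypothesis. *)
Lemma prekopa_leindler n (F G H : 'rV[R]_n -> \bar R) :
  measurable_fun setT F -> measurable_fun setT G -> measurable_fun setT H ->
  (forall x, 0 <= F x)%E -> (forall x, 0 <= G x)%E -> (forall x, 0 <= H x)%E ->
  (forall x y, F x * G y <=
    H (2^-1 *: (x + y))%R * H (2^-1 *: (x + y))%R)%E ->
  (\int[lebesgue_rV R n]_x F x * \int[lebesgue_rV R n]_x G x <=
   \int[lebesgue_rV R n]_x H x * \int[lebesgue_rV R n]_x H x)%E.
Proof.
elim: n F G H => [|n IHn] F G H mF mG mH F0 G0 H0 FGH.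
  rewrite /= !integral_dirac// !diracT !mul1e.
  by apply: le_trans (FGH 0 0) _; rewrite addr0 scaler0.
rewrite (lebesgue_rVS_tonelli mF F0) (lebesgue_rVS_tonelli mG G0).
rewrite (lebesgue_rVS_tonelli mH H0); apply: prekopa_leindler1.
- exact: measurable_rV_cons_integral.
- exact: measurable_rV_cons_integral.
- exact: measurable_rV_cons_integral.
- by move=> x; exact: integral_ge0.
- by move=> x; exact: integral_ge0.
- by move=> x; exact: integral_ge0.
move=> a b; apply: IHn => //; try exact: measurable_rV_cons_section.
move=> v w; apply: le_trans (FGH _ _) _.
by rewrite rV_consD rV_consZ [2^-1 * _]mulrC.
Qed.

Lemma measurable_rV_translate n (z : 'rV[R]_n) :
  measurable_fun setT (fun x : 'rV[R]_n => x + z).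
Proof.
apply: measurable_fun_rV => i.
rewrite (_ : _ \o _ = (fun x => rV_coord i x + z ord0 i)).
  by apply: measurable_funD => //; exact: measurable_rV_coord.
by apply/funext => x; rewrite /rV_coord /= mxE.
Qed.

Lemma ge0_integral_translate1 (F : measurableTypeR R -> \bar R) (b : R) :
  measurable_fun setT F -> (forall x, (0 <= F x)%E) ->
  (\int[lam]_x F (x + b)%R = \int[lam]_x F x)%E.
Proof.
move=> mF F0.
pose phi : measurableTypeR R -> measurableTypeR R := fun x => 1 * x + b.
have mphi : measurable_fun [set: measurableTypeR R] phi by exact: measurable_affine.
transitivity (\int[pushforward lam phi]_x F x)%E; last first.
  apply: eq_measure_integral => A mA _.
  by rewrite /pushforward -[RHS](@lebesgue_affine _ 1 b)// mul1e.
rewrite ge0_integral_pushforward// preimage_setT.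
by apply: eq_integral => x _; rewrite /phi /= mul1r.
Qed.

Lemma ge0_integral_translate n (F : 'rV[R]_n -> \bar R) (z : 'rV[R]_n) :
  measurable_fun setT F -> (forall x, (0 <= F x)%E) ->
  (\int[lebesgue_rV R n]_x F (x + z)%R = \int[lebesgue_rV R n]_x F x)%E.
Proof.
elim: n F z => [|n IHn] F z mF F0.
  by apply: eq_integral => x _; congr F; rewrite [z]thinmx0 addr0.
have mFz : measurable_fun setT (fun x : 'rV[R]_n.+1 => F (x + z)).
  by apply: measurableT_comp => //; exact: measurable_rV_translate.
rewrite (lebesgue_rVS_tonelli mFz (fun x => F0 _)) (lebesgue_rVS_tonelli mF F0).
set b := (rV_uncons z).1; set w := (rV_uncons z).2.
rewrite -[RHS](@ge0_integral_translate1
  (fun a => \int[lebesgue_rV R n]_v F (rV_cons (a, v)))%E b); last 2 first.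
- exact: measurable_rV_cons_integral.
- by move=> x; exact: integral_ge0.
apply: eq_integral => a _.
rewrite -[RHS](IHn (fun v => F (rV_cons (a + b, v))) w)//; last first.
  exact: measurable_rV_cons_section.
apply: eq_integral => v _; rewrite [z]rV_consU.
by rewrite [rV_uncons z]surjective_pairing rV_consD.
Qed.

End lebesgue_rV_theory.

(** * Continuously differentiable functions of n variables *)

Section derivatives.
Variable R : realType.

(** An explicit first-order error estimate composes more easily than a limit of
difference quotients. *)
Lemma is_derive_estimate (V : normedModType R) (f : V -> R) (x v : V) (df : R) :
  (forall e, 0 < e -> exists2 d, 0 < d &
     forall h : R, `|h| < d -> `|f (h *: v + x) - f x - h * df| <= e * `|h|) ->
  is_derive x v f df.
Proof.
move=> H.
have C : h^-1 *: ((f \o shift x) (h *: v) - f x) @[h --> 0^'] --> df.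
  apply/cvgrPdist_le => e e0; have [d d0 hd] := H e e0.
  near=> h => /=.
  have h0 : h != 0 by near: h; exact: nbhs_dnbhs_neq.
  have hld : `|h| < d.
    near: h; apply: (@nbhs_dnbhs _ (0 : R)); apply/nbhs_ballP; exists d => //= y.
    by rewrite /ball /= sub0r normrN.
  rewrite -(@ler_pM2r _ `|h|) ?normr_gt0//; apply: le_trans (hd h hld).
  rewrite le_eqVlt; apply/orP; left; apply/eqP.
  rewrite -normrM -[RHS]normrN; congr (`| _ |).
  by rewrite -[_ *: _]/(_ * _); field.
split; first by apply/cvg_ex; exists df.
by apply/cvg_lim.
Unshelve. all: by end_near. Qed.

Lemma is_derive_quadratic (f : R -> R) (x df C : R) : 0 <= C ->
  (forall h, `|f (h + x) - f x - h * df| <= C * h ^+ 2) -> is_derive x 1 f df.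
Proof.
move=> C0 H; apply: is_derive_estimate => e e0.
exists (e / (C + 1)); first by rewrite divr_gt0// ltr_wpDl.
move=> h hd; rewrite [h *: 1]mulr1; apply: le_trans (H h) _.
rewrite -real_normK ?num_real// expr2 mulrA ler_wpM2r//.
move: hd; rewrite ltr_pdivlMr ?ltr_wpDl// => hd.
by apply: le_trans (ltW hd); rewrite mulrC ler_wpM2l// lerDl.
Qed.

Lemma is_derive_line (V : normedModType R) (f : V -> R) (x v : V) (df : R) :
  is_derive x v f df <-> is_derive (0 : R) 1 (fun t => f (x + t *: v)) df.
Proof.
have E : (fun h : R => h^-1 *: ((f \o shift x) (h *: v) - f x)) =
  (fun h : R => h^-1 *: (((fun t => f (x + t *: v)) \o shift 0) (h *: 1) -
     f (x + 0 *: v))).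
  apply/funext => h /=; rewrite scale0r addr0 [h *: 1]mulr1 addr0.
  by rewrite [h *: v + x]addrC.
split=> -[D <-]; split.
- by move: D; rewrite /derivable E.
- by rewrite /derive -E.
- by rewrite /derivable E.
- by rewrite /derive E.
Qed.

Lemma is_derive_line_at (V : normedModType R) (f : V -> R) (x v : V) (t df : R) :
  is_derive (x + t *: v) v f df -> is_derive t 1 (fun s => f (x + s *: v)) df.
Proof.
move=> /is_derive_line [D <-].
have E : (fun h : R => h^-1 *: (((fun s => f (x + s *: v)) \o shift t) (h *: 1) -
     f (x + t *: v))) =
  (fun h : R => h^-1 *: (((fun s => f (x + t *: v + s *: v)) \o shift 0) (h *: 1) -
     f (x + t *: v + 0 *: v))).
  apply/funext => h /=; rewrite scale0r !addr0 [h *: 1]mulr1.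
  by rewrite scalerDl [h *: v + _]addrC addrA.
by split; [move: D; rewrite /derivable E|rewrite /derive E].
Qed.

Lemma is_derive_comp (V : normedModType R) (phi : R -> R) (f : V -> R) (x v : V)
    (a b : R) :
  is_derive (f x) 1 phi a -> is_derive x v f b ->
  is_derive x v (fun y => phi (f y)) (a * b).
Proof.
move=> Dphi /is_derive_line Df; apply/is_derive_line.
have Dphi' : is_derive ((fun t : R => f (x + t *: v)) 0) 1 phi a.
  by rewrite scale0r addr0.
have := @is_derive1_comp _ phi (fun t : R => f (x + t *: v)) 0 a b Dphi' Df.
by [].
Qed.

End derivatives.

Lemma continuous_sum (K : numFieldType) (T : topologicalType) (I : Type)
    (r : seq I) (f : I -> T -> K) :
  (forall i, continuous (f i)) -> continuous (fun x => \sum_(i <- r) f i x).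
Proof.
move=> cf; elim: r => [|i r IHr].
  have -> : (fun x : T => \sum_(i <- [::]) f i x) = cst 0.
    by apply/funext => x; rewrite big_nil.
  exact: cst_continuous.
have -> : (fun x : T => \sum_(j <- i :: r) f j x) =
    (fun x => f i x + \sum_(j <- r) f j x).
  by apply/funext => x; rewrite big_cons.
by move=> x; exact: (cvgD (cf i x) (IHr x)).
Qed.

Section c1_functions.
Variables (R : realType) (n : nat).
Implicit Types (f : 'rV[R]_n -> R) (g : 'I_n -> 'rV[R]_n -> R) (x y v : 'rV[R]_n).
Local Notation e_ i := (delta_mx ord0 i : 'rV[R]_n).

(** The gradient is a parameter, so that the rules for sums, products and
compositions compute it in closed form. *)
Definition has_grad f g :=
  [/\ continuous f, forall i x, is_derive x (e_ i) f (g i x) &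
      forall i, continuous (g i)].

Lemma Ck1_has_grad k f : Ck k.+1 f -> has_grad f (fun i => partial i f).
Proof.
move=> [cf H]; split => // i.
  by move=> x; split => //; exact: (H i).1.
by case: (H i) => _; case: k {H} => [|k] [].
Qed.

Lemma has_grad_mvt f g i x (s : R) : has_grad f g ->
  exists2 t, `|t| <= `|s| & f (x + s *: e_ i) - f x = s * g i (x + t *: e_ i).
Proof.
move=> [_ D _].
pose F t := f (x + t *: e_ i).
have DF (t : R) : is_derive t 1 F (g i (x + t *: e_ i)).
  exact: is_derive_line_at.
have cF : continuous F.
  by move=> t; apply/differentiable_continuous/derivable1_diffP; case: (DF t).
have F0 : F 0 = f x by rewrite /F scale0r addr0.
have [s0|s0|s0] := ltgtP s 0.
- have [c] := @MVT _ F (fun t => g i (x + t *: e_ i)) s 0 s0 (fun t _ => DF t)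
    (continuous_subspaceT cF).
  rewrite in_itv/= F0 => /andP[sc c0] E; exists c.
    by rewrite !ltr0_norm//; lra.
  by apply/eqP; rewrite -[_ - _]opprB -/(F s) E; apply/eqP; ring.
- have [c] := @MVT _ F (fun t => g i (x + t *: e_ i)) 0 s s0 (fun t _ => DF t)
    (continuous_subspaceT cF).
  rewrite in_itv/= F0 => /andP[c0 cs] E; exists c.
    by rewrite !gtr0_norm//; lra.
  by rewrite -/(F s) E; ring.
- by exists 0; [rewrite normr0|rewrite s0 scale0r addr0 subrr mul0r].
Qed.

(** The partial sums of the coordinate expansion of [v] are the steps of the
path from [x] to [x + v] along the axes. *)
Definition restr (s : seq 'I_n) v : 'rV[R]_n := \sum_(i <- s) v ord0 i *: e_ i.

Lemma restrE s v k : uniq s -> restr s v ord0 k = if k \in s then v ord0 k else 0.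
Proof.
rewrite /restr summxE; elim: s => [|j s IHs]; first by rewrite big_nil.
move=> /= /andP[js us]; rewrite big_cons IHs// !mxE eqxx/= in_cons.
have [->|kj] := eqVneq k j; first by rewrite (negPf js) mulr1 addr0.
by rewrite eq_sym in kj; rewrite mulr0 add0r.
Qed.

Lemma restrT v : restr (index_enum _) v = v.
Proof.
apply/rowP => k; rewrite restrE ?index_enum_uniq//.
by rewrite mem_index_enum.
Qed.

Lemma has_grad_near f g x (e : R) : has_grad f g -> 0 < e -> exists2 d, 0 < d &
  forall v, (forall i, `|v ord0 i| < d) -> forall i, `|g i (x + v) - g i x| <= e.
Proof.
move=> [_ _ cg] e0.
have : \forall y \near x, forall i, `|g i x - g i y| <= e.
  apply: (@filter_forall _ _ (fun i (y : 'rV[R]_n) => `|g i x - g i y| <= e) (nbhs x) (nbhs_filter x)) => i.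
  by have /cvgrPdist_le := cg i x; apply.
move=> /nbhs_ballP[d /= d0 H]; exists d => // v vd i; rewrite distrC; apply: H.
by apply/rV_ballP => // j; rewrite !mxE opprD addNKr normrN.
Qed.

(** Moving one coordinate at a time, the mean value theorem along the axes and
the continuity of the partial derivatives give total differentiability. *)
Lemma has_grad_taylor f g x (e : R) : has_grad f g -> 0 < e ->
  exists2 d, 0 < d & forall v, (forall i, `|v ord0 i| < d) ->
    `|f (x + v) - f x - \sum_i v ord0 i * g i x| <= e * \sum_i `|v ord0 i|.
Proof.
move=> fg e0; have [d d0 H] := has_grad_near x fg e0.
exists d => // v vd.
suff /(_ (index_enum _)) : forall s : seq 'I_n, uniq s ->
    `|f (x + restr s v) - f x - \sum_(i <- s) v ord0 i * g i x| <=
      e * \sum_(i <- s) `|v ord0 i|.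
  by rewrite restrT; apply; exact: index_enum_uniq.
elim=> [|j s IHs]; first by rewrite /restr !big_nil addr0 subrr subr0 normr0 mulr0.
move=> /= /andP[js us]; rewrite !big_cons.
have [t tv E] := has_grad_mvt j (x + restr s v) (v ord0 j) fg.
have -> : x + restr (j :: s) v = x + restr s v + v ord0 j *: e_ j.
  by rewrite /restr big_cons -addrA [_ *: _ + _]addrC.
rewrite mulrDr.
rewrite (_ : _ - _ = v ord0 j * (g j (x + restr s v + t *: e_ j) - g j x) +
  (f (x + restr s v) - f x - \sum_(i <- s) v ord0 i * g i x)); last first.
  by rewrite mulrBr -E; ring.
apply: le_trans (ler_normD _ _) _; apply: lerD; last exact: IHs.
rewrite normrM mulrC ler_wpM2r// -addrA; apply: H => i.
rewrite !mxE restrE// eqxx/=.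
have [->|ij] := eqVneq i j; last by rewrite mulr0 addr0; case: ifP; rewrite ?normr0.
by rewrite (negPf js) mulr1 add0r; apply: le_lt_trans (vd j).
Qed.

Lemma has_grad_dir f g x y : has_grad f g ->
  is_derive x y f (\sum_i y ord0 i * g i x).
Proof.
move=> fg; apply: is_derive_estimate => e e0.
pose M := \sum_i `|y ord0 i| + 1.
have M0 : 0 < M by rewrite ltr_wpDl// sumr_ge0.
have [d d0 H] := has_grad_taylor x fg (divr_gt0 e0 M0).
exists (d / M); first by rewrite divr_gt0.
move=> h; rewrite ltr_pdivlMr// => hd.
have vd i : `|(h *: y) ord0 i| < d.
  rewrite mxE normrM; apply: le_lt_trans hd; rewrite ler_wpM2l// /M.
  rewrite (bigD1 i)//= -addrA lerDl addr_ge0// sumr_ge0//.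
have := H _ vd; rewrite [h *: y + x]addrC.
rewrite (eq_bigr (fun i => h * (y ord0 i * g i x))); last first.
  by move=> i _; rewrite mxE mulrA.
rewrite -mulr_sumr => /le_trans; apply.
rewrite (eq_bigr (fun i => `|h| * `|y ord0 i|)); last first.
  by move=> i _; rewrite mxE normrM.
rewrite -mulr_sumr (_ : e / M * _ = e * `|h| * ((\sum_i `|y ord0 i|) / M)); last first.
  by ring.
rewrite ler_piMr//; first by rewrite mulr_ge0// ltW.
by rewrite ler_pdivrMr// mul1r lerDl.
Qed.

Lemma has_grad_line f g x y (t : R) : has_grad f g ->
  is_derive t 1 (fun s : R => f (x + s *: y)) (\sum_i y ord0 i * g i (x + t *: y)).
Proof. by move=> fg; apply: is_derive_line_at; exact: has_grad_dir. Qed.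

Lemma has_grad_mvt_line f g x y : has_grad f g -> exists2 t, 0 <= t <= 1 &
  f (x + y) - f x = \sum_i y ord0 i * g i (x + t *: y).
Proof.
move=> fg; pose F (t : R) := f (x + t *: y).
have DF (t : R) : is_derive t 1 F (\sum_i y ord0 i * g i (x + t *: y)).
  exact: has_grad_line.
have cF : continuous F.
  by move=> t; apply/differentiable_continuous/derivable1_diffP; case: (DF t).
have [c] := @MVT _ F (fun t => \sum_i y ord0 i * g i (x + t *: y)) 0 1 ltr01
   (fun t _ => DF t) (continuous_subspaceT cF).
rewrite in_itv/= => /andP[c0 c1] E; exists c; first by rewrite !ltW.
by move: E; rewrite /F scale1r scale0r addr0 subr0 mulr1.
Qed.

Lemma has_grad_cst (c : R) : has_grad (fun=> c) (fun _ _ => 0).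
Proof.
by split => [|i x|i]; [exact: cst_continuous|exact: is_derive_cst|exact: cst_continuous].
Qed.

Lemma has_grad_coord j : has_grad (fun x => x ord0 j) (fun i _ => (i == j)%:R).
Proof.
split => [|i x|i]; [exact: coord_continuous| |exact: cst_continuous].
apply: is_derive_estimate => e e0; exists 1 => // h _.
rewrite !mxE eqxx/= [j == i]eq_sym addrK subrr normr0.
by apply: mulr_ge0 => //; exact: ltW.
Qed.

Lemma has_gradD f1 g1 f2 g2 : has_grad f1 g1 -> has_grad f2 g2 ->
  has_grad (fun x => f1 x + f2 x) (fun i x => g1 i x + g2 i x).
Proof.
move=> [c1 D1 h1] [c2 D2 h2]; split.
- by move=> x; exact: (cvgD (c1 x) (c2 x)).
- by move=> i x; exact: is_deriveD.
- by move=> i x; exact: (cvgD (h1 i x) (h2 i x)).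
Qed.

Lemma has_gradM f1 g1 f2 g2 : has_grad f1 g1 -> has_grad f2 g2 ->
  has_grad (fun x => f1 x * f2 x) (fun i x => f1 x * g2 i x + f2 x * g1 i x).
Proof.
move=> [c1 D1 h1] [c2 D2 h2]; split.
- by move=> x; exact: (cvgM (c1 x) (c2 x)).
- by move=> i x; exact: is_deriveM.
- move=> i x.
  exact: (cvgD (cvgM (c1 x) (h2 i x)) (cvgM (c2 x) (h1 i x))).
Qed.

Lemma has_grad_comp (phi dphi : R -> R) f g :
  (forall t : R, is_derive t 1 phi (dphi t)) -> continuous dphi ->
  has_grad f g -> has_grad (fun x => phi (f x)) (fun i x => dphi (f x) * g i x).
Proof.
move=> Dphi cdphi [c D h].
have cphi : continuous phi.
  by move=> t; apply/differentiable_continuous/derivable1_diffP; case: (Dphi t).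
split.
- by move=> x; apply: (@continuous_comp _ _ _ f phi); [exact: c|exact: cphi].
- by move=> i x; exact: is_derive_comp.
- move=> i x.
  have cd : dphi (f y) @[y --> x] --> dphi (f x).
    by apply: (@continuous_comp _ _ _ f dphi); [exact: c|exact: cdphi].
  exact: (cvgM cd (h i x)).
Qed.

Lemma has_grad_ext f g f' g' : (forall x, f x = f' x) ->
  (forall i x, g i x = g' i x) -> has_grad f g -> has_grad f' g'.
Proof.
move=> ff gg; have -> : f' = f by apply/funext.
by have -> : g' = g by apply/funext => i; apply/funext => x.
Qed.

(** The squared Euclidean norm is smooth at the origin and needs no square
root, so the estimates are phrased with it. *)
Definition sqn x : R := \sum_i x ord0 i ^+ 2.

Lemma sqn_ge0 x : 0 <= sqn x.
Proof. by apply: sumr_ge0 => i _; exact: sqr_ge0. Qed.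

Lemma has_grad_sqn : has_grad sqn (fun i x => 2 * x ord0 i).
Proof.
have cc i : continuous (fun x : 'rV[R]_n => x ord0 i) by exact: coord_continuous.
split.
- apply: continuous_sum => i x.
  exact: (cvgM (cc i x) (cc i x)).
- move=> i x; apply: is_derive_estimate => e e0; exists e => // h he.
  rewrite /sqn (bigD1 i)//= [X in _ - X - _](bigD1 i)//=.
  rewrite [X in _ + X - _ - _](eq_bigr (fun j => x ord0 j ^+ 2)); last first.
    by move=> j ji; rewrite !mxE eqxx/= (negPf ji) mulr0 add0r.
  rewrite !mxE !eqxx/= (_ : _ - _ = h ^+ 2); last by ring.
  by rewrite normrX expr2 ler_wpM2r// ltW.
- move=> i x; exact: (cvgM (cvg_cst _) (cc i x)).
Qed.

End c1_functions.

(** * Functions of bounded support *)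

Section bounded_support.
Variables (R : realType) (n : nat).
Implicit Types (f : 'rV[R]_n -> R) (g : 'I_n -> 'rV[R]_n -> R) (x y v z : 'rV[R]_n).
Local Notation e_ i := (delta_mx ord0 i : 'rV[R]_n).
Local Notation leb := (lebesgue_rV R n).

Definition cube (B : R) : set 'rV[R]_n := [set x | forall i, `|x ord0 i| <= B].

Definition cube_supp (B : R) f := forall x i, B < `|x ord0 i| -> f x = 0.

Lemma cube_suppN B f x : cube_supp B f -> ~ cube B x -> f x = 0.
Proof.
by move=> fB /existsNP[i /negP]; rewrite -ltNge; exact: fB.
Qed.

Lemma cube_compact B : compact (cube B).
Proof.
have := @rV_compact R n (fun=> `[- B, B]%classic) (fun=> @segment_compact R (- B) B).
by congr compact; apply/seteqP; split => x /= h i; have := h i;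
  rewrite in_itv/= ler_norml.
Qed.

Lemma measurable_cube B : measurable (cube B).
Proof.
rewrite (_ : cube B = \bigcap_(i in [set: 'I_n])
    (@rV_coord R n i @^-1` (`[(- B), B]%classic))).
  apply: fin_bigcap_measurable => // i _.
  by rewrite -[X in measurable X]setTI; apply: measurable_rV_coord => //;
    exact: measurable_itv.
by apply/seteqP; split => x /= h i; [move=> _; have := h i|have := h i I];
  rewrite /= in_itv/= ler_norml.
Qed.

Lemma lebesgue_cube B : 0 <= B -> leb (cube B) = ((2 * B) ^+ n)%:E.
Proof.
move=> B0.
have -> : cube B = [set x | forall i,
    (const_mx (- B) : 'rV[R]_n) ord0 i <= x ord0 i <= (const_mx B : 'rV[R]_n) ord0 i].
  by apply/seteqP; split => x /= h i; have := h i; rewrite !mxE ler_norml.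
rewrite lebesgue_rV_box; last by move=> i; rewrite !mxE; lra.
under eq_bigr do rewrite !mxE.
by rewrite prodr_const card_ord; congr ((_ ^+ _)%:E); lra.
Qed.

Lemma lebesgue_cube_fin B : (leb (cube B) < +oo)%E.
Proof.
apply: (@le_lt_trans _ _ (leb (cube `|B|))).
  apply: le_measure; rewrite ?inE; [exact: measurable_cube..|].
  by move=> x h i; apply: le_trans (h i) (ler_norm _).
by rewrite lebesgue_cube ?ltry.
Qed.

Lemma cube_supp_bounded B f : continuous f -> cube_supp B f ->
  exists2 M, 0 <= M & forall x, `|f x| <= M.
Proof.
move=> cf fB.
have /compact_bounded[M [_ HM]] : compact (f @` cube B).
  apply: continuous_compact; last exact: cube_compact.
  by apply: continuous_subspaceT.
exists (`|M| + 1) => [|x]; first by rewrite addr_ge0.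
have [xB|xB] := pselect (cube B x).
  apply: (HM (`|M| + 1)); last by exists x.
  by rewrite (le_lt_trans (ler_norm _))// ltrDl.
by rewrite (cube_suppN fB xB) normr0 addr_ge0.
Qed.

(** A Heine argument on a slightly larger cube: outside it both values vanish
as soon as the increment is smaller than [1]. *)
Lemma cube_supp_unif_continuous B f (e : R) : continuous f -> cube_supp B f ->
  0 < e -> exists2 d, 0 < d &
    forall x v, (forall i, `|v ord0 i| < d) -> `|f (x + v) - f x| <= e.
Proof.
move=> cf fB e0.
have K : compact (cube (B + 1)) by exact: cube_compact.
have := (compact_near_coveringP (cube (B + 1))).1 K R (0 : R)^'+
  (fun d x => forall v, (forall i, `|v ord0 i| < d) -> `|f (x + v) - f x| <= e) _.
have Hcov : forall x : 'rV[R]_n, cube (B + 1) x ->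
   \forall x' \near x & i \near (0 : R)^'+,
     forall v, (forall i0, `|v ord0 i0| < i) -> `|f (x' + v) - f x'| <= e.
  move=> x _.
  have e20 : 0 < e / 2 by rewrite divr_gt0.
  have /cvgrPdist_le/(_ _ e20) := cf x.
  move=> /nbhs_ballP[d /= d0 Hd].
  have d20 : 0 < d / 2 by rewrite divr_gt0.
  exists (ball x (d / 2), [set t | t < d / 2]).
    split; first by apply/nbhs_ballP; exists (d / 2).
    by apply: nbhs_right_lt.
  move=> [x' t] /= [/(rV_ballP _ _ d20) xx' td] v vt.
  have h1 : `|f x - f x'| <= e / 2.
    apply: Hd; apply/rV_ballP => // i; apply: lt_trans (xx' i) _; lra.
  have h2 : `|f x - f (x' + v)| <= e / 2.
    apply: Hd; apply/rV_ballP => // i; rewrite mxE opprD addrA.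
    by apply: le_lt_trans (ler_normB _ _) _; have := xx' i; have := vt i; lra.
  rewrite (_ : _ - _ = (f x - f x') - (f x - f (x' + v))); last by lra.
  by apply: le_trans (ler_normB _ _) _; lra.
move=> /(_ _ Hcov) H.
have : \forall d \near (0 : R)^'+, [/\ 0 < d, d < 1 & cube (B + 1) `<=`
  (fun x => forall v, (forall i, `|v ord0 i| < d) -> `|f (x + v) - f x| <= e)].
  near=> d; split.
  - by near: d; exact: nbhs_right_gt.
  - by near: d; exact: nbhs_right_lt.
  - by near: d; exact: H.
move=> /filter_ex[d [d0 d1 Hd]]; exists d => // x v vd.
have [xB|xB] := pselect (cube (B + 1) x); first exact: Hd.
have f0 : f x = 0.
  apply: (cube_suppN fB); apply: contra_not xB => h i.
  by apply: le_trans (h i) _; rewrite lerDl.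
move: xB => /existsNP[i /negP]; rewrite -ltNge => xB.
have := fB (x + v) i; rewrite mxE f0 subr0 => ->; first by rewrite normr0 ltW.
have : `|x ord0 i| <= `|x ord0 i + v ord0 i| + `|v ord0 i|.
  by rewrite -{1}(addrK (v ord0 i) (x ord0 i)) ler_normB.
by have := vd i; lra.
Unshelve. all: by end_near. Qed.

Lemma has_grad_supp B f g i : has_grad f g -> cube_supp B f -> cube_supp B (g i).
Proof.
move=> [cf D cg] fB x k xk.
have D0 : is_derive x (e_ i) f 0.
  apply: (near_eq_is_derive (f := cst 0) _ (is_derive_cst (0 : R) x (e_ i))).
  have := @coord_continuous R 1 n ord0 k x.
  move=> /cvg_norm /cvgrPdist_lt; have d0 : 0 < `|x ord0 k| - B by rewrite subr_gt0.
  move=> /(_ _ d0); apply: filterS => y /= h.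
  rewrite (fB y k)//; move: h; rewrite ltr_norml => /andP[_]; lra.
by have := D i x => -[_ <-]; case: D0 => _ ->.
Qed.

Lemma cube_supp_integrable B (M : R) f : measurable_fun setT f ->
  (forall x, `|f x| <= M) -> cube_supp B f -> leb.-integrable setT (EFin \o f).
Proof.
move=> mf fM fB.
have : leb.-integrable setT (EFin \o (fun x => M * \1_(cube B) x)).
  rewrite [X in _.-integrable _ X](_ : _ = (fun x => M%:E * (\1_(cube B) x)%:E)%E);
    last by apply/funext => x; rewrite /= EFinM.
  have mB := measurable_cube B.
  apply: integrableZl => //; apply/integrableP; split.
    by apply/measurable_EFinP; exact: measurable_indic.
  under eq_integral do rewrite gee0_abs ?lee_fin//.
  by rewrite integral_indic// setIT lebesgue_cube_fin.
apply: le_integrable => //; first exact/measurable_EFinP.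
move=> x _; rewrite /= lee_fin indicE.
have [xB|xB] := pselect (cube B x).
  by rewrite mem_set// mulr1 (le_trans (fM x))// ler_norm.
by rewrite (cube_suppN fB xB) normr0.
Qed.

Lemma integral_translate (F : 'rV[R]_n -> \bar R) z : measurable_fun setT F ->
  (\int[leb]_x F (x + z)%R = \int[leb]_x F x)%E.
Proof.
move=> mF; rewrite [LHS]integralE [RHS]integralE; congr (_ - _)%E.
  transitivity (\int[leb]_x (F^\+%E) (x + z)%R)%E; first by apply: eq_integral => x _; rewrite !funeposE.
  by apply: ge0_integral_translate => //; exact: measurable_funepos.
transitivity (\int[leb]_x (F^\-%E) (x + z)%R)%E; first by apply: eq_integral => x _; rewrite !funenegE.
by apply: ge0_integral_translate => //; exact: measurable_funeneg.
Qed.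

(** Translation invariance makes the integral of each difference quotient
vanish. *)
Lemma integral_partial0 B f g i : has_grad f g -> cube_supp B f ->
  \int[leb]_x g i x = 0.
Proof.
move=> fg fB; have [cf D cg] := fg.
have giB := has_grad_supp i fg fB.
have [M M0 HM] := cube_supp_bounded (cg i) giB.
have [Mf Mf0 HMf] := cube_supp_bounded cf fB.
have mf : measurable_fun setT f by exact: continuous_measurable_rV.
have mg : measurable_fun setT (g i) by exact: continuous_measurable_rV.
pose q (k : nat) x := k.+1%:R * (f (x + k.+1%:R^-1 *: e_ i) - f x).
have qE k x : exists2 t, `|t| <= 1 & q k x = g i (x + t *: e_ i).
  have [t tk E] := has_grad_mvt i x k.+1%:R^-1 fg; exists t.
    by apply: le_trans tk _; rewrite ger0_norm// invf_le1// ler1n.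
  by rewrite /q E mulrA mulfV ?mul1r// pnatr_eq0.
have mft (z : 'rV[R]_n) : measurable_fun setT (fun x : 'rV[R]_n => f (x + z)).
  by apply: measurableT_comp => //; exact: measurable_rV_translate.
have mq k : measurable_fun setT (q k).
  by apply: measurable_funM => //; apply: measurable_funB.
have iF : leb.-integrable setT (EFin \o f) by exact: (cube_supp_integrable mf HMf fB).
have q0 k : (\int[leb]_x (q k x)%:E = 0)%E.
  have B0 : B <= `|B| + 1 by rewrite (le_trans (ler_norm _))// lerDl.
  have iFz : leb.-integrable setT
      (EFin \o (fun x : 'rV[R]_n => f (x + k.+1%:R^-1 *: e_ i))).
    apply: (@cube_supp_integrable (B + 1) Mf) => // x j xj.
    apply: (fB _ j); rewrite !mxE/=.
    have : `|k.+1%:R^-1 * (j == i)%:R| <= 1 :> R.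
      rewrite normrM ger0_norm// mulr_ile1//; first by rewrite invf_le1// ler1n.
      by case: (j == i); rewrite ?normr1 ?normr0.
    have := ler_normB (x ord0 j + k.+1%:R^-1 * (j == i)%:R) (k.+1%:R^-1 * (j == i)%:R).
    by rewrite addrK; lra.
  under eq_integral do rewrite EFinM EFinB.
  rewrite integralZl//; last exact: integrableB.
  rewrite integralB//=.
  have -> : (\int[leb]_x (f (x + (k.+1%:R^-1 *: e_ i)%R)%R)%:E =
      \int[leb]_x (f x)%:E)%E.
    by apply: (@integral_translate (EFin \o f)); exact/measurable_EFinP.
  by rewrite subee ?mule0//; exact: integrable_fin_num.
have cvq x : (q k x)%:E @[k --> \oo] --> (g i x)%:E.
  apply: cvg_EFin; first exact: nearW.
  rewrite /comp /=.
  have [Dx Ex] := D i x.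
  move: Dx => /cvg_ex[/= l Hl].
  have <- : l = g i x by rewrite -Ex; apply/esym/cvg_lim.
  move/cvgr_dnbhsP : Hl => /(_ (fun k => k.+1%:R^-1)) H.
  rewrite (_ : (fun k => q k x) = (fun k : nat => (k.+1%:R^-1 : R)^-1 *:
     (f (k.+1%:R^-1 *: e_ i + x) - f x))).
    by apply: H; split; [by move=> k; rewrite invr_eq0 pnatr_eq0|exact: cvg_harmonic].
  by apply/funext => k; rewrite invrK [X in f X]addrC.
have iG : leb.-integrable setT (EFin \o (fun x => M * \1_(cube (`|B| + 1)) x)).
  apply: (@cube_supp_integrable (`|B| + 1) M) => //.
  - by apply: measurable_funM => //; apply: measurable_indic; exact: measurable_cube.
  - move=> x; rewrite indicE normrM ger0_norm//.
    by case: (_ \in _); rewrite ?normr1 ?normr0 ?mulr1 ?mulr0.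
  - move=> x j h; rewrite indicE memNset ?mulr0// => /(_ j).
    by rewrite leNgt h.
have dom : \forall x \ae leb, forall k, setT x ->
    (`|(q k x)%:E| <= (EFin \o (fun x => M * \1_(cube (`|B| + 1)) x)%R) x)%E.
  apply: aeW => x k _; rewrite /= lee_fin indicE.
  have [t t1 ->] := qE k x.
  have [xB|xB] := pselect (cube (`|B| + 1) x); first by rewrite mem_set// mulr1.
  rewrite memNset// mulr0; move: xB => /existsNP[j /negP]; rewrite -ltNge => xB.
  rewrite (giB _ j) ?normr0// !mxE/=.
  have : `|t * (j == i)%:R| <= 1.
    rewrite normrM mulr_ile1//.
    by case: (j == i); rewrite ?normr1 ?normr0.
  have := ler_normB (x ord0 j + t * (j == i)%:R) (t * (j == i)%:R).
  by rewrite addrK; have := ler_norm B; lra.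
have [_ _ C] := @dominated_convergence _ _ _ leb setT measurableT
  (fun k x => (q k x)%:E) (fun x => (g i x)%:E) _
  (fun k => (measurable_EFinP _ _).2 (mq k)) ((measurable_EFinP _ _).2 mg)
  (aeW _ (fun x _ => cvq x)) iG dom.
rewrite /Rintegral; apply: (congr1 fine (y := 0%E)).
have : (fun k => \int[leb]_x (q k x)%:E)%E @ \oo --> 0%E.
  rewrite (_ : (fun k => _) = cst 0%E); first exact: cvg_cst.
  by apply/funext => k; exact: q0.
by move: C => /cvg_lim <- // /cvg_lim ->.
Qed.

End bounded_support.

(** * Integration against a density, bounded functions *)

Section density.
Context d (T : measurableType d) (R : realType).
Variables (leb mu : {measure set T -> \bar R}) (w : T -> R).
Hypotheses (mw : measurable_fun setT w) (w0 : forall x, 0 <= w x).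
Hypothesis muE : forall A, measurable A ->
  mu A = (\int[leb]_(x in A) (w x)%:E)%E.

Import HBNNSimple.

(** Simple functions reduce the change of measure to indicators. *)
Let density_nnsfun (h : {nnsfun T >-> R}) :
  (\int[mu]_x (h x)%:E = \int[leb]_x ((h x)%:E * (w x)%:E))%E.
Proof.
transitivity (\sum_(k \in range h) (k%:E * mu (h @^-1` [set k])))%E.
  under eq_integral do rewrite fimfunE -fsumEFin//.
  rewrite ge0_integral_fsum//.
  - apply: eq_fsbigr => r _; rewrite integralZl_indic_nnsfun//.
    by rewrite integral_indic// setIT.
  - by move=> r; apply/measurable_EFinP; exact: measurable_funM.
  - by move=> r x _; rewrite EFinM nnfun_muleindic_ge0.
transitivity (\int[leb]_x
    (\sum_(k \in range h) ((k * \1_(h @^-1` [set k]) x)%:E * (w x)%:E)))%E; last first.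
  apply: eq_integral => x _; rewrite -ge0_mule_fsuml; last first.
    by move=> r; rewrite EFinM nnfun_muleindic_ge0.
  by rewrite fsumEFin// -fimfunE.
rewrite ge0_integral_fsum//; last 2 first.
- move=> r; apply: emeasurable_funM; apply/measurable_EFinP => //.
  exact: measurable_funM.
- move=> r x _; apply: mule_ge0; last by rewrite lee_fin.
  by rewrite EFinM nnfun_muleindic_ge0.
apply: eq_fsbigr => r /set_mem[x _ <-].
rewrite muE//.
under [RHS]eq_integral do rewrite EFinM -muleA.
rewrite ge0_integralZl//; last 3 first.
- apply: emeasurable_funM; apply/measurable_EFinP => //.
- by move=> y _; apply: mule_ge0; rewrite lee_fin.
- by rewrite lee_fin.
congr (_ * _)%E; rewrite integral_mkcond; apply: eq_integral => y _.
rewrite patchE indicE; case: ifPn => yA; first by rewrite mul1e.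
by rewrite mul0e.
Qed.

Lemma ge0_integral_density (f : T -> \bar R) : measurable_fun setT f ->
  (forall x, (0 <= f x)%E) ->
  (\int[mu]_x f x = \int[leb]_x (f x * (w x)%:E))%E.
Proof.
move=> mf f0; pose f_ := nnsfun_approx measurableT mf.
have cf x : (f_ n x)%:E @[n --> \oo] --> f x by exact: cvg_nnsfun_approx.
transitivity (limn (fun n => \int[mu]_x (f_ n x)%:E)%E).
  rewrite -monotone_convergence//.
  - by apply: eq_integral => x _; apply/esym/cvg_lim.
  - by move=> n; exact/measurable_EFinP.
  - by move=> n x _; rewrite lee_fin.
  - by move=> x _ a b ab; rewrite lee_fin; exact/lefP/nd_nnsfun_approx.
transitivity (limn (fun n => \int[leb]_x ((f_ n x)%:E * (w x)%:E))%E).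
  by congr (limn _); apply/funext => n; exact: density_nnsfun.
rewrite -monotone_convergence//.
- apply: eq_integral => x _; apply/cvg_lim => //.
  have [->|wx] := eqVneq (w x) 0.
    by rewrite mule0; under eq_fun do rewrite mule0; exact: cvg_cst.
  by apply: cvgeZr.
- by move=> n; apply: emeasurable_funM; exact/measurable_EFinP.
- by move=> n x _; apply: mule_ge0; rewrite lee_fin.
- move=> x _ a b ab; apply: lee_wpmul2r; rewrite lee_fin//.
  exact/lefP/nd_nnsfun_approx.
Qed.

Lemma integral_density (f : T -> R) : measurable_fun setT f ->
  (\int[mu]_x (f x)%:E = \int[leb]_x (f x * w x)%:E)%E.
Proof.
move=> mf; rewrite [LHS]integralE [RHS]integralE.
have mF : measurable_fun setT (EFin \o f) by exact/measurable_EFinP.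
congr (_ - _)%E.
  rewrite ge0_integral_density//; last exact: measurable_funepos.
  apply: eq_integral => x _; rewrite !funeposE.
  by rewrite -!EFin_max -EFinM maxr_pMl ?mul0r.
rewrite ge0_integral_density//; last exact: measurable_funeneg.
apply: eq_integral => x _; rewrite !funenegE.
by rewrite -!EFinN -!EFin_max -EFinM maxr_pMl ?mul0r ?mulNr.
Qed.

End density.

Section bounded_measurable.
Context d (T : measurableType d) (R : realType) (mu : probability T R).
Implicit Types f g h : T -> R.

Definition bounded_mfun f :=
  measurable_fun setT f /\ exists M, forall x, `|f x| <= M.

Lemma bounded_mfun_cst c : bounded_mfun (fun=> c).
Proof. by split; [exact: measurable_cst|exists `|c|]. Qed.

Lemma bounded_mfunD f g : bounded_mfun f -> bounded_mfun g ->
  bounded_mfun (fun x => f x + g x).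
Proof.
move=> [mf [M fM]] [mg [N gN]]; split; first exact: measurable_funD.
by exists (M + N) => x; apply: le_trans (ler_normD _ _) (lerD _ _).
Qed.

Lemma bounded_mfunM f g : bounded_mfun f -> bounded_mfun g ->
  bounded_mfun (fun x => f x * g x).
Proof.
move=> [mf [M fM]] [mg [N gN]]; split; first exact: measurable_funM.
by exists (M * N) => x; rewrite normrM; apply: ler_pM.
Qed.

Lemma bounded_mfunZ c f : bounded_mfun f -> bounded_mfun (fun x => c * f x).
Proof. by move=> bf; apply: bounded_mfunM => //; exact: bounded_mfun_cst. Qed.

Lemma bounded_mfun_norm f : bounded_mfun f -> bounded_mfun (fun x => `|f x|).
Proof.
move=> [mf [M fM]]; split; first exact: measurableT_comp.
by exists M => x; rewrite normr_id.
Qed.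

Lemma bounded_mfun_sum (I : Type) (r : seq I) (F : I -> T -> R) :
  (forall i, bounded_mfun (F i)) -> bounded_mfun (fun x => \sum_(i <- r) F i x).
Proof.
move=> bF; elim: r => [|i r IHr].
  under eq_fun do rewrite big_nil; exact: bounded_mfun_cst.
by under eq_fun do rewrite big_cons; exact: bounded_mfunD.
Qed.

Lemma bounded_mfun_expR f : bounded_mfun f -> bounded_mfun (fun x => expR (f x)).
Proof.
move=> [mf [M fM]]; split; first exact: measurableT_comp.
exists (expR M) => x; rewrite ger0_norm ?expR_ge0// ler_expR.
exact: le_trans (ler_norm _) (fM x).
Qed.

Lemma bounded_mfun_integrable f : bounded_mfun f ->
  mu.-integrable setT (EFin \o f).
Proof.
move=> [mf [M fM]]; apply: measurable_bounded_integrable => //.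
  by rewrite -ge0_fin_numE//; exact: fin_num_measure.
exists M; split; first exact: num_real.
by move=> y My x _; apply: le_trans (fM x) (ltW My).
Qed.

Lemma bounded_integralE f : bounded_mfun f ->
  (\int[mu]_x (f x)%:E = (\int[mu]_x f x)%:E)%E.
Proof.
move=> bf; rewrite /Rintegral fineK//.
by apply: integrable_fin_num => //; exact: bounded_mfun_integrable.
Qed.

Lemma bounded_RintegralD f g : bounded_mfun f -> bounded_mfun g ->
  \int[mu]_x (f x + g x) = \int[mu]_x f x + \int[mu]_x g x.
Proof. by move=> bf bg; apply: RintegralD => //; exact: bounded_mfun_integrable. Qed.

Lemma bounded_RintegralZ c f : bounded_mfun f ->
  \int[mu]_x (c * f x) = c * \int[mu]_x f x.
Proof. by move=> bf; apply: RintegralZl => //; exact: bounded_mfun_integrable. Qed.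

Lemma bounded_le_Rintegral f g : bounded_mfun f -> bounded_mfun g ->
  (forall x, f x <= g x) -> \int[mu]_x f x <= \int[mu]_x g x.
Proof.
by move=> bf bg fg; apply: le_Rintegral => //; exact: bounded_mfun_integrable.
Qed.

End bounded_measurable.

(** * From Prekopa-Leindler to a weighted Poincare inequality *)

Section exponential_bounds.
Variable R : realType.

(** Taylor bounds with non-optimal constants; each follows from
[1 + x <= expR x]. *)
Lemma expR_ge_quadratic (s : R) : `|s| <= 1 -> 1 + s + s ^+ 2 / 4 <= expR s.
Proof.
rewrite ler_norml => /andP[s1 s2].
have h := expR_ge1Dx (s / 2).
have -> : expR s = expR (s / 2) * expR (s / 2) by rewrite -expRD; congr expR; lra.
have h0 : 0 <= 1 + s / 2 by lra.
by apply: le_trans (ler_pM h0 h0 h h); rewrite le_eqVlt; apply/orP; left; apply/eqP; field.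
Qed.

Lemma expR_le_linear (s : R) : 0 <= s -> s <= 1 / 2 -> expR s <= 1 + 2 * s.
Proof.
move=> s0 s1; have h := expR_ge1Dx (- s).
have E : expR s * expR (- s) = 1 by rewrite -expRD subrr expR0.
have p := expR_gt0 s; have := expR_gt0 (- s).
move: (expR s) (expR (- s)) h E p => a b h E p q.
have h1 : a * (1 - s) <= 1 by rewrite -E; apply: ler_wpM2l; [exact: ltW|lra].
have : 1 <= (1 + 2 * s) * (1 - s) by nra.
move=> h2; have : a * (1 - s) <= (1 + 2 * s) * (1 - s) by lra.
by rewrite ler_pM2r//; lra.
Qed.

End exponential_bounds.

Lemma continuous_bounded_mfun (R : realType) n (B : R) (f : 'rV[R]_n -> R) :
  continuous f -> cube_supp B f -> bounded_mfun f.
Proof.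
move=> cf fB; split; first exact: continuous_measurable_rV.
by have [M _ HM] := cube_supp_bounded cf fB; exists M.
Qed.

Lemma sqr_sum_le (R : realDomainType) (s t : R) :
  (s + t) ^+ 2 <= 2 * s ^+ 2 + 2 * t ^+ 2.
Proof. by have := sqr_ge0 (s - t); nra. Qed.

Section poincare_from_prekopa_leindler.
Variables (R : realType) (n : nat) (mu : probability 'rV[R]_n R).
Variables (V W : 'rV[R]_n -> R) (Z K : R).
Hypotheses (Z0 : 0 < Z) (K0 : 0 < K) (cV : continuous V) (cW : continuous W).
Hypothesis muV : has_gibbs_density mu V Z.
Hypothesis VW : forall x, V x <= W x.
Hypothesis midW : forall x y,
  W (2^-1 *: (x + y)) <= (W x + W y) / 2 - K / 8 * sqn (x - y).

Let om x := expR (V x - W x).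

Let om0 x : 0 <= om x. Proof. exact: expR_ge0. Qed.

Let bom : bounded_mfun om.
Proof.
have mV : measurable_fun setT V by exact: continuous_measurable_rV.
have mW : measurable_fun setT W by exact: continuous_measurable_rV.
split; first by apply: measurableT_comp => //; exact: measurable_funB.
exists 1 => x; rewrite ger0_norm// /om -expR0 ler_expR subr_le0; exact: VW.
Qed.

Let E h := \int[mu]_x (h x * om x).

Let bE h : bounded_mfun h -> bounded_mfun (fun x => h x * om x).
Proof. by move=> bh; exact: bounded_mfunM. Qed.

Let ED h k : bounded_mfun h -> bounded_mfun k ->
  E (fun x => h x + k x) = E h + E k.
Proof.
move=> bh bk; rewrite /E -bounded_RintegralD; [|exact: bE|exact: bE].
by congr Rintegral; apply/funext => x; rewrite mulrDl.
Qed.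

Let EZ c h : bounded_mfun h -> E (fun x => c * h x) = c * E h.
Proof.
move=> bh; rewrite /E -bounded_RintegralZ; last exact: bE.
by congr Rintegral; apply/funext => x; rewrite mulrA.
Qed.

Let Ele h k : bounded_mfun h -> bounded_mfun k -> (forall x, h x <= k x) ->
  E h <= E k.
Proof.
move=> bh bk hk; apply: bounded_le_Rintegral; [exact: bE|exact: bE|].
by move=> x; apply: ler_wpM2r.
Qed.

(** Transcription of Prekopa-Leindler to the measure [om mu], whose Lebesgue
density is proportional to [expR (- W)]. *)
Let prekopa_leindler_om (a b th : 'rV[R]_n -> R) :
  bounded_mfun a -> bounded_mfun b -> bounded_mfun th ->
  (forall x y, a x + b y <=
     2 * th (2^-1 *: (x + y)) + K / 4 * sqn (x - y)) ->
  E (fun x => expR (a x)) * E (fun x => expR (b x)) <=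
  E (fun x => expR (th x)) ^+ 2.
Proof.
move=> ba bb bth H.
have mV : measurable_fun setT V by exact: continuous_measurable_rV.
have mden : measurable_fun setT (fun x : 'rV[R]_n => Z^-1 * expR (- V x)).
  apply: measurable_funM => //; apply: measurableT_comp => //.
  exact: measurableT_comp.
have den0 x : 0 <= Z^-1 * expR (- V x) by rewrite mulr_ge0 ?expR_ge0 ?invr_ge0 ?ltW.
pose F (h : 'rV[R]_n -> R) x : \bar R :=
  (expR (h x) * om x * (Z^-1 * expR (- V x)))%:E.
have FE h : bounded_mfun h -> (E (fun x => expR (h x)))%:E =
    (\int[lebesgue_rV R n]_x F h x)%E.
  move=> bh; have bh' : bounded_mfun (fun x => expR (h x)) by exact: bounded_mfun_expR.
  rewrite /E -bounded_integralE; last exact: bE.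
  rewrite (@ge0_integral_density _ _ _ (lebesgue_rV R n) mu _ mden den0)//.
  - by apply/measurable_EFinP; case: (bE bh').
  - by move=> x; rewrite lee_fin mulr_ge0// expR_ge0.
have mF h : bounded_mfun h -> measurable_fun setT (F h).
  move=> bh; apply/measurable_EFinP; apply: measurable_funM => //.
  by case: (bE (bounded_mfun_expR bh)).
have F0 h x : (0 <= F h x)%E.
  by rewrite lee_fin !mulr_ge0// ?expR_ge0// invr_ge0 ltW.
rewrite -lee_fin expr2 !EFinM (FE _ ba) (FE _ bb) (FE _ bth).
apply: prekopa_leindler => //; try exact: mF.
move=> x y; rewrite -!EFinM lee_fin.
have FFE h z : expR (h z) * om z * (Z^-1 * expR (- V z)) = Z^-1 * expR (h z - W z).
  by rewrite mulrCA /om -mulrA -!expRD; congr (_ * expR _); lra.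
rewrite !FFE mulrACA [leRHS]mulrACA ler_pM2l ?mulr_gt0 ?invr_gt0//.
rewrite -!expRD ler_expR.
have := midW x y; have := H x y; lra.
Qed.

(** Test [prekopa_leindler_om] on [t f] and [- t f]: to second order in [t]
this is the Poincare inequality. Crude Taylor bounds only cost a factor, and
with them a single small [t] suffices. *)
Lemma weighted_poincare (B : R) f g : has_grad f g -> cube_supp B f ->
  exists m, \int[mu]_x ((f x - m) ^+ 2 * expR (V x - W x)) <=
    8 / K * \int[mu]_x ((\sum_i g i x ^+ 2) * expR (V x - W x)).
Proof.
move=> fg fB; have [cf _ cg] := fg.
have bf : bounded_mfun f by exact: continuous_bounded_mfun fB.
have bg i : bounded_mfun (g i).
  by apply: (@continuous_bounded_mfun _ _ B) => //; exact: has_grad_supp fg fB.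
have bc (c : R) : bounded_mfun (fun _ : 'rV[R]_n => c) by exact: bounded_mfun_cst.
pose N := E (fun=> 1); pose m := E f / N.
exists m; rewrite -/(E (fun x => (f x - m) ^+ 2)) -/(E (fun x => \sum_i g i x ^+ 2)).
pose F x := f x - m.
have bF : bounded_mfun F by apply: bounded_mfunD => //; exact: bounded_mfun_cst.
have b2 (h : 'rV[R]_n -> R) : bounded_mfun h -> bounded_mfun (fun x => h x ^+ 2).
  by move=> bh; exact: bounded_mfunM.
have Ec c : E (fun=> c) = c * N.
  by rewrite -EZ; [under [in RHS]eq_fun do rewrite mulr1|exact: bounded_mfun_cst].
have N0 : 0 <= N.
  have := @Ele (fun=> 0) (fun=> 1) (bc 0) (bc 1)
    (fun=> ler01); by rewrite Ec mul0r.
have [M [M0 fM]] : exists M, 0 <= M /\ forall x, `|f x| <= M.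
  by have [M M0 HM] := cube_supp_bounded cf fB; exists M.
have [M1 M10 FM1] : exists2 M1, 0 < M1 & forall x, `|F x| <= M1.
  exists (M + `|m| + 1) => [|x]; first by rewrite ltr_wpDl// addr_ge0.
  by apply: le_trans (ler_normB _ _) _; have := fM x; lra.
have EF : E F = 0.
  rewrite (ED bf (bc _)) Ec mulNr /m.
  have [N00|N00] := eqVneq N 0; last by rewrite divfK// subrr.
  rewrite N00 mulr0 subr0; apply/eqP; rewrite eq_le; apply/andP; split.
    have := Ele bf (bc M) (fun x => le_trans (ler_norm _) (fM x)).
    by rewrite Ec N00 mulr0.
  have := Ele (bc (- M)) bf _.
  by rewrite Ec N00 mulr0; apply => x; have := fM x; rewrite ler_norml => /andP[].
set A := E (fun x => F x ^+ 2); set D := E (fun x => \sum_i g i x ^+ 2).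
have bD : bounded_mfun (fun x => \sum_i g i x ^+ 2).
  by apply: bounded_mfun_sum => i; exact: b2.
suff key e : 0 < e -> A <= 8 / K * D + e.
  by apply/ler_addgt0Pr => e e0; exact: key.
move=> e0.
(* [eta] is the tolerated oscillation of the gradient on the scale [dl] *)
have [eta eta0 etae] : exists2 eta : R, 0 < eta & 8 / K * (n%:R * eta ^+ 2 * N) <= e.
  pose c := 8 / K * (n%:R * N) + 1.
  have p0 : 0 <= 8 / K * (n%:R * N).
    by apply: mulr_ge0; [rewrite divr_ge0// ltW|rewrite mulr_ge0].
  have c0 : 0 < c by rewrite ltr_wpDl.
  exists (Num.sqrt (e / c)); first by rewrite sqrtr_gt0 divr_gt0.
  rewrite sqr_sqrtr; last by rewrite divr_ge0 ?ltW.
  rewrite (_ : 8 / K * _ = (8 / K * (n%:R * N)) * (e / c)); last by ring.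
  rewrite mulrCA -[leRHS]mulr1 ler_wpM2l ?(ltW e0)//.
  by rewrite ler_pdivrMr// mul1r /c lerDl.
have [dl dl0 Hdl] : exists2 dl : R, 0 < dl & forall i (x v : 'rV[R]_n),
    (forall j, `|v ord0 j| < dl) -> `|g i (x + v) - g i x| <= eta.
  have /choice[d Hd] : forall i, exists d : R, 0 < d /\ forall x v : 'rV[R]_n,
    (forall j, `|v ord0 j| < d) -> `|g i (x + v) - g i x| <= eta.
    move=> i; have [d d0 Hd] := cube_supp_unif_continuous (cg i) (has_grad_supp i fg fB) eta0.
    by exists d.
  exists (\big[Num.min/1]_i d i).
    by apply: lt_bigmin => // i _; case: (Hd i).
  move=> i x v vd; apply: (Hd i).2 => j; apply: lt_le_trans (vd j) _.
  exact: bigmin_le_cond.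
pose S x := \sum_i (`|g i x| + eta) ^+ 2.
have S0 x : 0 <= S x by apply: sumr_ge0 => i _; exact: sqr_ge0.
have bS : bounded_mfun S.
  apply: bounded_mfun_sum => i; apply: b2; apply: bounded_mfunD.
    exact: bounded_mfun_norm.
  exact: bounded_mfun_cst.
have [MS [MS0 HMS]] : exists MS, 0 < MS /\ forall x, S x <= MS.
  have [_ [MS HMS]] := bS; exists (`|MS| + 1); split; first by rewrite ltr_wpDl.
  move=> x; apply: le_trans (ler_norm _) _; apply: le_trans (HMS x) _.
  by apply: le_trans (ler_norm _) _; rewrite lerDl.
(* [t] is small enough for both Taylor bounds, and for the quadratic term to beat
   the oscillation of [t F] over distances larger than [dl] *)
have [t [t0 tM1 tS tM]] : exists t : R,
   [/\ 0 < t, t * M1 <= 1, t ^+ 2 * MS <= K & 2 * t * M <= K * dl ^+ 2].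
  have M20 : 0 < 2 * M + 1 by rewrite ltr_wpDl// mulr_ge0.
  pose t := Num.min (Num.min 1 M1^-1) (Num.min (K / MS) (K * dl ^+ 2 / (2 * M + 1))).
  have t0 : 0 < t.
    by rewrite /t !lt_min ltr01 invr_gt0 M10 !divr_gt0// mulr_gt0// exprn_gt0.
  have t1 : t <= 1 by rewrite /t !ge_min lexx.
  exists t; split => //.
  - rewrite -ler_pdivlMr// div1r; by rewrite /t !ge_min lexx !orbT.
  - rewrite -ler_pdivlMr//; apply: (@le_trans _ _ t).
      by rewrite expr2 ler_piMr// ltW.
    by rewrite /t !ge_min lexx !orbT.
  - apply: (@le_trans _ _ (t * (2 * M + 1))); first by nra.
    by rewrite -ler_pdivlMr// /t !ge_min lexx !orbT.
(* [2 th z] bounds [t (F x - F y) - K / 4 |x - y|^2] over all pairs of midpoint [z] *)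
pose th x := t ^+ 2 / (2 * K) * S x.
have bth : bounded_mfun th by exact: bounded_mfunZ.
have btF c : bounded_mfun (fun x => c * F x) by exact: bounded_mfunZ.
have PLH x y : t * F x + - t * F y <=
    2 * th (2^-1 *: (x + y)) + K / 4 * sqn (x - y).
  set z := 2^-1 *: (x + y); set w := 2^-1 *: (x - y).
  have xE : x = z + w.
    by apply/rowP => i; rewrite !mxE; lra.
  have yE : y = z - w.
    by apply/rowP => i; rewrite !mxE; lra.
  have -> : sqn (x - y) = 4 * sqn w.
    rewrite /sqn mulr_sumr; apply: eq_bigr => i _; rewrite !mxE; by field.
  have -> : t * F x + - t * F y = t * (f x - f y) by rewrite /F; ring.
  have -> : 2 * th z + K / 4 * (4 * sqn w) = t ^+ 2 / K * S z + K * sqn w.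
    by rewrite /th; field; rewrite gt_eqF.
  have [wd|/existsNP[j /negP]] := pselect (forall j, `|w ord0 j| < dl); last first.
    rewrite -leNgt => wj.
    apply: (@le_trans _ _ (t * (M + M))).
      rewrite ler_pM2l//; apply: le_trans (ler_norm _) _.
      by apply: le_trans (ler_normB _ _) _; rewrite lerD.
    apply: (@le_trans _ _ (K * dl ^+ 2)); first by lra.
    apply: (@le_trans _ _ (K * sqn w)); last first.
      by rewrite lerDr mulr_ge0// divr_ge0 ?sqr_ge0// ltW.
    rewrite ler_pM2l// /sqn (bigD1 j)//= -[dl ^+ 2]addr0 lerD//.
      rewrite -[leRHS]real_normK ?num_real//.
      by rewrite lerXn2r ?nnegrE// ltW.
    by apply: sumr_ge0 => i _; exact: sqr_ge0.
  have [s /andP[s0 s1]] := has_grad_mvt_line y (2 *: w) fg.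
  have -> : y + 2 *: w = x by apply/rowP => i; rewrite !mxE; lra.
  move=> ->; rewrite mulr_sumr /S /sqn !mulr_sumr -big_split/=.
  apply: ler_sum => i _.
  have gb : `|g i (y + s *: (2 *: w))| <= `|g i z| + eta.
    have -> : y + s *: (2 *: w) = z + (2 * s - 1) *: w.
      by apply/rowP => k; rewrite !mxE; lra.
    have := Hdl i z ((2 * s - 1) *: w) _.
    have /[swap] /[apply] h : forall k, `|((2 * s - 1) *: w) ord0 k| < dl.
      move=> k; rewrite mxE normrM; apply: le_lt_trans (wd k).
      by rewrite ler_piMl// ler_norml; apply/andP; split; lra.
    have := ler_normD (g i (z + (2 * s - 1) *: w) - g i z) (g i z).
    rewrite subrK; lra.
  rewrite mxE.
  set gam := g i _ in gb *; set a := `|g i z| + eta in gb *.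
  have h1 : (w ord0 i) * gam <= `|w ord0 i| * a.
    apply: le_trans (ler_norm _) _; rewrite normrM; exact: ler_wpM2l.
  have -> : t * (2 * w ord0 i * gam) = 2 * t * (w ord0 i * gam) by ring.
  apply: (@le_trans _ _ (2 * t * (`|w ord0 i| * a))).
    by rewrite ler_pM2l ?mulr_gt0.
  rewrite -[w ord0 i ^+ 2]real_normK ?num_real//.
  have h2 := sqr_ge0 (t / K * a - `|w ord0 i|).
  have : 0 <= K * (t / K * a - `|w ord0 i|) ^+ 2 by rewrite mulr_ge0// ltW.
  have -> : K * (t / K * a - `|w ord0 i|) ^+ 2 =
    t ^+ 2 / K * a ^+ 2 + K * `|w ord0 i| ^+ 2 - 2 * t * (`|w ord0 i| * a).
    by field; rewrite gt_eqF.
  by rewrite subr_ge0.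
have PL := prekopa_leindler_om (btF t) (btF (- t)) bth PLH.
have low (c : R) : `|c| = t -> N + t ^+ 2 / 4 * A <= E (fun x => expR (c * F x)).
  move=> ct.
  have c2 : c ^+ 2 = t ^+ 2 by rewrite -ct real_normK ?num_real.
  have -> : N + t ^+ 2 / 4 * A =
      E (fun x => 1 + c * F x + (c * F x) ^+ 2 / 4).
    rewrite ED; last 2 first.
    - by apply: bounded_mfunD => //; exact: bounded_mfun_cst.
    - by apply: bounded_mfunM; [exact: b2|exact: bounded_mfun_cst].
    rewrite (ED (bc 1) (btF c)).
    rewrite EZ// EF mulr0 addr0 -/N; congr (_ + _).
    rewrite /A -EZ; last exact: b2.
    by congr E; apply/funext => x; rewrite exprMn c2; ring.
  apply: Ele.
  - apply: bounded_mfunD; last by apply: bounded_mfunM; [exact: b2|exact: bounded_mfun_cst].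
    by apply: bounded_mfunD => //; exact: bounded_mfun_cst.
  - exact: bounded_mfun_expR.
  move=> x; apply: expR_ge_quadratic; rewrite normrM ct.
  by apply: le_trans tM1; rewrite ler_pM2l.
have tt : `|t| = t by rewrite gtr0_norm.
have up : E (fun x => expR (th x)) <= N + t ^+ 2 / K * (2 * D + 2 * (n%:R * eta ^+ 2 * N)).
  apply: (@le_trans _ _ (E (fun x => 1 + t ^+ 2 / K * (2 * (\sum_i g i x ^+ 2) +
      2 * (n%:R * eta ^+ 2))))).
    apply: Ele.
    - exact: bounded_mfun_expR.
    - apply: bounded_mfunD; first exact: bounded_mfun_cst.
      apply: bounded_mfunZ; apply: bounded_mfunD; last exact: bounded_mfun_cst.
      exact: bounded_mfunZ.
    move=> x; apply: le_trans (expR_le_linear _ _) _.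
    - by rewrite /th mulr_ge0// divr_ge0 ?sqr_ge0// mulr_ge0// ltW.
    - rewrite /th mulrAC ler_pdivrMr ?mulr_gt0//.
      rewrite (_ : 1 / 2 * (2 * K) = K); last by field.
      by apply: le_trans tS; rewrite ler_wpM2l ?sqr_ge0.
    rewrite lerD2l /th.
    rewrite (_ : 2 * (t ^+ 2 / (2 * K) * S x) = t ^+ 2 / K * S x); last first.
      by field; rewrite gt_eqF.
    apply: ler_wpM2l; first by rewrite divr_ge0 ?sqr_ge0// ltW.
    rewrite /S mulr_sumr.
    have -> : 2 * (n%:R * eta ^+ 2) = \sum_(i < n) 2 * eta ^+ 2.
      by rewrite sumr_const card_ord -mulr_natl; ring.
    rewrite -big_split/=; apply: ler_sum => i _.
    rewrite -[g i x ^+ 2]real_normK ?num_real//.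
    exact: sqr_sum_le.
  rewrite ED; last 2 first.
  - exact: bounded_mfun_cst.
  - apply: bounded_mfunZ; apply: bounded_mfunD; last exact: bounded_mfun_cst.
    exact: bounded_mfunZ.
  rewrite EZ; last first.
    apply: bounded_mfunD; last exact: bounded_mfun_cst.
    exact: bounded_mfunZ.
  rewrite ED; last 2 first.
  - exact: bounded_mfunZ.
  - exact: bounded_mfun_cst.
  by rewrite EZ// (Ec (2 * (n%:R * eta ^+ 2))) -/N -/D -[2 * (n%:R * eta ^+ 2) * N]mulrA.
have A0 : 0 <= A.
  have := Ele (bc 0) (b2 _ bF) (fun x => sqr_ge0 _).
  by rewrite Ec mul0r.
have D0 : 0 <= D.
  have := Ele (bc 0) bD (fun x => sumr_ge0 _ (fun i _ => sqr_ge0 _)).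
  by rewrite Ec mul0r.
have L1 := low t tt.
have L2 : N + t ^+ 2 / 4 * A <= E (fun x => expR (- t * F x)).
  by apply: low; rewrite normrN.
have q0 : 0 <= N + t ^+ 2 / 4 * A.
  by rewrite addr_ge0// mulr_ge0// divr_ge0// sqr_ge0.
have h : N + t ^+ 2 / 4 * A <= N + t ^+ 2 / K * (2 * D + 2 * (n%:R * eta ^+ 2 * N)).
  apply: le_trans up.
  have E0 : 0 <= E (fun x => expR (th x)).
    have := Ele (bc 0) (bounded_mfun_expR bth) (fun x => expR_ge0 _).
    by rewrite Ec mul0r.
  have := le_trans (ler_pM q0 q0 L1 L2) PL.
  by rewrite -expr2 (ler_sqr q0 E0).
move: h; rewrite lerD2l => h.
have {h} : t ^+ 2 * (A / 4) <= t ^+ 2 * ((2 * D + 2 * (n%:R * eta ^+ 2 * N)) / K).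
  by move: h; congr (_ <= _); ring.
rewrite ler_pM2l ?exprn_gt0// => h.
apply: (@le_trans _ _ (8 / K * D + 8 / K * (n%:R * eta ^+ 2 * N))); last by rewrite lerD2l.
have -> : 8 / K * D + 8 / K * (n%:R * eta ^+ 2 * N) =
   4 * ((2 * D + 2 * (n%:R * eta ^+ 2 * N)) / K) by field; rewrite gt_eqF.
by rewrite -ler_pdivrMl// mulrC.
Qed.

End poincare_from_prekopa_leindler.

(** * A Hardy inequality removes the weight *)

Section cutoff.
Variable R : realType.

(** A cutoff that is only [C^1]: the truncations below never differentiate it
twice, and its polynomial form makes them explicit. *)
Definition bump2 (s : R) : R := Num.max 0 (1 - s) ^+ 2.
Definition dbump2 (s : R) : R := - 2 * Num.max 0 (1 - s).

Lemma is_derive_bump2 (s : R) : is_derive s 1 bump2 (dbump2 s).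
Proof.
apply: (@is_derive_quadratic _ _ _ _ 1) => // h; rewrite /bump2 /dbump2 mul1r.
case: (leP 0 (1 - s)) => h1; case: (leP 0 (1 - (h + s))) => h2;
  rewrite ler_norml; apply/andP; split; nra.
Qed.

Lemma dbump2_continuous : continuous dbump2.
Proof.
move=> s; have c1 : 1 - t @[t --> s] --> 1 - s.
  exact: (cvgB (cvg_cst _) cvg_id).
have c2 : Num.max 0 (1 - t) @[t --> s] --> Num.max 0 (1 - s).
  exact: (@continuous_max R R (cst 0) (fun t => 1 - t) s (cvg_cst _) c1).
exact: (cvgM (cvg_cst _) c2).
Qed.

Lemma bump2_ge0 s : 0 <= bump2 s. Proof. exact: sqr_ge0. Qed.

Lemma bump2_le1 s : 0 <= s -> bump2 s <= 1.
Proof.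
by move=> s0; rewrite /bump2; case: (leP 0 (1 - s)) => h; rewrite ?expr0n/= ?ler01//; nra.
Qed.

Lemma is_derive_expRN (t : R) :
  is_derive t 1 (fun t => expR (- t)) (- expR (- t)).
Proof.
have -> : - expR (- t) = expR (- t) * (- 1) by rewrite mulrN1.
exact: (is_derive_comp (is_derive_expR _) (is_deriveN (is_derive_id _ _))).
Qed.

Lemma expRN_continuous : continuous (fun t : R => - expR (- t)).
Proof.
move=> t; apply: cvgN; apply: (@continuous_comp _ _ _ -%R expR).
  exact: opp_continuous.
exact: continuous_expR.
Qed.

End cutoff.

Section c1_poincare.
Variables (R : realType) (n : nat) (mu : probability 'rV[R]_n R).
Variables (V W : 'rV[R]_n -> R) (Z K rho : R).
Hypotheses (n0 : (0 < n)%N) (Z0 : 0 < Z) (K0 : 0 < K) (rho0 : 0 < rho).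
Variable dV : 'I_n -> 'rV[R]_n -> R.
Hypotheses (gV : has_grad V dV) (cW : continuous W).
Hypothesis muV : has_gibbs_density mu V Z.
Hypothesis VW : forall x, V x <= W x.
Hypothesis midW : forall x y,
  W (2^-1 *: (x + y)) <= (W x + W y) / 2 - K / 8 * sqn (x - y).
Hypothesis W_V : forall x, rho ^+ 2 / 16 <= sqn x -> W x = V x.
Hypothesis euler : forall x, sqn x < rho ^+ 2 ->
  \sum_i x ord0 i * dV i x <= n%:R / 2.

Let cV : continuous V. Proof. by case: gV. Qed.

(** The divergence theorem for a field of the form [Y expR (- V)], written with
the density of [mu] divided out. *)
Lemma integral_divergence0 (B : R) (Y : 'I_n -> 'rV[R]_n -> R)
    (dY : 'I_n -> 'I_n -> 'rV[R]_n -> R) :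
  (forall i, has_grad (Y i) (dY i)) -> (forall i, cube_supp B (Y i)) ->
  bounded_mfun (fun x => expR (V x) * \sum_i dY i i x) /\
  \int[mu]_x (expR (V x) * \sum_i dY i i x) = 0.
Proof.
move=> gY YB.
have cdY i : continuous (dY i i) by case: (gY i).
have sdY i : cube_supp B (dY i i) by exact: has_grad_supp (gY i) (YB i).
have cS : continuous (fun x => \sum_i dY i i x) by exact: continuous_sum.
have ck : continuous (fun x => expR (V x) * \sum_i dY i i x).
  move=> x; have ce : expR (V y) @[y --> x] --> expR (V x).
    by apply: (@continuous_comp _ _ _ V expR); [exact: cV|exact: continuous_expR].
  exact: (cvgM ce (cS x)).
have bk : bounded_mfun (fun x => expR (V x) * \sum_i dY i i x).
  apply: (continuous_bounded_mfun (B := B)) => // x j xj.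
  by rewrite big1 ?mulr0// => i _; rewrite (sdY i x j).
split => //.
have mV : measurable_fun setT V by exact: continuous_measurable_rV.
have mden : measurable_fun setT (fun x : 'rV[R]_n => Z^-1 * expR (- V x)).
  apply: measurable_funM => //; apply: measurableT_comp => //.
  exact: measurableT_comp.
have den0 x : 0 <= Z^-1 * expR (- V x) by rewrite mulr_ge0 ?expR_ge0 ?invr_ge0 ?ltW.
rewrite /Rintegral (integral_density (leb := lebesgue_rV R n) mden den0)//; last by case: bk.
have kE x : expR (V x) * (\sum_i dY i i x) * (Z^-1 * expR (- V x)) =
    Z^-1 * \sum_i dY i i x.
  have E : expR (V x) * expR (- V x) = 1 by rewrite -expRD addrN expR0.
  transitivity (Z^-1 * (\sum_i dY i i x) * (expR (V x) * expR (- V x))); first by ring.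
  by rewrite E mulr1.
under eq_integral do rewrite kE.
have iY i : (lebesgue_rV R n).-integrable setT (EFin \o dY i i).
  have [M _ HM] := cube_supp_bounded (cdY i) (sdY i).
  by apply: cube_supp_integrable HM (sdY i); exact: continuous_measurable_rV.
rewrite -/(Rintegral _ _ _) RintegralZl//; last first.
  have sS : cube_supp B (fun x => \sum_i dY i i x).
    by move=> x j xj; rewrite big1// => i _; exact: (sdY i x j).
  have [M _ HM] := cube_supp_bounded cS sS.
  by apply: cube_supp_integrable HM sS; exact: continuous_measurable_rV.
suff -> : \int[lebesgue_rV R n]_x (\sum_i dY i i x) = 0 by rewrite mulr0.
rewrite /Rintegral; under eq_integral do rewrite -sumEFin.
rewrite integral_sum//= big1 ?fine0// => i _.
have fi : (\int[lebesgue_rV R n]_x (dY i i x)%:E \is a fin_num)%E.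
  by apply: integrable_fin_num => //; exact: iY.
by rewrite -(fineK fi) -/(Rintegral _ _ _) (integral_partial0 i (gY i) (YB i)).
Qed.

(** A Hardy-type estimate, kept pointwise. The function [k] is the
[mu]-divergence of the field [F^2 zeta x], with [F = f - m] and the cutoff
[zeta = (1 - |x|^2 / rho^2)_+^2]; it integrates to [0]. On the ball the
divergence of [zeta x] is about [n - x . grad V >= n / 2] near the origin, where
the weight [expR (V - W)] may be tiny; for [|x| >= rho / 4] the weight is [1] and
pays for the derivative of [zeta]. The cross term [2 F zeta x . grad f] is split
so that [F^2] takes the factor [n / 10]. *)
Lemma hardy_pointwise (f : 'rV[R]_n -> R) g (m : R) : has_grad f g ->
  exists k : 'rV[R]_n -> R, [/\ bounded_mfun k, \int[mu]_x k x = 0 &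
    forall x, n%:R / 8 * (f x - m) ^+ 2 <= k x +
      (1 + n%:R / 8) * ((f x - m) ^+ 2 * expR (V x - W x)) +
      10 * rho ^+ 2 / n%:R * \sum_i g i x ^+ 2].
Proof.
move=> fg.
pose F x := f x - m.
have gF : has_grad F g.
  have := has_gradD fg (has_grad_cst n (- m)).
  by apply: has_grad_ext => // i x; rewrite addr0.
have gz := has_grad_comp (@is_derive_bump2 R) (@dbump2_continuous R)
  (has_gradM (has_grad_cst n (rho ^- 2)) (@has_grad_sqn R n)).
have ge := has_grad_comp (@is_derive_expRN R) (@expRN_continuous R) gV.
have gY i := has_gradM (has_gradM (has_grad_coord R i) gz) (has_gradM (has_gradM gF gF) ge).
have r20 : 0 < rho ^+ 2 by rewrite exprn_gt0.
have YB i : cube_supp rho (fun x =>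
    x ord0 i * bump2 (rho ^- 2 * sqn x) * (F x * F x * expR (- V x))).
  move=> x j xj.
  have : 1 <= rho ^- 2 * sqn x.
    rewrite mulrC ler_pdivlMr// mul1r /sqn (bigD1 j)//= -[rho ^+ 2]addr0 lerD//.
      by rewrite -[leRHS]real_normK ?num_real// lerXn2r ?nnegrE// ltW.
    by apply: sumr_ge0 => k _; exact: sqr_ge0.
  move=> h; rewrite /bump2 max_l ?expr0n/= ?mulr0 ?mul0r//.
  by rewrite subr_le0.
have [bk k0] := integral_divergence0 gY YB.
eexists; split; [exact: bk|exact: k0|].
move=> x /=.
pose S := \sum_i x ord0 i * dV i x; pose T := \sum_i x ord0 i * g i x.
pose u := Num.max 0 (1 - rho ^- 2 * sqn x).
pose sg := rho ^- 2 * sqn x.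
set kk := expR (V x) * _.
have kE : kk = u ^+ 2 * (n%:R * F x ^+ 2 - F x ^+ 2 * S + 2 * F x * T)
    - 4 * sg * u * F x ^+ 2.
  rewrite /kk mulr_sumr.
  rewrite (eq_bigr (fun i => u ^+ 2 * F x ^+ 2 + 2 * F x * u ^+ 2 * (x ord0 i * g i x)
     - u ^+ 2 * F x ^+ 2 * (x ord0 i * dV i x)
     - 4 * rho ^- 2 * u * F x ^+ 2 * x ord0 i ^+ 2)); last first.
    move=> i _; rewrite eqxx /bump2 /dbump2 -/u.
    have E : expR (V x) * expR (- V x) = 1 by rewrite -expRD addrN expR0.
    rewrite /=.
    transitivity ((expR (V x) * expR (- V x)) * (u ^+ 2 * F x ^+ 2
       + 2 * F x * u ^+ 2 * (x ord0 i * g i x)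
     - u ^+ 2 * F x ^+ 2 * (x ord0 i * dV i x)
     - 4 * rho ^- 2 * u * F x ^+ 2 * x ord0 i ^+ 2)); first by ring.
    by rewrite E mul1r.
  rewrite !big_split/= sumr_const card_ord !sumrN -!mulr_sumr -/S -/T -/(sqn x) /sg.
  by rewrite -mulr_natl; ring.
have Nn : 1 <= n%:R :> R by rewrite ler1n.
have sg0 : 0 <= sg by rewrite mulr_ge0 ?sqn_ge0// invr_ge0 ltW.
have TG : - (n%:R / 10 * sg * F x ^+ 2 + 10 * rho ^+ 2 / n%:R * \sum_i g i x ^+ 2)
    <= 2 * F x * T.
  rewrite /T /sg /sqn !mulr_sumr !mulr_suml -big_split/= -sumrN.
  apply: ler_sum => i _; rewrite -subr_ge0.
  (* completed square whose weights split the cross term as announced *)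
  pose a := Num.sqrt (n%:R / 10 : R).
  have a2 : a ^+ 2 = n%:R / 10 by rewrite sqr_sqrtr// divr_ge0.
  have a0 : 0 < a by rewrite sqrtr_gt0 divr_gt0// (lt_le_trans ltr01).
  have := sqr_ge0 (a * (x ord0 i / rho) * F x + rho / a * g i x).
  congr (_ <= _).
  rewrite (_ : 10 * rho ^+ 2 / n%:R = rho ^+ 2 / a ^+ 2); last first.
    by rewrite a2; field; rewrite gt_eqF// (lt_le_trans ltr01).
  rewrite -a2; field.
  by rewrite !gt_eqF.
have G0 : 0 <= \sum_i g i x ^+ 2 by apply: sumr_ge0 => i _; exact: sqr_ge0.
rewrite -/(F x) kE.
set G := \sum_i g i x ^+ 2 in TG G0 *.
set c := 10 * rho ^+ 2 / n%:R in TG *.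
have cG : 0 <= c * G.
  by rewrite mulr_ge0// divr_ge0// mulr_ge0// ltW.
have F20 := sqr_ge0 (F x).
have om0 := expR_ge0 (V x - W x).
have u0 : 0 <= u by rewrite /u le_max lexx.
have u1 : u <= 1 by rewrite /u ge_max ler01/= lerBlDr lerDl.
have [sg1|sg1] := leP 1 sg.
  have -> : u = 0 by rewrite /u max_l// subr_le0.
  rewrite expr0n/= mul0r mulr0 mul0r sub0r oppr0 add0r W_V.
    rewrite subrr expR0 mulr1 ler_wpDr// ler_wpM2r// lerDr//.
  move: sg1; rewrite /sg mulrC ler_pdivlMr// mul1r; apply: le_trans.
  by rewrite ler_pdivrMr// ler_peMr ?ler1n// ltW.
have uE : u = 1 - sg by rewrite /u max_r// subr_ge0 ltW.
have SE : S <= n%:R / 2.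
  apply: euler; move: sg1.
  by rewrite /sg mulrC ltr_pdivrMr// mul1r.
have k1 : u ^+ 2 * (n%:R / 2 * F x ^+ 2 - n%:R / 10 * sg * F x ^+ 2) - c * G
    - 4 * sg * u * F x ^+ 2 <=
  u ^+ 2 * (n%:R * F x ^+ 2 - F x ^+ 2 * S + 2 * F x * T) - 4 * sg * u * F x ^+ 2.
  rewrite lerD2r.
  have h1 : u ^+ 2 * (n%:R / 2 * F x ^+ 2 - n%:R / 10 * sg * F x ^+ 2 - c * G) <=
     u ^+ 2 * (n%:R * F x ^+ 2 - F x ^+ 2 * S + 2 * F x * T).
    rewrite ler_wpM2l ?sqr_ge0//.
    have : F x ^+ 2 * S <= F x ^+ 2 * (n%:R / 2) by rewrite ler_wpM2l.
    lra.
  apply: le_trans h1.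
  have : u ^+ 2 * (c * G) <= 1 * (c * G).
    by rewrite ler_wpM2r// expr_le1.
  by rewrite mulrBr mul1r; lra.
suff k2 : n%:R / 8 * F x ^+ 2 <=
   u ^+ 2 * (n%:R / 2 * F x ^+ 2 - n%:R / 10 * sg * F x ^+ 2) - 4 * sg * u * F x ^+ 2
   + (1 + n%:R / 8) * (F x ^+ 2 * expR (V x - W x)) by lra.
have E0 : u ^+ 2 * (n%:R / 2 * F x ^+ 2 - n%:R / 10 * sg * F x ^+ 2) - 4 * sg * u * F x ^+ 2
  = F x ^+ 2 * (u ^+ 2 * (n%:R / 2 - n%:R / 10 * sg) - 4 * sg * u) by ring.
rewrite E0 mulrC [X in _ <= _ + X]mulrCA -mulrDr ler_wpM2l//.
(* [sg = 1 / 16] is the sphere of radius [rho / 4], beyond which the weight is [1] *)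
have [sg2|sg2] := leP (1 / 16) sg.
  rewrite W_V; last first.
    by move: sg2; rewrite /sg [rho ^- 2 * _]mulrC ler_pdivlMr//; lra.
  rewrite subrr expR0 mulr1.
  have h1 : 0 <= u ^+ 2 * (n%:R / 2 - n%:R / 10 * sg).
    by rewrite mulr_ge0 ?sqr_ge0//; nra.
  have h2 : 4 * sg * u <= 1 by rewrite uE; have := sqr_ge0 (1 - 2 * sg); nra.
  lra.
have h1 : 0 <= (1 + n%:R / 8) * expR (V x - W x).
  by rewrite mulr_ge0// addr_ge0// divr_ge0.
apply: ler_wpDr => //.
have h2 : 4 * sg * u <= n%:R * (4 * sg * u).
  by apply: ler_peMl => //; apply: mulr_ge0 => //; exact: mulr_ge0.
apply: (@le_trans _ _ (n%:R * (u ^+ 2 * (1 / 2 - sg / 10) - 4 * sg * u))).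
  have h3 : 1 / 8 <= u ^+ 2 * (1 / 2 - sg / 10) - 4 * sg * u.
    rewrite uE; nra.
  have := ler_wpM2l (ler0n R n) h3; lra.
lra.
Qed.

(** Integrate the pointwise Hardy estimate and bound the weighted term by
[weighted_poincare]; on the gradient side the weight is at most [1]. *)
Lemma c1_poincare (B : R) (f : 'rV[R]_n -> R) g :
  has_grad f g -> cube_supp B f ->
  exists m, \int[mu]_x ((f x - m) ^+ 2) <=
    (72 / K + 80 * rho ^+ 2 / n%:R ^+ 2) * \int[mu]_x (\sum_i g i x ^+ 2).
Proof.
move=> fg fB; have [cf _ cg] := fg.
have [m Hm] := weighted_poincare Z0 K0 cV cW muV VW midW fg fB.
have [k [bk k0 Hk]] := hardy_pointwise m fg.
exists m.
have bf : bounded_mfun (fun x => f x - m).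
  apply: bounded_mfunD; first exact: continuous_bounded_mfun fB.
  exact: bounded_mfun_cst.
have bf2 : bounded_mfun (fun x => (f x - m) ^+ 2) by exact: bounded_mfunM.
have bG : bounded_mfun (fun x => \sum_i g i x ^+ 2).
  apply: bounded_mfun_sum => i; apply: (@bounded_mfunM _ _ _ (g i) (g i));
    exact: continuous_bounded_mfun (cg i) (has_grad_supp i fg fB).
have mV : measurable_fun setT V by exact: continuous_measurable_rV.
have mW : measurable_fun setT W by exact: continuous_measurable_rV.
have om1 x : expR (V x - W x) <= 1.
  by rewrite -expR0 ler_expR subr_le0; exact: VW.
have bom : bounded_mfun (fun x => expR (V x - W x)).
  split; first by apply: measurableT_comp => //; exact: measurable_funB.
  by exists 1 => x; rewrite ger0_norm ?expR_ge0.
have bfo := bounded_mfunM bf2 bom.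
have bGo := bounded_mfunM bG bom.
have I1 : n%:R / 8 * \int[mu]_x ((f x - m) ^+ 2) <=
    (1 + n%:R / 8) * \int[mu]_x ((f x - m) ^+ 2 * expR (V x - W x)) +
    10 * rho ^+ 2 / n%:R * \int[mu]_x (\sum_i g i x ^+ 2).
  rewrite -!bounded_RintegralZ// -[leRHS]add0r -[X in X + (_ + _)]k0.
  rewrite -!bounded_RintegralD//; try by do ?[apply: bounded_mfunD|apply: bounded_mfunZ].
  apply: bounded_le_Rintegral; [exact: bounded_mfunZ| |by move=> x; rewrite addrA].
  by do ?[apply: bounded_mfunD|apply: bounded_mfunZ].
have I2 : \int[mu]_x ((\sum_i g i x ^+ 2) * expR (V x - W x)) <=
    \int[mu]_x (\sum_i g i x ^+ 2).
  apply: bounded_le_Rintegral => // x; rewrite ler_piMr//.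
  by apply: sumr_ge0 => i _; exact: sqr_ge0.
have Nn : 1 <= n%:R :> R by rewrite ler1n.
have G0 : 0 <= \int[mu]_x (\sum_i g i x ^+ 2).
  by apply: Rintegral_ge0 => x _; apply: sumr_ge0 => i _; exact: sqr_ge0.
move: I1 I2 Hm G0.
move: (\int[mu]_x ((f x - m) ^+ 2)) (\int[mu]_x ((f x - m) ^+ 2 * expR (V x - W x))).
move: (\int[mu]_x ((\sum_i g i x ^+ 2) * expR (V x - W x))) (\int[mu]_x (\sum_i g i x ^+ 2)).
move=> Go G A Ao I1 I2 Hm G0.
have N0 : 0 < n%:R :> R by rewrite ltr0n.
have {Hm} Ha : Ao <= 8 / K * G.
  by apply: le_trans Hm _; rewrite ler_wpM2l// divr_ge0// ltW.
have N8 : 0 < n%:R / 8 :> R by rewrite divr_gt0.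
rewrite -(ler_pM2l N8); apply: le_trans I1 _.
have h1 : (1 + n%:R / 8) * Ao <= (n%:R * (9 / 8)) * (8 / K * G).
  apply: (@le_trans _ _ ((1 + n%:R / 8) * (8 / K * G))).
    by rewrite ler_wpM2l// addr_ge0// divr_ge0.
  have h2 : 0 <= 8 / K * G by rewrite mulr_ge0// divr_ge0// ltW.
  by apply: ler_wpM2r => //; lra.
apply: (@le_trans _ _ ((n%:R * (9 / 8)) * (8 / K * G) + 10 * rho ^+ 2 / n%:R * G)).
  by rewrite lerD2r.
rewrite le_eqVlt; apply/orP; left; apply/eqP; field.
by rewrite !gt_eqF.
Qed.

End c1_poincare.

(** * The convexified potential *)

Section powR_convexity.
Variable R : realType.

(** Convexity of [t `^ b], read off Young's inequality. *)
Lemma powR_tangent (b s t : R) : 1 <= b -> 0 <= s -> 0 <= t ->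
  t `^ b + b * t `^ (b - 1) * (s - t) <= s `^ b.
Proof.
move=> b1 s0 t0.
have b0 : 0 < b by lra.
have [->|bn1] := eqVneq b 1.
  by rewrite subrr powRr0 !powRr1//; lra.
have b1' : 0 < b - 1 by rewrite subr_gt0 lt_neqAle eq_sym bn1.
have q0 : 0 < b / (b - 1) by rewrite divr_gt0.
have := @conjugate_powR _ s (t `^ (b - 1)) b (b / (b - 1)) s0 (powR_ge0 _ _) b0 q0.
have -> : b^-1 + (b / (b - 1))^-1 = 1 by field; rewrite !gt_eqF.
move=> /(_ erefl).
have -> : (t `^ (b - 1)) `^ (b / (b - 1)) = t `^ b.
  by rewrite -powRrM; congr powR; field; rewrite gt_eqF.
have tt : t * t `^ (b - 1) = t `^ b by rewrite mulr_powRB1.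
move=> h.
have {h} : b * (s * t `^ (b - 1)) <= s `^ b + (b - 1) * t `^ b.
  have -> : s `^ b + (b - 1) * t `^ b = b * (s `^ b / b + t `^ b / (b / (b - 1))).
    by field; rewrite !gt_eqF.
  by rewrite ler_pM2l.
rewrite mulrBr -[b * t `^ (b - 1) * t]mulrA [t `^ (b - 1) * t]mulrC tt; lra.
Qed.

(** The chord from the origin lies above the graph of a convex power. *)
Lemma powR_secant (b s t : R) : 1 <= b -> 0 <= s -> s <= t ->
  s `^ b <= t `^ (b - 1) * s.
Proof.
move=> b1 s0 st; have t0 : 0 <= t by apply: le_trans st.
rewrite -(@mulr_powRB1 _ s b)//; last by lra.
rewrite mulrC ler_wpM2r//; apply: ge0_ler_powR; rewrite ?nnegrE//; lra.
Qed.

End powR_convexity.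

(** Two applications of the mean value theorem express the second difference by a
value of [ddF] near [0], which continuity keeps above [k]. *)
Lemma second_difference_gt0 (R : realType) (F dF ddF : R -> R) (k : R) :
  (forall t : R, is_derive t 1 F (dF t)) ->
  (forall t : R, is_derive t 1 dF (ddF t)) -> continuous ddF -> k < ddF 0 ->
  exists2 d, 0 < d & forall h, 0 < h -> h < d ->
    k * h ^+ 2 < F h + F (- h) - 2 * F 0.
Proof.
move=> DF DdF cdd kd.
have /cvgr_gt/(_ _ kd) : ddF t @[t --> (0 : R)] --> ddF 0 by exact: cdd.
move=> /nbhs_ballP[d /= d0 Hd]; exists d => // h h0 hd.
have Hk t : `|t| < d -> k < ddF t.
  by move=> td; apply: Hd; rewrite /ball /= sub0r normrN.
have cont (f df : R -> R) : (forall t : R, is_derive t 1 f (df t)) -> continuous f.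
  by move=> D t; apply/differentiable_continuous/derivable1_diffP; case: (D t).
pose S t := F t + F (- t) - k * t ^+ 2.
have DS (t : R) : is_derive t 1 S (dF t - dF (- t) - k * (2 * t)).
  have D1 : is_derive t 1 (fun t => F (- t)) (dF (- t) * (- 1)).
    exact: (is_derive_comp (DF _) (is_deriveN (is_derive_id _ _))).
  have D2 : is_derive t 1 (fun t => k * t ^+ 2) (k * (2 * t)).
    apply: (@is_derive_quadratic _ _ _ _ `|k|) => // u.
    by rewrite (_ : _ - _ = k * u ^+ 2); [rewrite normrM [`|u ^+ 2|]ger0_norm ?sqr_ge0|ring].
  have D3 := is_deriveB (is_deriveD (DF t) D1) D2.
  by rewrite mulrN1 in D3.
have [x] := @MVT _ S _ 0 h h0 (fun t _ => DS t) (continuous_subspaceT (cont _ _ DS)).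
rewrite in_itv/= => /andP[x0 xh] E.
have xx : - x < x by lra.
have [y] := @MVT _ dF _ (- x) x xx (fun t _ => DdF t) (continuous_subspaceT (cont _ _ DdF)).
rewrite in_itv/= => /andP[y1 y2] E2.
have ky : k < ddF y by apply: Hk; rewrite ltr_norml; apply/andP; split; lra.
move: E; rewrite E2 /S oppr0 expr0n/= mulr0 subr0 => E.
have : 0 < (ddF y * (x - - x) - k * (2 * x)) * h.
  rewrite mulr_gt0// (_ : _ - _ = 2 * x * (ddF y - k)); last by ring.
  by rewrite !mulr_gt0// subr_gt0.
by move: E; rewrite addr0 => <-; lra.
Qed.

Section potential.
Variables (R : realType) (n : nat) (V : 'rV[R]_n -> R) (al Ra r L K : R).
Hypotheses (al2 : 2 <= al) (r0 : 0 < r) (rRa : r < Ra) (K0 : 0 < K).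
Hypothesis C2V : Ck 2 V.
Hypothesis V_in : forall x, enorm x <= Ra -> V x = enorm x `^ al / al.
Hypothesis V_out : forall x, Ra <= enorm x -> form_ge (hessian V x) L.
Hypothesis KL : K < L.
Hypothesis Kr : K < 2 / al * (r ^+ 2) `^ (al / 2 - 1).

Implicit Types x y z v : 'rV[R]_n.

Lemma enorm_ge0 x : 0 <= enorm x. Proof. exact: sqrtr_ge0. Qed.

Lemma enorm2 x : enorm x ^+ 2 = sqn x.
Proof. by rewrite sqr_sqrtr//; exact: sqn_ge0. Qed.

Lemma enorm_le x (t : R) : 0 <= t -> (enorm x <= t) = (sqn x <= t ^+ 2).
Proof. by move=> t0; rewrite -enorm2 ler_sqr// nnegrE ?enorm_ge0. Qed.

Lemma enorm_ge x (t : R) : 0 <= t -> (t <= enorm x) = (t ^+ 2 <= sqn x).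
Proof. by move=> t0; rewrite -enorm2 ler_sqr// nnegrE ?enorm_ge0. Qed.

Lemma enorm_powR x (b : R) : enorm x `^ b = sqn x `^ (b / 2).
Proof.
by rewrite /enorm -powR12_sqrt ?sqn_ge0// -powRrM [2^-1 * b]mulrC.
Qed.

Let Ra0 : 0 < Ra. Proof. exact: lt_trans rRa. Qed.

Let be := al / 2.
Let be1 : 1 <= be. Proof. by rewrite /be ler_pdivlMr// mul1r. Qed.
Let al0 : 0 < al. Proof. by apply: lt_le_trans al2. Qed.

Let p (t : R) := t `^ be / al - K / 2 * t.
Let b := p (r ^+ 2).

Let V_in' x : sqn x <= Ra ^+ 2 -> V x = sqn x `^ be / al.
Proof. by move=> h; rewrite V_in ?enorm_powR// enorm_le// ltW. Qed.

Let Krr : K < (r ^+ 2) `^ (be - 1).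
Proof.
apply: lt_le_trans Kr _; rewrite ler_piMl ?powR_ge0//.
by rewrite ler_pdivrMr// mul1r.
Qed.

Let p_tangent s t : 0 <= s -> 0 <= t ->
  (t `^ (be - 1) - K) / 2 * (s - t) <= p s - p t.
Proof.
move=> s0 t0; have h := powR_tangent be1 s0 t0.
have {h} : (t `^ be + be * t `^ (be - 1) * (s - t)) / al <= s `^ be / al.
  by rewrite ler_pM2r// invr_gt0.
have -> : (t `^ be + be * t `^ (be - 1) * (s - t)) / al =
   t `^ be / al + t `^ (be - 1) / 2 * (s - t).
  by rewrite /be; field; rewrite gt_eqF.
by rewrite /p; lra.
Qed.

Let p_ge s : r ^+ 2 <= s -> b <= p s.
Proof.
move=> rs; rewrite -subr_ge0; apply: le_trans (p_tangent _ _).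
- by rewrite mulr_ge0 ?subr_ge0// divr_ge0// subr_ge0 ltW.
- by apply: le_trans rs; rewrite sqr_ge0.
- exact: sqr_ge0.
Qed.

Let p_gt s : r ^+ 2 < s -> b < p s.
Proof.
move=> rs; rewrite -subr_gt0; apply: lt_le_trans (p_tangent _ _).
- by rewrite mulr_gt0 ?subr_gt0// divr_gt0// subr_gt0.
- by apply: le_trans (ltW rs); rewrite sqr_ge0.
- exact: sqr_ge0.
Qed.

Let p_le s : 0 <= s -> s <= r ^+ 2 -> p s <= b.
Proof.
move=> s0 sr; have h := powR_secant be1 s0 sr.
have r2 : 0 < r ^+ 2 by rewrite exprn_gt0.
have e : r ^+ 2 * (r ^+ 2) `^ (be - 1) = (r ^+ 2) `^ be.
  by rewrite mulr_powRB1 ?ltW// (lt_le_trans ltr01).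
rewrite -subr_ge0 /b /p -e.
set A := (r ^+ 2) `^ (be - 1) in h *.
have : s `^ be / al <= A * s / al by rewrite ler_pM2r// invr_gt0.
have : 0 <= (A / al - K / 2) * (r ^+ 2 - s).
  rewrite mulr_ge0 ?subr_ge0//.
  by move: Kr; rewrite -/be -/A; lra.
rewrite (_ : r ^+ 2 * A / al = A / al * r ^+ 2); last by ring.
rewrite (_ : A * s / al = A / al * s); last by ring.
lra.
Qed.

Let G0 x := V x - K / 2 * sqn x.
Let G x := Num.max b (G0 x).

(** [V], with its degenerate part near the origin replaced by a paraboloid of
curvature [K]: the constant [b] makes the two agree on the sphere of radius [r],
the paraboloid being above [V] inside and below it outside. *)
Definition convexified x := G x + K / 2 * sqn x.

Let G0_in x : sqn x <= Ra ^+ 2 -> G0 x = p (sqn x).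
Proof. by move=> h; rewrite /G0 V_in'. Qed.

Let gV := Ck1_has_grad C2V.

Lemma sqn_second_difference z v (h : R) :
  sqn (z + h *: v) + sqn (z + (- h) *: v) - 2 * sqn z = 2 * h ^+ 2 * sqn v.
Proof.
rewrite /sqn !mulr_sumr -big_split/= -sumrB; apply: eq_bigr => i _.
by rewrite !mxE; ring.
Qed.

Let cont_line (f : 'rV[R]_n -> R) z v : continuous f ->
  continuous (fun t : R => f (z + t *: v)).
Proof.
move=> cf t; apply: (@continuous_comp _ _ _ (fun t : R => z + t *: v) f); last exact: cf.
exact: (cvgD (cvg_cst z) (cvgZr_tmp cvg_id)).
Qed.

(** Inside the ball of radius [Ra] the tangent inequality for the power gives
positive second differences, and outside it the lower bound on the Hessian does.
Unlike second derivatives, second differences need no smoothness of the power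
and are blind to the sphere where the two descriptions meet. *)
Let G0_second_difference z v (eta : R) : r ^+ 2 < sqn z -> 0 < sqn v -> 0 < eta ->
  exists h, [/\ 0 < h, h < eta & 0 < G0 (z + h *: v) + G0 (z + (- h) *: v) - 2 * G0 z].
Proof.
move=> zr v0 eta0.
have [zRa|zRa] := ltP (sqn z) (Ra ^+ 2).
  have cq : continuous (@sqn R n) by case: (@has_grad_sqn R n).
  have c0 : sqn (z + t *: v) @[t --> (0 : R)] --> sqn (z + (0 : R) *: v).
    exact: (@cont_line _ z v cq (0 : R)).
  move/cvgr_lt : c0 => /(_ (Ra ^+ 2)).
  rewrite scale0r addr0 => /(_ zRa) /nbhs_ballP[d /= d0 Hd].
  pose h := Num.min (d / 2) (eta / 2).
  have h0 : 0 < h by rewrite /h lt_min !divr_gt0.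
  have hd : h <= d / 2 by rewrite /h ge_min lexx.
  have he : h <= eta / 2 by rewrite /h ge_min lexx orbT.
  exists h; split => //; first by lra.
  have i1 : sqn (z + h *: v) <= Ra ^+ 2.
    by apply/ltW/Hd; rewrite /ball /= sub0r normrN gtr0_norm//; lra.
  have i2 : sqn (z + (- h) *: v) <= Ra ^+ 2.
    by apply/ltW/Hd; rewrite /ball /= sub0r normrN normrN gtr0_norm//; lra.
  rewrite !G0_in ?(ltW zRa)//.
  have t1 := p_tangent (sqn_ge0 (z + h *: v)) (sqn_ge0 z).
  have t2 := p_tangent (sqn_ge0 (z + (- h) *: v)) (sqn_ge0 z).
  have sd := sqn_second_difference z v h.
  have K1 : K < sqn z `^ (be - 1).
    apply: lt_le_trans Krr _; apply: ge0_ler_powR; rewrite ?nnegrE ?sqr_ge0 ?sqn_ge0 ?(ltW zr)//.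
    by rewrite subr_ge0.
  apply: (@lt_le_trans _ _ ((sqn z `^ (be - 1) - K) / 2 * (2 * h ^+ 2 * sqn v))).
    by rewrite !mulr_gt0 ?exprn_gt0// ?divr_gt0 ?subr_gt0//.
  by rewrite -sd; lra.
have gi i : has_grad (partial i V) (fun j => partial j (partial i V)).
  exact: (@Ck1_has_grad _ _ 0 _ (C2V.2 i).2).
pose dF (t : R) := \sum_i v ord0 i * partial i V (z + t *: v).
pose ddF (t : R) := \sum_i v ord0 i *
  \sum_j v ord0 j * partial j (partial i V) (z + t *: v).
have DF (t : R) : is_derive t 1 (fun s : R => V (z + s *: v)) (dF t) by exact: (has_grad_line z v t gV).
have DdF (t : R) : is_derive t 1 dF (ddF t).
  have Di i : is_derive t 1 (fun t : R => v ord0 i * partial i V (z + t *: v))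
     (v ord0 i * \sum_j v ord0 j * partial j (partial i V) (z + t *: v)).
    exact: (is_deriveZ (v ord0 i) (has_grad_line z v t (gi i))).
  have := is_derive_sum Di; congr is_derive.
  by apply/funext => s; rewrite fct_sumE.
have cddF : continuous ddF.
  apply: continuous_sum => i t; apply: cvgM; first exact: cvg_cst.
  move: t; apply: continuous_sum => j t; apply: cvgM; first exact: cvg_cst.
  by apply: cont_line; case: (gi i).
have ddF0 : K * sqn v < ddF 0.
  have zE : Ra <= enorm z by rewrite enorm_ge ?(ltW Ra0).
  have := V_out zE v; rewrite enorm2.
  have -> : (v *m hessian V z *m v^T) ord0 ord0 = ddF 0.
    rewrite !mxE; apply: eq_bigr => i _.
    rewrite !mxE mulrC; congr (_ * _); apply: eq_bigr => j _.
    by rewrite !mxE scale0r addr0.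
  by apply: lt_le_trans; rewrite ltr_pM2r.
have [d d0 Hd] := second_difference_gt0 DF DdF cddF ddF0.
pose h := Num.min (d / 2) (eta / 2).
have h0 : 0 < h by rewrite /h lt_min !divr_gt0.
have hd : h <= d / 2 by rewrite /h ge_min lexx.
have he : h <= eta / 2 by rewrite /h ge_min lexx orbT.
exists h; split => //; first by lra.
have hd' : h < d by lra.
have := Hd h h0 hd'; rewrite scale0r addr0 => H.
have sd := sqn_second_difference z v h.
by rewrite /G0; nra.
Qed.

(** Maximum principle along a chord: where [G0] exceeds [b] its second
differences are positive, so [G0] minus an affine function has no interior
maximum there. *)
Let G_convex x y (s : R) : 0 <= s -> s <= 1 ->
  G (x + s *: (y - x)) <= (1 - s) * G x + s * G y.
Proof.
move=> s0 s1; set v := y - x.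
pose l t := (1 - t) * G x + t * G y.
have Gb z : b <= G z by rewrite /G le_max lexx.
have lb t : 0 <= t -> t <= 1 -> b <= l t.
  move=> t0 t1; rewrite /l; have := Gb x; have := Gb y; nra.
rewrite -/(l s) {1}/G ge_max lb//= leNgt; apply/negP => ls.
pose phi t := G0 (x + t *: v) - l t.
have cphi : continuous phi.
  have cV : continuous V by case: gV.
  have cq : continuous (@sqn R n) by case: (@has_grad_sqn R n).
  have c1 : continuous (fun t : R => G0 (x + t *: v)).
    move=> t; apply: cvgB; first exact: (@cont_line _ x v cV).
    by apply: cvgM; [exact: cvg_cst|exact: (@cont_line _ x v cq)].
  move=> t; apply: cvgB; first exact: c1.
  apply: cvgD; apply: cvgM; try exact: cvg_cst; last exact: cvg_id.
  by apply: cvgB; [exact: cvg_cst|exact: cvg_id].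
have [m] := @EVT_max _ phi 0 1 ler01 (continuous_subspaceT cphi).
rewrite in_itv/= => /andP[m0 m1] Hm.
have pm : 0 < phi m.
  apply: (@lt_le_trans _ _ (phi s)); first by rewrite /phi subr_gt0.
  by apply: Hm; rewrite in_itv/= s0.
have m0' : 0 < m.
  rewrite lt_neqAle m0 andbT; apply/eqP => me; move: pm.
  rewrite -me /phi /l scale0r addr0 subr0 mul1r mul0r addr0 subr_gt0.
  by rewrite ltNge /G le_max lexx orbT.
have m1' : m < 1.
  rewrite lt_neqAle m1 andbT; apply/eqP => me; move: pm.
  rewrite me /phi /l scale1r /v subrKC subrr mul0r mul1r add0r subr_gt0.
  by rewrite ltNge /G le_max lexx orbT.
set z := x + m *: v.
have zb : b < G0 z.
  by move: pm; rewrite /phi -/z subr_gt0; apply: le_lt_trans; apply: lb.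
have zr : r ^+ 2 < sqn z.
  rewrite ltNge; apply/negP => zr; move: zb; apply/negP; rewrite -leNgt.
  rewrite G0_in; first exact: p_le (sqn_ge0 _) zr.
  by apply: le_trans zr _; rewrite ler_sqr ?nnegrE ltW.
have v0 : 0 < sqn v.
  rewrite lt_neqAle sqn_ge0 andbT; apply/eqP => v0.
  have ve : v = 0.
    apply/rowP => i; rewrite [RHS]mxE; apply/eqP; rewrite -sqrf_eq0.
    have := @psumr_eq0P _ _ predT (fun i => v ord0 i ^+ 2).
    by move=> /(_ (fun i _ => sqr_ge0 _) (esym v0)) ->.
  move: pm; rewrite /phi ve scaler0 addr0 /l.
  have -> : y = x by move/eqP : ve; rewrite subr_eq0 => /eqP.
  have : G0 x <= G x by rewrite /G le_max lexx orbT.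
  lra.
have e0 : 0 < Num.min m (1 - m) by rewrite lt_min m0' subr_gt0.
have [h [h0 he H]] := G0_second_difference zr v0 e0.
move: he; rewrite lt_min => /andP[hm h1m].
have h1 : phi (m + h) <= phi m by apply: Hm; rewrite in_itv/=; apply/andP; split; lra.
have h2 : phi (m - h) <= phi m by apply: Hm; rewrite in_itv/=; apply/andP; split; lra.
move: h1 h2; rewrite /phi !scalerDl !addrA -/z /l; lra.
Qed.

Lemma convexified_ge x : V x <= convexified x.
Proof.
rewrite /convexified -lerBlDr -/(G0 x) /G le_max lexx orbT//.
Qed.

Lemma convexified_continuous : continuous convexified.
Proof.
have cV : continuous V by case: gV.
have cq : continuous (@sqn R n) by case: (@has_grad_sqn R n).
have cK : continuous (fun x => K / 2 * sqn x).
  by move=> x; exact: (cvgM (cvg_cst _) (cq x)).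
have cG0 : continuous G0 by move=> x; exact: (cvgB (cV x) (cK x)).
have cG : continuous G.
  move=> x; have cb : {for x, continuous (fun _ : 'rV[R]_n => b)} by move=> A; exact: (@cst_continuous _ _ b x A).
  exact: (continuous_max cb (cG0 x)).
by move=> x; exact: (cvgD (cG x) (cK x)).
Qed.

Lemma convexified_midpoint x y :
  convexified (2^-1 *: (x + y)) <=
  (convexified x + convexified y) / 2 - K / 8 * sqn (x - y).
Proof.
have h := @G_convex x y 2^-1.
have : G (2^-1 *: (x + y)) <= (G x + G y) / 2.
  have -> : 2^-1 *: (x + y) = x + 2^-1 *: (y - x).
    by apply/rowP => i; rewrite !mxE; lra.
  by apply: le_trans (h _ _) _; lra.
have : sqn (2^-1 *: (x + y)) = (sqn x + sqn y) / 2 - sqn (x - y) / 4.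
  rewrite /sqn -big_split/= !mulr_suml -sumrB; apply: eq_bigr => i _.
  by rewrite !mxE; field.
by rewrite /convexified => ->; lra.
Qed.

(** Beyond [Ra] nothing is known of [V] but its Hessian. If [G0] fell below [b] at
[x], the convex function [G] would equal [b] at [0] and at [x], hence be at most
[b] where the segment crosses the sphere of radius [Ra], and there [p] exceeds
[b]. *)
Let G0_ge x : r ^+ 2 <= sqn x -> b <= G0 x.
Proof.
move=> rx; have [xRa|xRa] := leP (sqn x) (Ra ^+ 2).
  by rewrite G0_in//; exact: p_ge.
rewrite leNgt; apply/negP => Gx.
have G0E : G 0 = b.
  rewrite /G max_l// G0_in.
    apply: p_le; first exact: sqn_ge0.
    by rewrite /sqn big1 ?sqr_ge0// => i _; rewrite mxE expr0n.
  by rewrite /sqn big1 ?sqr_ge0// => i _; rewrite mxE expr0n.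
have GxE : G x = b by rewrite /G max_l// ltW.
have x0 : 0 < sqn x by apply: le_lt_trans xRa; exact: sqr_ge0.
pose s := Ra / Num.sqrt (sqn x).
have sx0 : 0 < Num.sqrt (sqn x) by rewrite sqrtr_gt0.
have s1 : s <= 1.
  rewrite ler_pdivrMr// mul1r -(ler_sqr (ltW Ra0) (ltW sx0)).
  by rewrite sqr_sqrtr ?ltW.
have s0 : 0 <= s by rewrite divr_ge0 ?ltW.
have := G_convex 0 x s0 s1; rewrite G0E GxE subr0 add0r.
have sE : sqn (s *: x) = Ra ^+ 2.
  have -> : sqn (s *: x) = s ^+ 2 * sqn x.
    by rewrite /sqn mulr_sumr; apply: eq_bigr => i _; rewrite mxE exprMn.
  by rewrite /s expr_div_n sqr_sqrtr ?(ltW x0)// divfK// gt_eqF.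
rewrite {1}/G ge_max => /andP[_].
rewrite G0_in ?sE//; apply/negP; rewrite -ltNge.
rewrite (_ : _ + _ = b); last by ring.
by apply: p_gt; rewrite ltr_sqr ?nnegrE// ltW.
Qed.

Lemma convexified_out x : r ^+ 2 <= sqn x -> convexified x = V x.
Proof. by move=> rx; rewrite /convexified /G max_r ?G0_ge// /G0 subrK. Qed.

(** Euler's identity for the function [|x|^al / al], homogeneous of degree [al]. *)
Lemma euler_identity x : sqn x < Ra ^+ 2 ->
  \sum_i x ord0 i * partial i V x = sqn x `^ be.
Proof.
move=> xRa.
have [x0|x0] := eqVneq (sqn x) 0.
  have xe i : x ord0 i = 0.
    apply/eqP; rewrite -sqrf_eq0.
    have := @psumr_eq0P _ _ predT (fun i => x ord0 i ^+ 2).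
    by move=> /(_ (fun i _ => sqr_ge0 _) x0) ->.
  rewrite x0 powR0; last by rewrite gt_eqF// (lt_le_trans ltr01).
  by rewrite big1// => i _; rewrite xe mul0r.
have xp : 0 < sqn x by rewrite lt_neqAle eq_sym x0 sqn_ge0.
have D1 : is_derive (0 : R) 1 (fun t : R => V (x + t *: x))
    (\sum_i x ord0 i * partial i V x).
  by have := has_grad_line x x 0 gV; rewrite scale0r addr0.
have Dq : is_derive (0 : R) 1 (fun t : R => sqn (x + t *: x)) (2 * sqn x).
  have := has_grad_line x x 0 (@has_grad_sqn R n); rewrite scale0r addr0.
  congr is_derive; rewrite /sqn mulr_sumr; apply: eq_bigr => i _; ring.
have Dp : is_derive (sqn (x + (0 : R) *: x)) 1 (fun t : R => t `^ be / al)
    (sqn x `^ (be - 1) / 2).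
  rewrite scale0r addr0.
  have := is_deriveZ al^-1 (is_derive1_powR be xp).
  have -> : al^-1 *: (be * sqn x `^ (be - 1)) = sqn x `^ (be - 1) / 2.
    by rewrite /be -[_ *: _]/(_ * _); field; rewrite gt_eqF.
  congr is_derive; apply/funext => t; exact: mulrC.
have := is_derive_comp (f := fun t : R => sqn (x + t *: x)) Dp Dq.
have near0 : \forall t \near (0 : R), V (x + t *: x) = sqn (x + t *: x) `^ be / al.
  have cq : continuous (@sqn R n) by case: (@has_grad_sqn R n).
  have c0 : sqn (x + t *: x) @[t --> (0 : R)] --> sqn (x + (0 : R) *: x).
    exact: (@cont_line _ x x cq (0 : R)).
  move/cvgr_lt : c0 => /(_ (Ra ^+ 2)).
  rewrite scale0r addr0 => /(_ xRa); apply: filterS => t /= h.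
  by rewrite V_in' // ltW.
move=> D2; have D3 := near_eq_is_derive near0 D1.
have <- : 'D_1 (fun t : R => sqn (x + t *: x) `^ be / al) 0 =
   \sum_i x ord0 i * partial i V x by case: D3.
case: D2 => _ ->.
rewrite -(@mulr_powRB1 _ (sqn x) be) ?sqn_ge0//; last exact: lt_le_trans be1.
by field.
Qed.

End potential.

(** * Continuity of translations *)

Lemma cvge0_lt (R : realType) (u : (\bar R)^nat) (e : R) :
  u @ \oo --> 0%E -> 0 < e -> exists N, (u N < e%:E)%E.
Proof.
move=> /fine_cvgP[fu cu] e0.
have /cvgr_lt/(_ e e0) nu := cu.
have : \forall k \near \oo, (u k < e%:E)%E.
  near=> k; have uk : u k \is a fin_num by near: k.
  by rewrite -(fineK uk) lte_fin; near: k.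
by move=> /filter_ex.
Unshelve. all: by end_near. Qed.

Section translation_continuity.
Variables (R : realType) (n : nat).
Local Notation leb := (lebesgue_rV R n).
Implicit Types (A : set 'rV[R]_n) (x z : 'rV[R]_n).

Definition small (d : R) z := forall i, `|z ord0 i| < d.

Lemma smallW d d' z : d <= d' -> small d z -> small d' z.
Proof. by move=> dd zd i; apply: lt_le_trans (zd i) dd. Qed.

Definition shift_diff A z : set 'rV[R]_n :=
  [set x | (A (x + z) /\ ~ A x) \/ (~ A (x + z) /\ A x)].

Lemma measurable_preimage_shift A z : measurable A ->
  measurable [set x : 'rV[R]_n | A (x + z)].
Proof.
move=> mA; rewrite -[X in measurable X]setTI.
exact: (measurable_rV_translate z measurableT mA).
Qed.

Lemma measurable_shift_diff A z : measurable A -> measurable (shift_diff A z).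
Proof.
move=> mA; have mAz := measurable_preimage_shift z mA.
by apply: measurableU; apply: measurableI => //; exact: measurableC.
Qed.

Lemma lebesgue_shift A z : measurable A -> leb [set x | A (x + z)] = leb A.
Proof.
move=> mA; have := @ge0_integral_translate R n (fun x => (\1_A x)%:E) z.
have -> : (fun x : 'rV[R]_n => (\1_A (x + z)%R)%:E : \bar R) =
    (fun x => (\1_[set x | A (x + z)] x)%:E) by [].
rewrite !integral_indic// ?setIT; last exact: measurable_preimage_shift.
apply; last by move=> x; rewrite lee_fin.
by apply/measurable_EFinP; exact: measurable_indic.
Qed.

(** Sets whose small translates are close to them, locally in measure. *)
Definition shift_good A := measurable A /\ forall B e : R, 0 < e ->
  exists2 d, 0 < d & forall z, small d z ->
    (leb (cube B `&` shift_diff A z) <= e%:E)%E.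

Lemma shift_good_setC A : shift_good A -> shift_good (~` A).
Proof.
move=> [mA gA]; split; first exact: measurableC.
move=> B e e0; have [d d0 H] := gA B e e0; exists d => // z zd.
rewrite (_ : shift_diff _ _ = shift_diff A z); first exact: H.
apply/seteqP; split => x [] [h1 h2].
- by right; split => //; exact: contrapT.
- by left; split => //; exact: contrapT.
- by right; split => // /(_ h1).
- by left; split => // /(_ h2).
Qed.

Let mcubeI B A z : measurable A -> measurable (cube B `&` shift_diff A z).
Proof.
by move=> mA; apply: measurableI; [exact: measurable_cube|exact: measurable_shift_diff].
Qed.

Lemma shift_good_setU A A' : shift_good A -> shift_good A' -> shift_good (A `|` A').
Proof.
move=> [mA gA] [mA' gA']; split; first exact: measurableU.
move=> B e e0; have e20 : 0 < e / 2 by rewrite divr_gt0.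
have [d d0 H] := gA B _ e20; have [d' d'0 H'] := gA' B _ e20.
exists (Num.min d d'); first by rewrite lt_min d0.
move=> z zd.
have h := H z (smallW _ zd); have h' := H' z (smallW _ zd).
rewrite ge_min lexx in h; rewrite ge_min lexx orbT in h'.
apply: (@le_trans _ _ (leb (cube B `&` shift_diff A z) + leb (cube B `&` shift_diff A' z))%E).
  apply: (le_trans _ (measureU2 _ (mcubeI _ _ mA) (mcubeI _ _ mA'))).
  apply: le_measure; rewrite ?inE.
  - by apply: mcubeI; exact: measurableU.
  - by apply: measurableU; exact: mcubeI.
  move=> x [xB [[[Ax|Ax] /not_orP[n1 n2]]|[/not_orP[n1 n2] [Ax|Ax]]]].
  - by left; split => //; left.
  - by right; split => //; left.
  - by left; split => //; right.
  - by right; split => //; right.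
rewrite (_ : e%:E = ((e / 2)%:E + (e / 2)%:E)%E); last by rewrite -EFinD; congr EFin; lra.
by apply: leeD; [exact: h|exact: h'].
Qed.

Lemma shift_good_set0 : shift_good set0.
Proof.
split => // B e e0; exists 1 => // z _.
rewrite (_ : _ `&` _ = set0) ?measure0 ?lee_fin ?ltW//.
by rewrite -subset0 => x [_ [[]|[]]].
Qed.

(** Countable unions: up to small measure on a larger cube, the union is one of
its finite stages. *)
Lemma shift_good_bigcup (A : (set 'rV[R]_n)^nat) :
  (forall k, shift_good (A k)) -> shift_good (\bigcup_k A k).
Proof.
move=> gA; have mA k : measurable (A k) by case: (gA k).
have mU : measurable (\bigcup_k A k) by exact: bigcup_measurable.
split => // B e e0.
pose T N := \big[setU/set0]_(k < N) A k.
have gT N : shift_good (T N).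
  rewrite /T; elim: N => [|N IHN]; first by rewrite big_ord0; exact: shift_good_set0.
  by rewrite big_ord_recr; exact: shift_good_setU.
have mT N : measurable (T N) by case: (gT N).
pose Q := cube (B + 1) : set 'rV[R]_n.
have mQ : measurable Q by exact: measurable_cube.
pose D N := Q `&` (\bigcup_k A k `\` T N).
have mD N : measurable (D N) by apply: measurableI => //; exact: measurableD.
have D0 : \bigcap_N D N = set0.
  rewrite -subset0 => x H; have [_ [[k _ Ak] _]] := H 0%N I.
  have [_ [_ nT]] := H k.+1 I; apply: nT.
  by rewrite /T -bigcup_mkord; exists k => //=.
have cD : leb (D N) @[N --> \oo] --> 0%E.
  rewrite -(measure0 leb) -D0; apply: nonincreasing_cvg_mu => //.
  - apply: le_lt_trans (@lebesgue_cube_fin R n (B + 1)).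
    by apply: le_measure; rewrite ?inE//; exact: subIsetl.
  - by rewrite D0.
  - move=> i j ij; apply/subsetPset => x [xQ [xU nT]]; split => //; split => //.
    apply: contra_not nT; rewrite /T -!bigcup_mkord => -[k /= ki Ak].
    by exists k => //=; exact: leq_trans ki ij.
have e30 : 0 < e / 3 by rewrite divr_gt0.
have [N HN] := cvge0_lt cD e30.
have [d d0 Hd] := (gT N).2 B _ e30.
exists (Num.min d 1); first by rewrite lt_min d0 ltr01.
move=> z zd.
have zd' : small d z by apply: smallW zd; rewrite ge_min lexx.
have z1 : small 1 z by apply: smallW zd; rewrite ge_min lexx orbT.
have mDz : measurable [set x | D N (x + z)] by exact: measurable_preimage_shift.
apply: (@le_trans _ _ (leb (cube B `&` shift_diff (T N) z) +
    (leb (D N) + leb [set x | D N (x + z)%R]))%E).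
  apply: (@le_trans _ _ (leb (cube B `&` shift_diff (T N) z) +
      leb (D N `|` [set x | D N (x + z)%R]))%E); last first.
    by apply: leeD => //; exact: measureU2.
  have mDD : measurable (D N `|` [set x | D N (x + z)]) by exact: measurableU.
  apply: (le_trans _ (measureU2 _ (mcubeI _ _ (mT N)) mDD)).
  apply: le_measure; rewrite ?inE.
  - exact: mcubeI.
  - by apply: measurableU => //; exact: mcubeI.
  have TU x : T N x -> (\bigcup_k A k) x.
    by rewrite /T -bigcup_mkord => -[k _ Ak]; exists k.
  move=> x [xB].
  have xQ : Q x by move=> i; apply: le_trans (xB i) _; rewrite lerDl.
  have xzQ : Q (x + z).
    by move=> i; rewrite mxE; apply: le_trans (ler_normD _ _) _; rewrite lerD// ltW.
  move=> [[U1 U2]|[U1 U2]].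
    have [T1|T1] := pselect (T N (x + z)); last by right; right.
    by left; split => //; left; split => // /TU.
  have [T1|T1] := pselect (T N x); last by right; left.
  by left; split => //; right; split => // /TU.
rewrite (_ : e%:E = ((e / 3)%:E + ((e / 3)%:E + (e / 3)%:E))%E); last first.
  by rewrite -!EFinD; congr EFin; lra.
apply: leeD; first exact: Hd.
by apply: leeD; rewrite ?lebesgue_shift//; exact: ltW.
Qed.

Lemma measurable_rV_box (l u : 'rV[R]_n) :
  measurable [set x : 'rV[R]_n | forall i, l ord0 i <= x ord0 i <= u ord0 i].
Proof.
have -> : [set x : 'rV[R]_n | forall i, l ord0 i <= x ord0 i <= u ord0 i] =
    \bigcap_(j in [set: 'I_n])
      (@rV_coord R n j @^-1` (`[(l ord0 j), (u ord0 j)]%classic)).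
  by apply/seteqP; split => x /= h j; [move=> _; have := h j|have := h j I];
    rewrite /= in_itv.
apply: fin_bigcap_measurable => // j _.
by rewrite -[X in measurable X]setTI; apply: measurable_rV_coord => //;
  exact: measurable_itv.
Qed.

(** A small translation changes the side of a hyperplane only for the points of a
thin slab around it. *)
Lemma shift_good_halfspace i (a : R) : shift_good [set x : 'rV[R]_n | x ord0 i <= a].
Proof.
have mS t : measurable [set x : 'rV[R]_n | `|x ord0 i - a| <= t].
  rewrite (_ : [set x : 'rV[R]_n | _] =
     @rV_coord R n i @^-1` (`[a - t, a + t]%classic)).
    by rewrite -[X in measurable X]setTI; apply: measurable_rV_coord => //;
      exact: measurable_itv.
  by apply/seteqP; split => x /=; rewrite in_itv/= ler_distl.
have mA : measurable [set x : 'rV[R]_n | x ord0 i <= a].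
  rewrite (_ : [set x : 'rV[R]_n | _] = @rV_coord R n i @^-1` (`]-oo, a]%classic)).
    by rewrite -[X in measurable X]setTI; apply: measurable_rV_coord => //;
      exact: measurable_itv.
  by apply/seteqP; split => x /=; rewrite in_itv.
split => // B e e0.
pose M := \prod_(j < n | j != i) (2 * `|B|).
have M0 : 0 <= M by apply: prodr_ge0 => j _; rewrite mulr_ge0.
exists (e / (2 * (M + 1))); first by rewrite divr_gt0// mulr_gt0// ltr_wpDl.
move=> z zd.
set t := e / (2 * (M + 1)) in zd *.
have t0 : 0 < t by rewrite /t divr_gt0// mulr_gt0// ltr_wpDl.
pose l : 'rV[R]_n := \row_j (if j == i then a - t else - `|B|).
pose u : 'rV[R]_n := \row_j (if j == i then a + t else `|B|).
have lu j : l ord0 j <= u ord0 j.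
  rewrite !mxE; case: ifP => _; first lra.
  by have := normr_ge0 B; lra.
have := lebesgue_rV_box lu.
have -> : \prod_(j < n) (u ord0 j - l ord0 j) = 2 * t * M.
  rewrite (bigD1 i)//= !mxE eqxx /M; congr (_ * _); first by lra.
  by apply: eq_bigr => j ji; rewrite !mxE (negPf ji); lra.
move=> boxE.
have tM : 2 * t * M <= e.
  rewrite /t (_ : 2 * _ * M = e * (M / (M + 1))); last first.
    by field; rewrite gt_eqF// ltr_wpDl.
  rewrite ler_piMr ?(ltW e0)// ler_pdivrMr ?ltr_wpDl//; lra.
apply: (@le_trans _ _ (2 * t * M)%:E); last by rewrite lee_fin.
rewrite -boxE; apply: le_measure; rewrite ?inE.
- exact: mcubeI.
- exact: measurable_rV_box.
move=> x [xB D] j /=; rewrite !mxE.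
have [->|ji] := eqVneq j i; last first.
  by rewrite -ler_norml; apply: le_trans (xB j) (ler_norm _).
have := zd i; rewrite ltr_norml => /andP[z1 z2].
case: D => /= -[]; rewrite mxE.
  by move=> h1 /negP; rewrite -ltNge => h2; apply/andP; split; lra.
by move=> /negP; rewrite -ltNge => h1 h2; apply/andP; split; lra.
Qed.

(** The good sets form a sigma-algebra containing the half-spaces. *)
Lemma measurable_shift_good A : measurable A -> shift_good A.
Proof.
suff : measurable `<=` shift_good by apply.
apply: smallest_sub.
  split; first exact: shift_good_set0.
    by move=> A0 gA; rewrite setTD; exact: shift_good_setC.
  exact: shift_good_bigcup.
have coordG i (Y : set (measurableTypeR R)) : measurable Y ->
    shift_good (@rV_coord R n i @^-1` Y).
  suff : measurable `<=` [set Y | shift_good (@rV_coord R n i @^-1` Y)] by apply.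
  apply: smallest_sub.
    split => /=; first by rewrite preimage_set0; exact: shift_good_set0.
      move=> Y' gY; rewrite setTD preimage_setC; exact: shift_good_setC.
    by move=> F gF; rewrite preimage_bigcup; exact: shift_good_bigcup.
  move=> _ [[a b] _ <-] /=.
  rewrite (_ : _ @^-1` _ = ~` ([set x : 'rV[R]_n | x ord0 i <= a] `|`
      ~` [set x : 'rV[R]_n | x ord0 i <= b])).
    apply: shift_good_setC; apply: shift_good_setU; first exact: shift_good_halfspace.
    by apply: shift_good_setC; exact: shift_good_halfspace.
  rewrite setCU setCK; apply/seteqP; split => x /=; rewrite /rV_coord in_itv/=.
    by move=> /andP[h1 h2]; split => //; apply/negP; rewrite -ltNge.
  by move=> [/negP]; rewrite -ltNge => -> ->.
move=> Y; rewrite -bigcup_seq/= => -[i _ [Y' mY' <-]].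
by rewrite setTI; exact: coordG.
Qed.

End translation_continuity.

Section integral_translation_continuity.
Variables (R : realType) (n : nat).
Local Notation leb := (lebesgue_rV R n).
Implicit Types (x z : 'rV[R]_n).

Import HBSimple.

Lemma sfun_translate_L1 (s : {sfun 'rV[R]_n >-> R}) (B e : R) : 0 < e ->
  exists2 d, 0 < d & forall z, small d z ->
    (\int[leb]_(x in cube B) (`|s (x + z) - s x|)%:E <= e%:E)%E.
Proof.
move=> e0.
have [cs csE] : exists cs : seq R, range s = [set` cs].
  by apply/finite_seqP; exact: fimfunP.
have scs x : s x \in cs.
  have : range s (s x) by exists x.
  by rewrite csE.
pose U (l : seq R) z := \big[setU/set0]_(c <- l) shift_diff (s @^-1` [set c]) z.
have mA c : measurable (s @^-1` [set c]).
  have ms : measurable_fun setT s by [].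
  by rewrite -[X in measurable X]setTI; apply: ms => //; exact: measurable_set1.
have mU l z : measurable (U l z).
  by apply: bigsetU_measurable => c _; exact: measurable_shift_diff.
have mQ : measurable (cube B : set 'rV[R]_n) by exact: measurable_cube.
have HU (l : seq R) e1 : 0 < e1 -> exists2 d, 0 < d & forall z, small d z ->
    (leb (cube B `&` U l z) <= e1%:E)%E.
  elim: l e1 => [|c l IHl] e1 e10.
    by exists 1 => // z _; rewrite /U big_nil setI0 measure0 lee_fin ltW.
  have e20 : 0 < e1 / 2 by rewrite divr_gt0.
  have [d d0 Hd] := IHl _ e20.
  have [d' d'0 Hd'] := (measurable_shift_good (mA c)).2 B _ e20.
  exists (Num.min d d'); first by rewrite lt_min d0.
  move=> z zd; rewrite /U big_cons setIUr -/(U l z).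
  apply: (le_trans (measureU2 _ _ _)).
  - by apply: measurableI => //; exact: measurable_shift_diff.
  - exact: measurableI.
  rewrite (_ : e1%:E = ((e1 / 2)%:E + (e1 / 2)%:E)%E); last first.
    by rewrite -EFinD; congr EFin; lra.
  apply: leeD.
    by apply: Hd'; apply: smallW zd; rewrite ge_min lexx orbT.
  by apply: Hd; apply: smallW zd; rewrite ge_min lexx.
have [M M0 HM] : exists2 M, 0 < M & forall c, c \in cs -> `|c| <= M.
  elim: cs {csE scs} => [|c cs [M M0 HM]]; first by exists 1.
  exists (M + `|c|); first by rewrite ltr_pwDl.
  move=> k; rewrite inE => /orP[/eqP ->|/HM h]; first by rewrite lerDr ltW.
  by apply: le_trans h _; rewrite lerDl.
have e20 : 0 < e / (2 * M) by rewrite divr_gt0// mulr_gt0.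
have [d d0 Hd] := HU cs _ e20.
exists d => // z zd.
have msz : measurable_fun setT (fun x : 'rV[R]_n => s (x + z)).
  by apply: measurableT_comp => //; exact: measurable_rV_translate.
apply: (@le_trans _ _ (\int[leb]_(x in cube B) ((2 * M)%:E * (\1_(U cs z) x)%:E))%E).
  apply: ge0_le_integral => //.
  - apply/measurable_EFinP; apply: measurable_funTS.
    by apply: measurableT_comp => //; exact: measurable_funB.
  - apply: measurable_funeM; apply/measurable_EFinP; apply: measurable_funTS.
    exact: measurable_indic.
  move=> x xB; rewrite -EFinM lee_fin indicE.
  have [E|ne] := eqVneq (s (x + z)) (s x).
    by rewrite E subrr normr0 mulr_ge0// mulr_ge0// ltW.
  rewrite mem_set ?mulr1.
    by apply: le_trans (ler_normB _ _) _; rewrite mulrDl !mul1r lerD// HM.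
  rewrite /U -bigcup_seq; exists (s x); first exact: scs.
  by right; split => //= h; move: ne; rewrite h eqxx.
rewrite ge0_integralZl//; last 2 first.
- by apply/measurable_EFinP; apply: measurable_funTS; exact: measurable_indic.
- by rewrite lee_fin mulr_ge0// ltW.
rewrite integral_indic// setIC.
have -> : e%:E = ((2 * M)%:E * (e / (2 * M))%:E)%E.
  by rewrite -EFinM; congr EFin; field; rewrite gt_eqF.
by rewrite lee_pmul2l ?Hd// lte_fin mulr_gt0.
Qed.

(** Approximation by simple functions, whose translates are controlled set by
set. *)
Lemma translate_L1 (w : 'rV[R]_n -> R) (B e : R) :
  leb.-integrable setT (EFin \o w) -> 0 < e ->
  exists2 d, 0 < d & forall z, small d z ->
    (\int[leb]_(x in cube B) (`|w (x + z) - w x|)%:E <= e%:E)%E.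
Proof.
move=> iw e0; have e30 : 0 < e / 3 by rewrite divr_gt0.
have mw : measurable_fun setT w by have /measurable_int/measurable_EFinP := iw.
have [s_ [_ _ sw]] := approximation_sfun_integrable measurableT iw.
have [N HN] := cvge0_lt sw e30.
set s := s_ N in HN.
have [d d0 Hd] := sfun_translate_L1 s B e30.
have mQ : measurable (cube B : set 'rV[R]_n) by exact: measurable_cube.
exists d => // z zd.
pose D x := `|w x - s x|.
have mD : measurable_fun setT D.
  by apply: measurableT_comp => //; exact: measurable_funB.
have mt (f : 'rV[R]_n -> R) : measurable_fun setT f ->
    measurable_fun setT (fun x : 'rV[R]_n => f (x + z)).
  by move=> mf; apply: measurableT_comp => //; exact: measurable_rV_translate.
have HN' : (\int[leb]_x (D x)%:E < (e / 3)%:E)%E by [].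
have msd : measurable_fun setT (fun x : 'rV[R]_n => `|s (x + z) - s x|).
  by apply: measurableT_comp => //; apply: measurable_funB => //; exact: mt.
apply: (@le_trans _ _ (\int[leb]_(x in cube B)
    ((D (x + z)%R)%:E + ((`|s (x + z)%R - s x|)%:E + (D x)%:E)))%E).
  apply: ge0_le_integral => //.
  - apply/measurable_EFinP; apply: measurable_funTS.
    by apply: measurableT_comp => //; apply: measurable_funB => //; exact: mt.
  - apply: measurable_funTS; apply: emeasurable_funD.
      by apply/measurable_EFinP; exact: mt.
    by apply: emeasurable_funD; apply/measurable_EFinP.
  move=> x _; rewrite -!EFinD lee_fin /D.
  rewrite (_ : w (x + z) - w x = (w (x + z) - s (x + z)) +
    ((s (x + z) - s x) - (w x - s x))); last by ring.
  apply: le_trans (ler_normD _ _) _; rewrite lerD2l.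
  exact: ler_normB.
have D0 x : 0 <= D x by exact: normr_ge0.
have mDB : measurable_fun (cube B : set 'rV[R]_n) (fun x => (D x)%:E).
  by apply/measurable_EFinP; exact: measurable_funTS.
have mDzB : measurable_fun (cube B : set 'rV[R]_n) (fun x => (D (x + z))%:E).
  by apply/measurable_EFinP; apply: measurable_funTS; exact: mt.
have msdB : measurable_fun (cube B : set 'rV[R]_n) (fun x => (`|s (x + z) - s x|)%:E).
  by apply/measurable_EFinP; exact: measurable_funTS.
rewrite ge0_integralD//; last first.
- exact: emeasurable_funD.
- by move=> x _; rewrite -EFinD lee_fin addr_ge0.
- by move=> x _; rewrite lee_fin.
rewrite ge0_integralD//; last by move=> x _; rewrite lee_fin.
rewrite (_ : e%:E = ((e / 3)%:E + ((e / 3)%:E + (e / 3)%:E))%E); last first.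
  by rewrite -!EFinD; congr EFin; lra.
have sub (f : 'rV[R]_n -> R) : measurable_fun setT f -> (forall x : 'rV[R]_n, 0 <= f x) ->
    (\int[leb]_(x in cube B) (f x)%:E <= \int[leb]_x (f x)%:E)%E.
  move=> mf f0; apply: ge0_subset_integral => //.
    exact/measurable_EFinP.
  by move=> x _; rewrite lee_fin.
apply: leeD; last apply: leeD.
- apply: le_trans (sub (fun x => D (x + z)) _ _) _ => //; first exact: mt.
  rewrite (@ge0_integral_translate _ _ (fun x => (D x)%:E)) ?ltW//.
  exact/measurable_EFinP.
- exact: Hd.
- by apply: le_trans (sub D _ _) _ => //; exact: ltW.
Qed.

(** For nonnegative [a] and [b] one has [(a - b)^2 <= `|a^2 - b^2|]: continuity
of translations in [L^2] follows from continuity in [L^1], applied to the squares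
of the positive and negative parts. *)
Lemma translate_L2 (u : 'rV[R]_n -> R) (B e : R) : measurable_fun setT u ->
  (forall B', leb.-integrable (cube B') (EFin \o (fun x => u x ^+ 2))) -> 0 < e ->
  exists2 d, 0 < d & forall z, small d z ->
    (\int[leb]_(x in cube B) ((u (x + z) - u x) ^+ 2)%:E <= e%:E)%E.
Proof.
move=> mu iu e0; have e40 : 0 < e / 4 by rewrite divr_gt0.
pose Q := cube (B + 1) : set 'rV[R]_n.
have mQ : measurable Q by exact: measurable_cube.
have mB : measurable (cube B : set 'rV[R]_n) by exact: measurable_cube.
pose P (f : 'rV[R]_n -> R) x := (Num.max (f x) 0) ^+ 2 * \1_Q x.
have mP (f : 'rV[R]_n -> R) : measurable_fun setT f -> measurable_fun setT (P f).
  move=> mf; apply: measurable_funM; last exact: measurable_indic.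
  by apply: measurable_funX; apply: measurable_maxr.
have iP (f : 'rV[R]_n -> R) : measurable_fun setT f -> (forall x, `|f x| = `|u x|) ->
    leb.-integrable setT (EFin \o P f).
  move=> mf fu.
  have := (integrable_mkcond _ mQ).1 (iu (B + 1)).
  apply: le_integrable => //; first by apply/measurable_EFinP; exact: mP.
  move=> x _; rewrite /= patchE /P indicE.
  have [xQ|xQ] := boolP (x \in Q); last by rewrite mulr0 normr0 abse0.
  rewrite mulr1 /= lee_fin ger0_norm ?sqr_ge0// ger0_norm ?sqr_ge0//.
  rewrite -[u x ^+ 2]real_normK ?num_real// -fu real_normK ?num_real//.
  by case: (leP (f x) 0) => // _; rewrite expr0n/= sqr_ge0.
have [d d0 Hd] := translate_L1 B (iP u mu (fun=> erefl)) e40.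
have mNu : measurable_fun setT (fun x => - u x) by exact: measurableT_comp.
have [d' d'0 Hd'] := translate_L1 B (iP _ mNu (fun x => normrN (u x))) e40.
exists (Num.min 1 (Num.min d d')); first by rewrite !lt_min ltr01 d0.
move=> z zd.
have z1 : small 1 z by apply: smallW zd; rewrite ge_min lexx.
have zd1 : small d z by apply: smallW zd; rewrite !ge_min lexx orbT.
have zd2 : small d' z by apply: smallW zd; rewrite !ge_min lexx !orbT.
have mt (f : 'rV[R]_n -> R) : measurable_fun setT f ->
    measurable_fun setT (fun x : 'rV[R]_n => f (x + z)).
  by move=> mf; apply: measurableT_comp => //; exact: measurable_rV_translate.
have mabs (f : 'rV[R]_n -> R) : measurable_fun setT f ->
    measurable_fun (cube B) (fun x : 'rV[R]_n => (`|f (x + z) - f x|)%:E).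
  move=> mf; apply/measurable_EFinP; apply: measurable_funTS.
  by apply: measurableT_comp => //; apply: measurable_funB => //; exact: mt.
have mNP := mP _ mNu; have mPu := mP _ mu.
apply: (@le_trans _ _ (\int[leb]_(x in cube B)
   (2%:E * (`|P u (x + z)%R - P u x|)%:E +
    2%:E * (`|P (fun x => - u x)%R (x + z)%R - P (fun x => - u x)%R x|)%:E))%E).
  apply: ge0_le_integral => //.
  - by move=> x _; rewrite lee_fin sqr_ge0.
  - apply/measurable_EFinP; apply: measurable_funTS; apply: measurable_funX.
    by apply: measurable_funB => //; exact: mt.
  - by apply: emeasurable_funD; apply: measurable_funeM; exact: mabs.
  move=> x xB; rewrite -!EFinM -EFinD lee_fin /P.
  have xQ : x \in Q.
    by rewrite inE => i; apply: le_trans (xB i) _; rewrite lerDl.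
  have xzQ : x + z \in Q.
    rewrite inE => i; rewrite mxE; apply: le_trans (ler_normD _ _) _.
    by rewrite lerD// ltW.
  rewrite !indicE xQ xzQ !mulr1.
  move: (u (x + z)) (u x) => a b.
  have key (s t : R) : 0 <= s -> 0 <= t -> (s - t) ^+ 2 <= `|s ^+ 2 - t ^+ 2|.
    move=> s0 t0; rewrite subr_sqr normrM -real_normK ?num_real// expr2.
    by apply: ler_wpM2l => //; rewrite ler_norml; have := ler_norm (s + t); lra.
  have a0 : 0 <= Num.max a 0 by rewrite le_max lexx orbT.
  have b0 : 0 <= Num.max b 0 by rewrite le_max lexx orbT.
  have na0 : 0 <= Num.max (- a) 0 by rewrite le_max lexx orbT.
  have nb0 : 0 <= Num.max (- b) 0 by rewrite le_max lexx orbT.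
  have k1 := key _ _ a0 b0; have k2 := key _ _ na0 nb0.
  have dec (c : R) : c = Num.max c 0 - Num.max (- c) 0.
    by case: (leP c 0) => h1; case: (leP (- c) 0) => h2; lra.
  apply: (@le_trans _ _ (2 * (Num.max a 0 - Num.max b 0) ^+ 2 +
      2 * (Num.max (- a) 0 - Num.max (- b) 0) ^+ 2)); last by lra.
  rewrite {1}(dec a) {1}(dec b).
  have := sqr_ge0 ((Num.max a 0 - Num.max b 0) + (Num.max (- a) 0 - Num.max (- b) 0)).
  nra.
rewrite ge0_integralD//; last 2 first.
- by apply: measurable_funeM; exact: mabs.
- by apply: measurable_funeM; exact: mabs.
rewrite !ge0_integralZl//; last 2 first.
- exact: mabs.
- exact: mabs.
rewrite (_ : e%:E = (2%:E * (e / 4)%:E + 2%:E * (e / 4)%:E)%E); last first.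
  by rewrite -!EFinM -EFinD; congr EFin; lra.
by apply: leeD; rewrite lee_pmul2l//; [exact: Hd|exact: Hd'].
Qed.

End integral_translation_continuity.

(** * Smooth test functions *)

Section flat_functions.
Variable R : realType.
Implicit Types (P : {poly R}) (t : R).

(** Closed under differentiation, and flat at the origin: the source of smooth
functions with compact support. *)
Definition flat P t : R := if 0 < t then P.[t^-1] * expR (- t^-1) else 0.

Definition dflat P : {poly R} := 'X^2 * (P - P^`()).

Lemma expX_expRN_le k (y : R) : 0 <= y -> y ^+ k * expR (- y) <= k`!%:R.
Proof.
move=> y0; rewrite expRN ler_pdivrMr ?expR_gt0//.
case: k => [|k]; first by rewrite expr0 fact0 mul1r -expR0 ler_expR.
have f0 : 0 < k.+1`!%:R :> R by rewrite ltr0n fact_gt0.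
rewrite mulrC -ler_pdivrMr//; apply: le_trans (expR_ge1Dxn k y0).
by rewrite lerDr.
Qed.

Lemma horner_expRN_bounded P : exists2 C : R, 0 <= C &
  forall y, 0 <= y -> `|P.[y] * expR (- y)| <= C.
Proof.
exists (\sum_(i < size P) `|P`_i| * i`!%:R).
  by apply: sumr_ge0 => i _; rewrite mulr_ge0.
move=> y y0; rewrite horner_coef mulr_suml.
apply: le_trans (ler_norm_sum _ _ _) _; apply: ler_sum => i _.
rewrite -mulrA normrM ler_wpM2l// ger0_norm; first exact: expX_expRN_le.
by rewrite mulr_ge0 ?exprn_ge0 ?expR_ge0.
Qed.

(** At the origin the bound on [y^2 P(y) exp (- y)] makes [flat P] quadratically
small. *)
Lemma is_derive_flat P t : is_derive t 1 (flat P) (flat (dflat P) t).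
Proof.
have [t0|t0|->] := ltgtP t 0.
- rewrite {2}/flat ltNge (ltW t0)/=.
  apply: (near_eq_is_derive (f := cst 0) _ (is_derive_cst (0 : R) t 1)).
  by apply: filterS (lt_nbhsl t0) => s s0; rewrite /flat ltNge (ltW s0).
- rewrite {2}/flat t0.
  have Dinv : is_derive t 1 (fun s : R => s^-1) (- t ^- 2).
    have := @is_deriveV _ id t 1 1 (lt0r_neq0 t0) (is_derive_id t 1).
    by congr is_derive; rewrite [_ *: _]mulr1.
  have DP : is_derive t^-1 1 (horner P) (P^`()).[t^-1] by exact: is_derive_poly.
  have D1 := is_derive_comp (f := fun s : R => s^-1) DP Dinv.
  have D2 := is_derive_comp (f := fun s : R => s^-1) (is_derive_expRN t^-1) Dinv.
  have D3 := is_deriveM D1 D2.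
  apply: (near_eq_is_derive (f := fun s : R => P.[s^-1] * expR (- s^-1))).
    by apply: filterS (lt_nbhsr t0) => s s0; rewrite /flat s0.
  move: D3; congr is_derive.
  rewrite /dflat hornerM hornerXn hornerD hornerN -![_ *: _]/(_ * _) exprVn.
  by ring.
- rewrite {2}/flat ltxx.
  have [C C0 HC] := horner_expRN_bounded ('X^2 * P).
  apply: (@is_derive_quadratic _ _ _ _ C) => // h.
  rewrite addr0 mulr0 subr0 {2}/flat ltxx subr0 /flat.
  case: ifPn => h0; last by rewrite normr0 mulr_ge0 ?sqr_ge0.
  have := HC h^-1; rewrite invr_ge0 ltW// hornerM hornerXn => /(_ isT).
  have h2 : 0 < h ^+ 2 by rewrite exprn_gt0.
  rewrite -mulrA normrM exprVn ger0_norm ?invr_ge0 ?(ltW h2)//.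
  by rewrite mulrC ler_pdivrMr.
Qed.

Lemma flat_continuous P : continuous (flat P).
Proof.
by move=> t; apply/differentiable_continuous/derivable1_diffP; case: (is_derive_flat P t).
Qed.

Lemma flat1_gt0 t : 0 < t -> 0 < flat 1 t.
Proof. by move=> t0; rewrite /flat t0 hornerE mul1r expR_gt0. Qed.

Lemma flat1_ge0 t : 0 <= flat 1 t.
Proof. by rewrite /flat; case: ifP => // _; rewrite hornerE mul1r expR_ge0. Qed.

Lemma flat_le0 P t : t <= 0 -> flat P t = 0.
Proof. by move=> t0; rewrite /flat ltNge t0. Qed.

End flat_functions.

Section Ck_algebra.
Variables (R : realType) (n : nat).
Implicit Types (f g : 'rV[R]_n -> R) (x y : 'rV[R]_n).
Local Notation e_ i := (delta_mx ord0 i : 'rV[R]_n).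

Lemma CkW k f : Ck k.+1 f -> Ck k f.
Proof.
elim: k f => [|k IHk] f [cf H]; first by split.
by split => // i; have [D C] := H i; split => //; exact: IHk.
Qed.

Lemma Ck_succ k f (g : 'I_n -> 'rV[R]_n -> R) : continuous f ->
  (forall i x, is_derive x (e_ i) f (g i x)) -> (forall i, Ck k (g i)) -> Ck k.+1 f.
Proof.
move=> cf D Cg; split => // i; split; first by move=> x; case: (D i x).
rewrite (_ : partial i f = g i)//.
by apply/funext => x; rewrite /partial; case: (D i x).
Qed.

Lemma Ck_has_partial k f : Ck k.+1 f ->
  forall i x, is_derive x (e_ i) f (partial i f x).
Proof. by move=> [_ H] i x; split => //; exact: (H i).1. Qed.

Lemma Ck_cst k (c : R) : Ck k (fun _ : 'rV[R]_n => c).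
Proof.
elim: k c => [|k IHk] c; first by split => //; exact: cst_continuous.
apply: (@Ck_succ _ _ (fun _ _ => 0)) => //; first exact: cst_continuous.
Qed.

Lemma CkD k f g : Ck k f -> Ck k g -> Ck k (fun x => f x + g x).
Proof.
elim: k f g => [|k IHk] f g Cf Cg.
  by split => // x; exact: (cvgD (Cf.1 x) (Cg.1 x)).
apply: (@Ck_succ _ _ (fun i x => partial i f x + partial i g x)).
- by move=> x; exact: (cvgD (Cf.1 x) (Cg.1 x)).
- by move=> i x; exact: (is_deriveD (Ck_has_partial Cf i x) (Ck_has_partial Cg i x)).
- by move=> i; apply: IHk; [exact: (Cf.2 i).2|exact: (Cg.2 i).2].
Qed.

Lemma CkM k f g : Ck k f -> Ck k g -> Ck k (fun x => f x * g x).
Proof.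
elim: k f g => [|k IHk] f g Cf Cg.
  by split => // x; exact: (cvgM (Cf.1 x) (Cg.1 x)).
apply: (@Ck_succ _ _ (fun i x => f x * partial i g x + g x * partial i f x)).
- by move=> x; exact: (cvgM (Cf.1 x) (Cg.1 x)).
- by move=> i x; exact: (is_deriveM (Ck_has_partial Cf i x) (Ck_has_partial Cg i x)).
- move=> i; apply: CkD; apply: IHk.
  + exact: CkW.
  + exact: (Cg.2 i).2.
  + exact: CkW.
  + exact: (Cf.2 i).2.
Qed.

Lemma Ck_prod k (I : Type) (r : seq I) (F : I -> 'rV[R]_n -> R) :
  (forall i, Ck k (F i)) -> Ck k (fun x => \prod_(i <- r) F i x).
Proof.
move=> CF; elim: r => [|i r IHr].
  have -> : (fun x => \prod_(i <- [::]) F i x) = fun=> 1.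
    by apply/funext => x; rewrite big_nil.
  exact: Ck_cst.
have -> : (fun x => \prod_(j <- i :: r) F j x) = (fun x => F i x * \prod_(j <- r) F j x).
  by apply/funext => x; rewrite big_cons.
exact: CkM.
Qed.

Lemma Ck_translate k f x : Ck k f -> Ck k (fun y => f (y - x)).
Proof.
have ct h : continuous h -> continuous (fun y : 'rV[R]_n => h (y - x) : R).
  move=> ch y; apply: (@continuous_comp _ _ _ (fun y : 'rV[R]_n => y - x) h); last exact: ch.
  exact: (cvgB cvg_id (cvg_cst x)).
elim: k f => [|k IHk] f Cf; first by split => //; exact: (ct f Cf.1).
apply: (@Ck_succ _ _ (fun i y => partial i f (y - x))); first exact: (ct f Cf.1).
  move=> i y; apply/is_derive_line.
  have /is_derive_line := Ck_has_partial Cf i (y - x).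
  by congr is_derive; apply/funext => t; rewrite addrAC.
by move=> i; apply: IHk; exact: (Cf.2 i).2.
Qed.

Lemma Ck_flat k P (a b : R) j : Ck k (fun y => flat P (a + b * y ord0 j)).
Proof.
have gl : has_grad (fun y : 'rV[R]_n => a + b * y ord0 j) (fun i _ => b * (i == j)%:R).
  have := has_gradD (has_grad_cst n a) (has_gradM (has_grad_cst n b) (has_grad_coord R j)).
  by apply: has_grad_ext => // i x; rewrite mulr0 addr0 add0r.
have [cl Dl _] := gl.
have cf P' : continuous (fun y : 'rV[R]_n => flat P' (a + b * y ord0 j)).
  move=> y; apply: (@continuous_comp _ _ _ (fun y : 'rV[R]_n => a + b * y ord0 j) (flat P')).
    exact: cl.
  exact: flat_continuous.
elim: k P => [|k IHk] P; first by split.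
apply: (@Ck_succ _ _ (fun i y => flat (dflat P) (a + b * y ord0 j) * (b * (i == j)%:R))) => //.
  move=> i x; exact: (is_derive_comp (f := fun y : 'rV[R]_n => a + b * y ord0 j) (is_derive_flat P _) (Dl i x)).
by move=> i; apply: CkM; [exact: IHk|exact: Ck_cst].
Qed.

Definition mollifier (eps : R) y : R :=
  \prod_(i <- index_enum 'I_n) (flat 1 (eps + 1 * y ord0 i) * flat 1 (eps + (- 1) * y ord0 i)).

Lemma Ck_mollifier k eps : Ck k (mollifier eps).
Proof. by apply: Ck_prod => i; apply: CkM; exact: Ck_flat. Qed.

Lemma mollifier_ge0 eps y : 0 <= mollifier eps y.
Proof. by apply: prodr_ge0 => i _; rewrite mulr_ge0 ?flat1_ge0. Qed.

Lemma mollifier_supp eps y i : eps <= `|y ord0 i| -> mollifier eps y = 0.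
Proof.
move=> ey; rewrite /mollifier (bigD1 i)//=.
suff -> : flat 1 (eps + 1 * y ord0 i) * flat 1 (eps + (- 1) * y ord0 i) = 0.
  by rewrite mul0r.
move: ey; rewrite ler_normr => /orP[h|h].
  by rewrite [X in _ * X]flat_le0 ?mulr0//; lra.
by rewrite flat_le0 ?mul0r//; lra.
Qed.

Lemma mollifier_gt0 eps : 0 < eps -> 0 < mollifier eps 0.
Proof.
move=> e0; apply: prodr_gt0 => i _; rewrite mulr_gt0// flat1_gt0// mxE.
  by rewrite mulr0 addr0.
by rewrite mulr0 addr0.
Qed.

Lemma mollifier_cube_supp eps : cube_supp eps (mollifier eps).
Proof. by move=> y i yi; apply: (@mollifier_supp _ _ i); exact: ltW. Qed.

Lemma mollifier_continuous eps : continuous (mollifier eps).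
Proof. exact: (Ck_mollifier 0 eps).1. Qed.

Lemma mollifier_integral_gt0 eps : 0 < eps ->
  0 < \int[lebesgue_rV R n]_y mollifier eps y.
Proof.
move=> e0; have c := @mollifier_continuous eps.
have p0 := mollifier_gt0 e0.
set p := mollifier eps 0 in p0.
have p20 : p / 2 < mollifier eps 0 by rewrite -/p; lra.
have := c 0 => /cvgr_gt /(_ _ p20) /nbhs_ballP[d /= d0 Hd].
have d20 : 0 < d / 2 by rewrite divr_gt0.
have mf : measurable_fun setT (mollifier eps) by exact: continuous_measurable_rV.
have [M _ HM] := cube_supp_bounded c (@mollifier_cube_supp eps).
have ip : (lebesgue_rV R n).-integrable setT (EFin \o mollifier eps).
  exact: cube_supp_integrable HM (@mollifier_cube_supp eps).
have mQ : measurable (cube (d / 2) : set 'rV[R]_n) by exact: measurable_cube.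
have L : (((p / 2) * (2 * (d / 2)) ^+ n)%:E <=
    \int[lebesgue_rV R n]_y (mollifier eps y)%:E)%E.
  rewrite EFinM -lebesgue_cube ?(ltW d20)//.
  apply: (@le_trans _ _ (\int[lebesgue_rV R n]_y ((p / 2)%:E * (\1_(cube (d / 2)) y)%:E))%E).
    rewrite ge0_integralZl//.
    - by rewrite integral_indic// setIT.
    - by apply/measurable_EFinP; exact: measurable_indic.
    - by rewrite lee_fin divr_ge0// ltW.
  apply: ge0_le_integral => //.
  - by move=> y _; rewrite -EFinM lee_fin mulr_ge0// divr_ge0// ltW.
  - by apply: measurable_funeM; apply/measurable_EFinP; exact: measurable_indic.
  - exact/measurable_EFinP.
  move=> y _; rewrite -EFinM lee_fin indicE.
  have [yQ|yQ] := pselect (cube (d / 2) y); last first.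
    by rewrite memNset// mulr0 mollifier_ge0.
  rewrite mem_set// mulr1; apply/ltW/Hd; apply/rV_ballP => // i.
  by rewrite mxE sub0r normrN; apply: le_lt_trans (yQ i) _; lra.
rewrite -lte_fin /Rintegral fineK; last exact: integrable_fin_num.
apply: lt_le_trans L; rewrite lte_fin mulr_gt0 ?exprn_gt0 ?mulr_gt0//; lra.
Qed.

Lemma mollifier_test_function eps x :
  test_function (fun y => mollifier eps (y - x)).
Proof.
split; first by move=> k; apply: Ck_translate; exact: Ck_mollifier.
pose B := eps + \sum_i `|x ord0 i|.
have sub : [set y | mollifier eps (y - x) != 0] `<=` cube B.
  move=> y /= yx i; rewrite leNgt; apply/negP => h; move/negP: yx; apply.
  apply/eqP; apply: (@mollifier_supp _ _ i); rewrite !mxE.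
  have : `|x ord0 i| <= \sum_i `|x ord0 i| by rewrite (bigD1 i)//= lerDl sumr_ge0.
  have := ler_normB (y ord0 i - x ord0 i) (- x ord0 i).
  rewrite opprK subrK normrN; move: h; rewrite /B; lra.
have cB : compact (cube B : set 'rV[R]_n) by exact: cube_compact.
have clB : closed (cube B : set 'rV[R]_n).
  by apply: compact_closed => //; exact: norm_hausdorff.
apply: (subclosed_compact _ cB); first exact: closed_closure.
by rewrite closureE => y; apply; split.
Qed.

End Ck_algebra.

(** * Mollification *)

Section mollification.
Variables (R : realType) (n : nat).
Local Notation leb := (lebesgue_rV R n).
Local Notation e_ i := (delta_mx ord0 i : 'rV[R]_n).
Implicit Types (w psi : 'rV[R]_n -> R) (x y z : 'rV[R]_n).

Definition cube_integrable w :=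
  measurable_fun setT w /\ forall B, leb.-integrable (cube B) (EFin \o w).

(** The quantitative bound lets uniform estimates on [psi] pass through the
integral. *)
Lemma cube_integrableM w psi (B M : R) : cube_integrable w ->
  measurable_fun setT psi -> (forall x, `|psi x| <= M) -> cube_supp B psi ->
  leb.-integrable setT (EFin \o (fun x => w x * psi x)) /\
  `|\int[leb]_x (w x * psi x)| <= M * \int[leb]_(x in cube B) `|w x|.
Proof.
move=> [mw iw] mpsi psiM psiB.
have mQ : measurable (cube B : set 'rV[R]_n) by exact: measurable_cube.
have M0 : 0 <= M by apply: le_trans (psiM 0).
have iaw : leb.-integrable (cube B) (EFin \o (fun x => `|w x|)).
  by have := integrable_norm (iw B).
have iMw : leb.-integrable (cube B) (EFin \o (fun x => M * `|w x|)).
  rewrite (_ : EFin \o _ = (fun x => M%:E * (`|w x|%R)%:E)%E); last first.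
    by apply/funext => x; rewrite /= EFinM.
  exact: integrableZl.
pose f x := w x * psi x.
have supp x : f x = (f \_ (cube B)) x.
  rewrite patchE; case: ifPn => // /negP xB.
  by rewrite /f (cube_suppN psiB) ?mulr0// => h; apply: xB; exact: mem_set.
have iB : leb.-integrable (cube B) (EFin \o (fun x => w x * psi x)).
  apply: le_integrable iMw => //.
    by apply/measurable_EFinP; apply: measurable_funTS; exact: measurable_funM.
  move=> x _; rewrite /= lee_fin normrM mulrC [leRHS]ger0_norm ?mulr_ge0//.
  exact: ler_wpM2r.
have iT : leb.-integrable setT (EFin \o (fun x => w x * psi x)).
  have := (integrable_mkcond _ mQ).1 iB; congr integrable.
  apply/funext => x; rewrite /= -/(f x) supp !patchE /=.
  by case: ifP.
split => //.
have -> : \int[leb]_x (w x * psi x) = \int[leb]_(x in cube B) (w x * psi x).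
  rewrite [RHS]Rintegral_mkcond; by apply: eq_Rintegral => x _; exact: supp.
apply: le_trans (le_normr_Rintegral mQ iB) _.
rewrite -RintegralZl//; apply: le_Rintegral => //.
  by have := integrable_norm iB.
move=> x _; rewrite normrM mulrC; exact: ler_wpM2r.
Qed.

(** The correlation of [w] with [psi], that is the convolution of [w] with the
reflection of [psi]. *)
Definition corr w psi x := \int[leb]_y (w y * psi (y - x)).

Lemma cube_supp_translate (B M : R) psi x : cube_supp B psi ->
  (forall i, `|x ord0 i| <= M) -> cube_supp (B + M) (fun y => psi (y - x)).
Proof.
move=> psiB xM y i yi; apply: (psiB _ i); rewrite !mxE.
have := ler_normB (y ord0 i - x ord0 i) (- x ord0 i).
by rewrite opprK subrK normrN; have := xM i; lra.
Qed.

Lemma coord_bound x : exists2 M, 0 <= M & forall i, `|x ord0 i| <= M.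
Proof.
exists (\sum_i `|x ord0 i|); first exact: sumr_ge0.
by move=> i; rewrite (bigD1 i)//= lerDl sumr_ge0.
Qed.

Let mtrans psi x : measurable_fun setT psi ->
  measurable_fun setT (fun y : 'rV[R]_n => psi (y - x)).
Proof. by move=> mp; apply: measurableT_comp => //; exact: measurable_rV_translate. Qed.

Lemma corr_integrable w psi (B : R) x : cube_integrable w -> continuous psi ->
  cube_supp B psi -> leb.-integrable setT (EFin \o (fun y => w y * psi (y - x))).
Proof.
move=> iw cpsi psiB; have [M M0 xM] := coord_bound x.
have [N _ HN] := cube_supp_bounded cpsi psiB.
have mpsi : measurable_fun setT psi by exact: continuous_measurable_rV.
by have [] := cube_integrableM iw (mtrans x mpsi) (fun y => HN (y - x))
  (cube_supp_translate psiB xM).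
Qed.

(** Uniform continuity of [psi] controls every integral of [w] against a function
[chi] dominated by small variations of [psi]; [chi] will be an increment of a
translate of [psi] or the error of its difference quotient. *)
Lemma corr_uniform w psi (B : R) x : cube_integrable w -> continuous psi ->
  cube_supp B psi -> exists2 L, 0 <= L & forall e, 0 < e -> exists2 d, 0 < d &
    forall chi : 'rV[R]_n -> R, measurable_fun setT chi ->
      (forall y, exists2 z : 'rV[R]_n, small d z & `|chi y| <= `|psi (y - x + z) - psi (y - x)|) ->
      `|\int[leb]_y (w y * chi y)| <= e * L.
Proof.
move=> iw cpsi psiB; have [M M0 xM] := coord_bound x.
pose C := B + M + 1.
have mQ : measurable (cube C : set 'rV[R]_n) by exact: measurable_cube.
exists (\int[leb]_(y in cube C) `|w y|).
  by apply: Rintegral_ge0 => y _.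
move=> e e0; have [d d0 Hd] := cube_supp_unif_continuous cpsi psiB e0.
exists (Num.min d 1); first by rewrite lt_min d0 ltr01.
move=> chi mchi Hchi.
have [] := @cube_integrableM w chi C e iw mchi _ _; last by [].
  move=> y; have [z zd h] := Hchi y; apply: le_trans h _; apply: Hd.
  by apply: smallW zd; rewrite ge_min lexx.
move=> y i yi; have [z zd h] := Hchi y.
apply/eqP; rewrite -normr_le0; apply: le_trans h _.
have z1 : `|z ord0 i| < 1 by apply: lt_le_trans (zd i) _; rewrite ge_min lexx orbT.
have h1 := ler_normB (y ord0 i - x ord0 i + z ord0 i) (z ord0 i - x ord0 i).
have h2 := ler_normB (y ord0 i - x ord0 i) (- x ord0 i).
have h3 := ler_normB (z ord0 i) (x ord0 i).
rewrite (_ : y ord0 i - x ord0 i + z ord0 i - (z ord0 i - x ord0 i) = y ord0 i) in h1; last by ring.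
rewrite opprK subrK normrN in h2.
have xi := xM i.
rewrite (psiB _ i) ?(psiB (y - x) i) ?subrr ?normr0// !mxE; move: yi; rewrite /C; lra.
Qed.

Lemma corrB w psi1 psi2 (B1 B2 : R) x1 x2 : cube_integrable w ->
  continuous psi1 -> cube_supp B1 psi1 -> continuous psi2 -> cube_supp B2 psi2 ->
  corr w psi1 x1 - corr w psi2 x2 =
  \int[leb]_y (w y * (psi1 (y - x1) - psi2 (y - x2))).
Proof.
move=> iw c1 s1 c2 s2; rewrite /corr -RintegralB//.
- by apply: eq_Rintegral => y _; rewrite mulrBr.
- exact: corr_integrable s1.
- exact: corr_integrable s2.
Qed.

Lemma corr_continuous w psi (B : R) : cube_integrable w -> continuous psi ->
  cube_supp B psi -> continuous (corr w psi).
Proof.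
move=> iw cpsi psiB x; have FF : Filter (nbhs x) by exact: nbhs_filter.
apply/cvgrPdist_le => e e0.
have mpsi : measurable_fun setT psi by exact: continuous_measurable_rV.
have [L L0 H] := corr_uniform x iw cpsi psiB.
have L1 : 0 < L + 1 by rewrite ltr_wpDl.
have [d d0 Hd] := H (e / (L + 1)) (divr_gt0 e0 L1).
apply: filterS (nbhsx_ballx x d d0) => x' /(rV_ballP _ _ d0) xx'.
rewrite distrC (corrB x' x iw cpsi psiB cpsi psiB).
apply: le_trans (Hd _ _ _) _.
- by apply: measurable_funB; exact: mtrans.
- move=> y; exists (x - x'); first by move=> i; rewrite !mxE.
  by rewrite addrA subrK.
by rewrite mulrAC ler_pdivrMr// ler_wpM2l ?(ltW e0)// lerDl.
Qed.

(** The sign comes from moving [x], which enters [psi] negatively; the same sign in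
the definition of weak derivatives cancels it. *)
Lemma corr_derive w psi dpsi (B : R) i x : cube_integrable w ->
  has_grad psi dpsi -> cube_supp B psi ->
  is_derive x (e_ i) (corr w psi) (- corr w (dpsi i) x).
Proof.
move=> iw gpsi psiB; have [cpsi _ cd] := gpsi.
have mpsi : measurable_fun setT psi by exact: continuous_measurable_rV.
have dB := has_grad_supp i gpsi psiB.
have mdpsi : measurable_fun setT (dpsi i) by exact: continuous_measurable_rV.
have [L L0 H] := corr_uniform x iw (cd i) dB.
have L1 : 0 < L + 1 by rewrite ltr_wpDl.
apply: is_derive_estimate => e e0.
have [d d0 Hd] := H (e / (L + 1)) (divr_gt0 e0 L1).
exists d => // h hd.
have [->|h0] := eqVneq h 0.
  by rewrite scale0r add0r subrr mul0r subrr normr0 mulr0.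
pose chi y := h^-1 * (psi (y - (h *: e_ i + x)) - psi (y - x)) + dpsi i (y - x).
have mchi : measurable_fun setT chi.
  apply: measurable_funD; last exact: mtrans.
  by apply: measurable_funM => //; apply: measurable_funB; exact: mtrans.
have chiE y : exists2 z, small d z & chi y = - (dpsi i (y - x + z) - dpsi i (y - x)).
  have [t th E] := has_grad_mvt i (y - x) (- h) gpsi.
  exists (t *: e_ i).
    move=> k; rewrite !mxE normrM; apply: le_lt_trans hd; rewrite -(normrN h).
    apply: le_trans th; rewrite ler_piMr//.
    by case: (_ && _); rewrite ?normr1 ?normr0.
  rewrite /chi opprD addrA addrAC -scaleNr E; field; exact: h0.
have bound := Hd chi mchi.
have -> : corr w psi (h *: e_ i + x) - corr w psi x - h * - corr w (dpsi i) x =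
    h * \int[leb]_y (w y * chi y).
  rewrite (corrB _ _ iw cpsi psiB cpsi psiB) mulrN opprK.
  have i1 := corr_integrable (h *: e_ i + x) iw cpsi psiB.
  have i2 := corr_integrable x iw cpsi psiB.
  have i3 := corr_integrable x iw (cd i) dB.
  have i12 : leb.-integrable setT
      (EFin \o (fun y => w y * (psi (y - (h *: e_ i + x)) - psi (y - x)))).
    have := integrableB measurableT i1 i2; congr integrable.
    by apply/funext => y /=; rewrite mulrBr EFinB.
  have i12' : leb.-integrable setT
      (EFin \o (fun y => h^-1 * (w y * (psi (y - (h *: e_ i + x)) - psi (y - x))))).
    have := integrableZl measurableT h^-1 i12; congr integrable.
  have -> : \int[leb]_y (w y * chi y) =
     h^-1 * \int[leb]_y (w y * (psi (y - (h *: e_ i + x)) - psi (y - x))) +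
     corr w (dpsi i) x.
    rewrite -RintegralZl// /corr -RintegralD//.
    by apply: eq_Rintegral => y _; rewrite /chi; ring.
  by field.
rewrite normrM mulrC; apply: ler_wpM2r => //.
apply: le_trans (bound _) _.
  by move=> y; have [z zd E] := chiE y; exists z => //; rewrite E normrN.
by rewrite mulrAC ler_pdivrMr// ler_wpM2l ?(ltW e0)// lerDl.
Qed.

(** Translated mollifiers are test functions, so the derivative that falls on them
can be moved onto the weak gradient of [u]. *)
Lemma mollify_has_grad (u : 'rV[R]_n -> R) (g : 'rV[R]_n -> 'rV[R]_n) (eps : R) :
  cube_integrable u -> (forall i, cube_integrable (fun x => g x ord0 i)) ->
  (forall i, weak_partial i u (fun x => g x ord0 i)) ->
  has_grad (corr u (mollifier eps))
    (fun i => corr (fun x => g x ord0 i) (mollifier eps)).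
Proof.
move=> iu ig wu.
have gm : has_grad (mollifier eps : 'rV[R]_n -> R) (fun i => partial i (mollifier eps)).
  exact: (@Ck1_has_grad _ _ 0 _ (Ck_mollifier n 1 eps)).
have cm := @mollifier_continuous R n eps.
have sm := @mollifier_cube_supp R n eps.
split.
- exact: corr_continuous sm.
- move=> i x; have := corr_derive i x iu gm sm; congr is_derive.
  have [_ _ W] := wu i.
  have := W _ (mollifier_test_function eps x).
  have -> : (fun y => u y * partial i (fun y => mollifier eps (y - x)) y) =
     (fun y => u y * partial i (mollifier eps) (y - x)).
    apply/funext => y.
    suff -> : partial i (fun y => mollifier eps (y - x)) y =
        partial i (mollifier eps) (y - x) by [].
    have D : is_derive y (e_ i) (fun y => mollifier eps (y - x))
        (partial i (mollifier eps) (y - x)).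
      apply/is_derive_line.
      have /is_derive_line := Ck_has_partial (Ck_mollifier n 1 eps) i (y - x).
      by congr is_derive; apply/funext => t; rewrite addrAC.
    by rewrite {1}/partial; case: D.
  by rewrite /corr => ->; rewrite opprK.
- by move=> i; apply: corr_continuous sm.
Qed.

End mollification.

Section mollification_error.
Variables (R : realType) (n : nat).
Local Notation leb := (lebesgue_rV R n).
Implicit Types (x y z : 'rV[R]_n).

Lemma cube_integrable_cst (c : R) : cube_integrable (fun _ : 'rV[R]_n => c).
Proof.
split => [|B]; first exact: measurable_cst.
have mQ : measurable (cube B : set 'rV[R]_n) by exact: measurable_cube.
apply: measurable_bounded_integrable => //; first exact: lebesgue_cube_fin.
exists `|c|; split; first exact: num_real.
by move=> M cM x _; exact: ltW.
Qed.

Lemma sq_cube_integrable (w : 'rV[R]_n -> R) :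
  cube_integrable (fun x => w x ^+ 2) -> measurable_fun setT w -> cube_integrable w.
Proof.
move=> [_ iw] mw; split => // B.
have mQ : measurable (cube B : set 'rV[R]_n) by exact: measurable_cube.
have i1 : leb.-integrable (cube B) (EFin \o (fun x => w x ^+ 2 + 1)).
  exact: (integrableD mQ (iw B) ((cube_integrable_cst 1).2 B)).
apply: le_integrable i1 => //.
  by apply/measurable_EFinP; exact: measurable_funTS.
move=> x _; rewrite /= lee_fin [leRHS]ger0_norm ?addr_ge0 ?sqr_ge0//.
rewrite -real_normK ?num_real//; have := sqr_ge0 (`|w x| - 1); have := normr_ge0 (w x); nra.
Qed.

Definition mollify (eps : R) (w : 'rV[R]_n -> R) x : R :=
  (\int[leb]_y mollifier eps y)^-1 * corr w (mollifier eps) x.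

(** Jensen's inequality for the square, proved as nonnegativity of the variance of
[w] under the mollifying density. *)
Lemma mollify_jensen (w : 'rV[R]_n -> R) (eps : R) x :
  cube_integrable (fun x => w x ^+ 2) -> measurable_fun setT w -> 0 < eps ->
  (((mollify eps w x - w x) ^+ 2)%:E <=
   \int[leb]_z ((w (x + z)%R - w x) ^+ 2 *
     ((\int[leb]_y mollifier eps y)^-1 * mollifier eps z))%:E)%E.
Proof.
move=> iw2 mw e0; have iw := sq_cube_integrable iw2 mw.
have cm := @mollifier_continuous R n eps.
have sm := @mollifier_cube_supp R n eps.
have mm : measurable_fun setT (mollifier eps : 'rV[R]_n -> R).
  exact: continuous_measurable_rV.
have c0 := @mollifier_integral_gt0 R n eps e0.
rewrite /mollify; set c := \int[leb]_y _ in c0 *.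
have mt (f : 'rV[R]_n -> R) v : measurable_fun setT f ->
    measurable_fun setT (fun y : 'rV[R]_n => f (y + v)).
  by move=> mf; apply: measurableT_comp => //; exact: measurable_rV_translate.
pose p y := mollifier eps (y - x).
have ip h : cube_integrable h -> leb.-integrable setT (EFin \o (fun y => h y * p y)).
  by move=> ih; exact: corr_integrable ih cm sm.
have I0 : \int[leb]_y p y = c.
  apply: (congr1 fine).
  apply: (@integral_translate _ _ (fun y => (mollifier eps y)%:E) (- x)).
  exact/measurable_EFinP.
have i0 : leb.-integrable setT (EFin \o p).
  have := ip _ (cube_integrable_cst 1); congr integrable.
  by apply/funext => y; rewrite /= mul1r.
have i1 := ip _ iw; have i2 := ip _ iw2.
set a := c^-1 * corr w (mollifier eps) x - w x.
(* integrals against [p] of quadratic polynomials in [w], for all coefficients at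
   once: those of the deviation from [w x] and from the mean are needed *)
have E (b : R) (s t : R) : leb.-integrable setT
    (EFin \o (fun y => b * (w y ^+ 2 * p y) + s * (w y * p y) + t * p y)) /\
  \int[leb]_y (b * (w y ^+ 2 * p y) + s * (w y * p y) + t * p y) =
  b * \int[leb]_y (w y ^+ 2 * p y) + s * corr w (mollifier eps) x + t * c.
  have j2 : leb.-integrable setT (EFin \o (fun y => b * (w y ^+ 2 * p y))).
    exact: (integrableZl measurableT b i2).
  have j1 : leb.-integrable setT (EFin \o (fun y => s * (w y * p y))).
    exact: (integrableZl measurableT s i1).
  have j0 : leb.-integrable setT (EFin \o (fun y => t * p y)).
    exact: (integrableZl measurableT t i0).
  have j21 : leb.-integrable setT
     (EFin \o (fun y => b * (w y ^+ 2 * p y) + s * (w y * p y))).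
    exact: (integrableD measurableT j2 j1).
  split; first exact: (integrableD measurableT j21 j0).
  rewrite (RintegralD measurableT j21 j0) (RintegralD measurableT j2 j1).
  rewrite (RintegralZl _ measurableT i2) (RintegralZl _ measurableT i1).
  by rewrite (RintegralZl _ measurableT i0) I0.
have -> : (\int[leb]_z ((w (x + z)%R - w x) ^+ 2 * (c^-1 * mollifier eps z))%:E =
    \int[leb]_y ((w y - w x) ^+ 2 * (c^-1 * p y))%:E)%E.
  rewrite -[RHS](@integral_translate _ _
     (fun y => ((w y - w x) ^+ 2 * (c^-1 * p y))%:E) x).
    by apply: eq_integral => z _; rewrite /p addrK [z + x]addrC.
  apply/measurable_EFinP; apply: measurable_funM.
    by apply: measurable_funX; exact: measurable_funB.
  by apply: measurable_funM => //; exact: mt.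
have sqE y : (w y - w x) ^+ 2 * (c^-1 * p y) =
    c^-1 * (w y ^+ 2 * p y) + (- 2 * c^-1 * w x) * (w y * p y) + (c^-1 * w x ^+ 2) * p y.
  by ring.
under eq_integral do rewrite sqE.
have [iJ EJ] := E c^-1 (- 2 * c^-1 * w x) (c^-1 * w x ^+ 2).
rewrite -(@fineK _ (\int[leb]_y _)%E); last exact: integrable_fin_num.
rewrite -/(Rintegral _ _ _) lee_fin EJ.
have [iV EV] := E c^-1 (- 2 * c^-1 * (w x + a)) (c^-1 * (w x + a) ^+ 2).
have : 0 <= \int[leb]_y (c^-1 * (w y ^+ 2 * p y) + (- 2 * c^-1 * (w x + a)) * (w y * p y) +
    (c^-1 * (w x + a) ^+ 2) * p y).
  apply: Rintegral_ge0 => y _.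
  have -> : c^-1 * (w y ^+ 2 * p y) + (- 2 * c^-1 * (w x + a)) * (w y * p y) +
    (c^-1 * (w x + a) ^+ 2) * p y = (w y - (w x + a)) ^+ 2 * (c^-1 * p y) by ring.
  apply: mulr_ge0; first exact: sqr_ge0.
  by apply: mulr_ge0; [rewrite invr_ge0 ltW|exact: mollifier_ge0].
rewrite EV.
have -> : corr w (mollifier eps) x = c * (a + w x).
  by rewrite /a subrK mulrA mulfV ?mul1r// gt_eqF.
rewrite -subr_ge0; congr (_ <= _).
by field; rewrite gt_eqF.
Qed.

(** Integrate the Jensen bound over the cube and exchange the integrals: the error
is an average over small translations. *)
Lemma mollify_L2 (w : 'rV[R]_n -> R) (eps B e : R) :
  cube_integrable (fun x => w x ^+ 2) -> measurable_fun setT w -> 0 < eps ->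
  (forall z, small eps z ->
     (\int[leb]_(x in cube B) ((w (x + z)%R - w x) ^+ 2)%:E <= e%:E)%E) ->
  (\int[leb]_(x in cube B) ((mollify eps w x - w x) ^+ 2)%:E <= e%:E)%E.
Proof.
move=> iw2 mw e0 H; have iw := sq_cube_integrable iw2 mw.
have cm := @mollifier_continuous R n eps.
have sm := @mollifier_cube_supp R n eps.
have mm : measurable_fun setT (mollifier eps : 'rV[R]_n -> R).
  exact: continuous_measurable_rV.
have c0 := @mollifier_integral_gt0 R n eps e0.
have mQ : measurable (cube B : set 'rV[R]_n) by exact: measurable_cube.
set c := \int[leb]_y mollifier eps y in c0 *.
pose p z := c^-1 * mollifier eps z.
have p0 z : 0 <= p z by rewrite mulr_ge0 ?mollifier_ge0// invr_ge0 ltW.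
have mp : measurable_fun setT p by exact: measurable_funM.
have mv : measurable_fun setT (mollify eps w).
  by apply: measurable_funM => //; apply: continuous_measurable_rV; exact: corr_continuous sm.
pose h (q : 'rV[R]_n * 'rV[R]_n) : \bar R :=
  ((w (q.1 + q.2) - w q.1) ^+ 2 * p q.2 * \1_(cube B) q.1)%:E.
have madd : measurable_fun setT (fun q : 'rV[R]_n * 'rV[R]_n => q.1 + q.2).
  apply: measurable_fun_rV => i.
  rewrite (_ : _ \o _ = (fun q => rV_coord i q.1 + rV_coord i q.2)).
    by apply: measurable_funD; apply: measurableT_comp => //; exact: measurable_rV_coord.
  by apply/funext => q; rewrite /rV_coord /= mxE.
have mh : measurable_fun setT h.
  apply/measurable_EFinP; apply: measurable_funM; last first.
    by apply: measurableT_comp => //; exact: measurable_indic.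
  apply: measurable_funM; last by apply: measurableT_comp.
  apply: measurable_funX; apply: measurable_funB; last exact: measurableT_comp.
  exact: measurableT_comp.
have h0 q : (0 <= h q)%E.
  by rewrite lee_fin; apply: mulr_ge0 => //; apply: mulr_ge0 => //; exact: sqr_ge0.
apply: (@le_trans _ _ (\int[leb]_x \int[leb]_z h (x, z))%E).
  rewrite integral_mkcond; apply: ge0_le_integral => //.
  - by move=> x _; rewrite patchE; case: ifP => // _; rewrite lee_fin sqr_ge0.
  - apply: (measurable_restrictT (fun x => ((mollify eps w x - w x) ^+ 2)%:E) mQ).1.
    apply: measurable_funTS; apply/measurable_EFinP; apply: measurable_funX.
    exact: measurable_funB.
  - exact: (@measurable_fun_fubini_tonelli_F _ _ _ _ _ leb h mh).
  move=> x _; rewrite patchE; case: ifPn => xB; last exact: integral_ge0.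
  apply: le_trans (mollify_jensen x iw2 mw e0) _.
  rewrite le_eqVlt; apply/orP; left; apply/eqP; apply: eq_integral => z _.
  by rewrite /h /= indicE xB mulr1.
rewrite fubini_tonelli//.
apply: (@le_trans _ _ (\int[leb]_z (e%:E * (p z)%:E))%E).
  apply: ge0_le_integral => //.
  - by move=> z _; apply: integral_ge0.
  - exact: (@measurable_fun_fubini_tonelli_G _ _ _ _ _ leb h mh).
  - by apply: measurable_funeM; exact/measurable_EFinP.
  move=> z _.
  have mwz : measurable_fun setT (fun x : 'rV[R]_n => ((w (x + z) - w x) ^+ 2)%:E).
    apply/measurable_EFinP; apply: measurable_funX; apply: measurable_funB => //.
    by apply: measurableT_comp => //; exact: measurable_rV_translate.
  have -> : (\int[leb]_x h (x, z) =
      (p z)%:E * \int[leb]_(x in cube B) ((w (x + z)%R - w x) ^+ 2)%:E)%E.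
    rewrite -ge0_integralZl//; last 3 first.
    - exact: measurable_funTS.
    - by move=> x _; rewrite lee_fin sqr_ge0.
    - by rewrite lee_fin.
    rewrite [RHS]integral_mkcond; apply: eq_integral => x _.
    rewrite patchE /h /= indicE; case: ifP => _; last by rewrite mulr0.
    by rewrite mulr1 mulrC EFinM.
  have [zs|/existsNP[i /negP]] := pselect (small eps z).
    by rewrite muleC; apply: lee_wpmul2r; rewrite ?lee_fin//; exact: H.
  by rewrite -leNgt /p => /mollifier_supp ->; rewrite mulr0 mul0e mule0.
have e1 : (0 <= e%:E)%E.
  have s0 : small eps (0 : 'rV[R]_n) by move=> i; rewrite mxE normr0.
  by apply: le_trans (H 0 s0); apply: integral_ge0 => x _; rewrite lee_fin sqr_ge0.
rewrite ge0_integralZl//; last 2 first.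
- exact/measurable_EFinP.
- by move=> z _; rewrite lee_fin.
have -> : (\int[leb]_z (p z)%:E = 1)%E.
  have [M _ HM] := cube_supp_bounded cm sm.
  have ip : leb.-integrable setT (EFin \o mollifier eps).
    exact: cube_supp_integrable HM sm.
  rewrite /p; under eq_integral do rewrite EFinM.
  rewrite integralZl//.
  rewrite -(@fineK _ (\int[leb]_y _)%E); last exact: integrable_fin_num.
  by rewrite -/(Rintegral _ _ _) -/c -EFinM mulVf// gt_eqF.
by rewrite mule1.
Qed.

End mollification_error.

(** * Density of C^1 functions of bounded support in H^1 *)

Lemma ge0_integral_le_comb d (T : measurableType d) (R : realType)
    (mu : {measure set T -> \bar R}) (F G H : T -> R) (a b s t : R) :
  measurable_fun setT F -> measurable_fun setT G -> measurable_fun setT H ->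
  (forall x, 0 <= F x) -> (forall x, 0 <= G x) -> (forall x, 0 <= H x) ->
  0 <= a -> 0 <= b -> (forall x, F x <= a * G x + b * H x) ->
  (\int[mu]_x (G x)%:E <= s%:E)%E -> (\int[mu]_x (H x)%:E <= t%:E)%E ->
  (\int[mu]_x (F x)%:E <= (a * s + b * t)%:E)%E.
Proof.
move=> mF mG mH F0 G0 H0 a0 b0 FGH Gs Ht.
have mE (f : T -> R) : measurable_fun setT f -> measurable_fun setT (EFin \o f).
  by move=> ?; exact/measurable_EFinP.
apply: (@le_trans _ _ (\int[mu]_x (a%:E * (G x)%:E + b%:E * (H x)%:E))%E).
  apply: ge0_le_integral => //.
  - by move=> x _; rewrite lee_fin.
  - exact: mE.
  - by apply: emeasurable_funD; apply: measurable_funeM; exact: mE.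
  - by move=> x _; rewrite -!EFinM -EFinD lee_fin.
have aG x : (0 <= a%:E * (G x)%:E)%E by rewrite -EFinM lee_fin mulr_ge0.
have bH x : (0 <= b%:E * (H x)%:E)%E by rewrite -EFinM lee_fin mulr_ge0.
rewrite ge0_integralD//; last 2 first.
- by apply: measurable_funeM; exact: mE.
- by apply: measurable_funeM; exact: mE.
have E (f : T -> R) k : measurable_fun setT f -> (forall x : T, 0 <= f x) -> 0 <= k ->
    (\int[mu]_x (k%:E * (f x)%:E) = k%:E * \int[mu]_x (f x)%:E)%E.
  move=> mf f0 k0; rewrite ge0_integralZl//; first exact: mE.
  by move=> x _; rewrite lee_fin.
rewrite !E//.
by rewrite EFinD !EFinM; apply: leeD; apply: lee_wpmul2l.
Qed.

Section sobolev_approximation.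
Variables (R : realType) (n : nat) (mu : probability 'rV[R]_n R).
Variables (V : 'rV[R]_n -> R) (Z : R).
Hypotheses (Z0 : 0 < Z) (cV : continuous V) (muV : has_gibbs_density mu V Z).
Local Notation leb := (lebesgue_rV R n).
Implicit Types (x : 'rV[R]_n) (h u : 'rV[R]_n -> R).

Let den x := Z^-1 * expR (- V x).

Let mden : measurable_fun setT den.
Proof.
have mV : measurable_fun setT V by exact: continuous_measurable_rV.
apply: measurable_funM => //; apply: measurableT_comp => //.
exact: measurableT_comp.
Qed.

Let den0 x : 0 <= den x.
Proof. by rewrite mulr_ge0 ?expR_ge0 ?invr_ge0 ?ltW. Qed.

(** On cubes [mu] and the Lebesgue measure are comparable, so local statements can
be moved from one to the other. *)
Lemma density_cube_bounds (B : R) : exists a A, [/\ 0 < a, 0 < A &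
  forall x, cube B x -> a <= den x <= A].
Proof.
have /compact_bounded[M [_ HM]] : compact (V @` cube B).
  apply: continuous_compact; last exact: cube_compact.
  by apply: continuous_subspaceT.
pose M1 := `|M| + 1.
exists (Z^-1 * expR (- M1)), (Z^-1 * expR M1); split.
- by rewrite mulr_gt0 ?invr_gt0 ?expR_gt0.
- by rewrite mulr_gt0 ?invr_gt0 ?expR_gt0.
move=> x xB.
have : `|V x| <= M1.
  apply: (HM M1); last by exists x.
  by rewrite (le_lt_trans (ler_norm _))// ltrDl.
rewrite ler_norml => /andP[V1 V2].
by rewrite /den !ler_pM2l ?invr_gt0// !ler_expR; apply/andP; split; lra.
Qed.

Lemma Lfun2_measurable h : h \in Lfun mu 2%:E -> measurable_fun setT h.
Proof.
move=> h2; have : h \in Lfun mu 1%:E.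
  by apply: Lfun_subset12 => //; exact: fin_num_measure.
by move/Lfun1_integrable => /measurable_int /measurable_EFinP.
Qed.

(** The density is bounded below on cubes, so [L^2(mu)] functions are locally
square integrable for the Lebesgue measure. *)
Lemma Lfun2_sq_cube_integrable h : h \in Lfun mu 2%:E ->
  cube_integrable (fun x => h x ^+ 2).
Proof.
move=> h2; have mh := Lfun2_measurable h2.
have mh2 : measurable_fun setT (fun x => h x ^+ 2) by exact: measurable_funX.
split => // B.
have [a [A [a0 A0 HB]]] := density_cube_bounds B.
have mQ : measurable (cube B : set 'rV[R]_n) by exact: measurable_cube.
have ih := Lfun2_integrable_sqr h2.
apply/integrableP; split; first by apply/measurable_EFinP; exact: measurable_funTS.
apply: (@le_lt_trans _ _ ((a^-1)%:E * \int[mu]_x (h x ^+ 2)%:E)%E).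
  rewrite (@ge0_integral_density _ _ _ leb mu _ mden den0)//; last 2 first.
  - exact/measurable_EFinP.
  - by move=> x; rewrite lee_fin sqr_ge0.
  have i0 : (0 <= (a^-1)%:E)%E by rewrite lee_fin invr_ge0 ltW.
  rewrite -ge0_integralZl//; last 2 first.
  - by apply: emeasurable_funM; apply/measurable_EFinP.
  - by move=> x _; apply: mule_ge0; rewrite lee_fin// sqr_ge0.
  rewrite [leLHS]integral_mkcond; apply: ge0_le_integral => //.
  - by move=> x _; rewrite patchE; case: ifP => // _; exact: abse_ge0.
  - apply: (measurable_restrictT (fun x => `|(h x ^+ 2)%:E|)%E mQ).1.
    apply: measurable_funTS; apply: measurableT_comp => //.
    exact/measurable_EFinP.
  - apply: measurable_funeM; apply: emeasurable_funM; exact/measurable_EFinP.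
  move=> x _; rewrite patchE; case: ifPn => [xB|_].
    rewrite /= lee_fin ger0_norm ?sqr_ge0//.
    have /andP[h1 _] := HB x (set_mem xB).
    by rewrite mulrCA ler_peMr ?sqr_ge0// mulrC ler_pdivlMr// mul1r.
  by rewrite lee_fin mulr_ge0 ?invr_ge0 ?(ltW a0)// mulr_ge0// sqr_ge0.
have := integrable_fin_num measurableT ih.
rewrite /= => fi; rewrite -(fineK fi) -EFinM ltry//.
Qed.

(** Truncation at distance of order [N]; its gradient is of order [1 / N]. *)
Let chi (N : nat) x := bump2 ((N.+1%:R ^- 2 : R) * sqn x).

Let chi_grad N : has_grad (chi N)
  (fun i x => dbump2 (N.+1%:R ^- 2 * sqn x) * (N.+1%:R ^- 2 * (2 * x ord0 i))).
Proof.
have := has_grad_comp (@is_derive_bump2 R) (@dbump2_continuous R)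
  (has_gradM (has_grad_cst n (N.+1%:R ^- 2)) (@has_grad_sqn R n)).
by apply: has_grad_ext => // i x; rewrite mulr0 addr0.
Qed.

Let N0 N : 0 < N.+1%:R ^- 2 :> R.
Proof. by rewrite invr_gt0 exprn_gt0. Qed.

Let chi01 N x : 0 <= chi N x <= 1.
Proof. by rewrite bump2_ge0 bump2_le1// mulr_ge0 ?sqn_ge0// ltW. Qed.

Let out_cube N x i : N.+1%:R < `|x ord0 i| -> 1 <= N.+1%:R ^- 2 * sqn x.
Proof.
move=> xi; rewrite mulrC ler_pdivlMr ?exprn_gt0// mul1r /sqn (bigD1 i)//= -[leLHS]addr0.
apply: lerD; last by apply: sumr_ge0 => j _; exact: sqr_ge0.
by rewrite -[leRHS]real_normK ?num_real// lerXn2r ?nnegrE// ltW.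
Qed.

Let chi_supp N : cube_supp N.+1%:R (chi N).
Proof.
move=> x i /out_cube h; rewrite /chi /bump2 max_l ?expr0n//.
by rewrite subr_le0.
Qed.

Let dchi_bound N i x :
  (dbump2 (N.+1%:R ^- 2 * sqn x) * (N.+1%:R ^- 2 * (2 * x ord0 i))) ^+ 2 <=
  16 * N.+1%:R ^- 2.
Proof.
have c0 := N0 N; set c := N.+1%:R ^- 2 in c0 *.
rewrite /dbump2; case: (leP 0 (1 - c * sqn x)) => h; last first.
  by rewrite mulr0 mul0r expr0n/= mulr_ge0// ltW.
set m := 1 - c * sqn x in h *.
have m1 : m <= 1 by rewrite /m lerBlDr lerDl mulr_ge0 ?sqn_ge0// ltW.
have xs : c * x ord0 i ^+ 2 <= 1.
  apply: (@le_trans _ _ (c * sqn x)); last by rewrite /m in h; lra.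
  rewrite ler_pM2l// /sqn (bigD1 i)//= lerDl.
  by apply: sumr_ge0 => j _; exact: sqr_ge0.
have -> : (- 2 * m * (c * (2 * x ord0 i))) ^+ 2 =
  16 * c * (m ^+ 2 * (c * x ord0 i ^+ 2)) by ring.
rewrite ler_piMr ?mulr_ge0 ?(ltW c0)//.
have : 0 <= c * x ord0 i ^+ 2 by rewrite mulr_ge0 ?sqr_ge0// ltW.
have : m ^+ 2 <= 1 by rewrite expr_le1.
have := sqr_ge0 m; nra.
Qed.

Let chi_cvg x : chi N x @[N --> \oo] --> (1 : R).
Proof.
have -> : 1 = bump2 (0 * sqn x) :> R.
  by rewrite mul0r /bump2 subr0 max_r// expr1n.
have c1 : (N.+1%:R ^- 2 : R) @[N --> \oo] --> (0 : R).
  have h : (N.+1%:R^-1 : R) @[N --> \oo] --> (0 : R) by exact: cvg_harmonic.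
  have -> : (fun N : nat => N.+1%:R ^- 2 : R) = (fun N : nat => N.+1%:R^-1 * N.+1%:R^-1).
    by apply/funext => N; rewrite -invfM.
  by rewrite -[X in _ --> X](mulr0 0); exact: (cvgM h h).
have c2 : (N.+1%:R ^- 2 * sqn x : R) @[N --> \oo] --> 0 * sqn x.
  exact: (cvgM c1 (cvg_cst _)).
have cb : {for 0 * sqn x, continuous (@bump2 R)}; last exact: (continuous_cvg _ cb c2).
by apply/differentiable_continuous/derivable1_diffP; case: (is_derive_bump2 (0 * sqn x)).
Qed.

Let mchi N : measurable_fun setT (chi N).
Proof. by apply: continuous_measurable_rV; case: (chi_grad N). Qed.

(** Dominated convergence: the mass left outside the truncation vanishes. *)
Let tail_cvg h : h \in Lfun mu 2%:E ->
  (\int[mu]_x (((1 - chi N x) * h x) ^+ 2)%:E)%E @[N --> \oo] --> 0%E.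
Proof.
move=> h2; have mh := Lfun2_measurable h2.
have ih := Lfun2_integrable_sqr h2.
have mF N : measurable_fun setT (fun x => (((1 - chi N x) * h x) ^+ 2)%:E).
  apply/measurable_EFinP; apply: measurable_funX; apply: measurable_funM => //.
  exact: measurable_funB.
have cF x : (((1 - chi N x) * h x) ^+ 2)%:E @[N --> \oo] --> (0 : R)%:E.
  apply: cvg_EFin; first exact: nearW.
  have c1 : ((1 - chi N x) * h x) @[N --> \oo] --> (1 - 1) * h x.
    exact: (cvgM (cvgB (cvg_cst _) (chi_cvg x)) (cvg_cst _)).
  have -> : 0 = (1 - 1) * h x * ((1 - 1) * h x) by rewrite subrr !mul0r.
  exact: (cvgM c1 c1).
have dom : \forall x \ae mu, forall N, setT x ->
   (`|(((1 - chi N x) * h x) ^+ 2)%:E| <= ((h x ^+ 2)%R)%:E)%E.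
  apply: aeW => x N _; rewrite /= lee_fin ger0_norm ?sqr_ge0// exprMn.
  rewrite ler_piMl ?sqr_ge0// expr_le1//; have := chi01 N x; lra.
have [_ _] := @dominated_convergence _ _ _ mu setT measurableT _ (fun=> 0%E) _
  mF (measurable_cst _) (aeW _ (fun x _ => cF x)) ih dom.
by rewrite integral0.
Qed.

(** [translate_L2] and [mollify_L2], transferred to [mu] by comparability on the
cube. *)
Let cube_error h (N : nat) (e : R) : h \in Lfun mu 2%:E -> 0 < e ->
  exists2 d, 0 < d & forall eps, 0 < eps -> eps <= d ->
    (\int[mu]_x ((mollify eps h x - h x) ^+ 2 * \1_(cube N.+1%:R) x)%:E <= e%:E)%E.
Proof.
move=> h2 e0; have mh := Lfun2_measurable h2.
have ih := Lfun2_sq_cube_integrable h2.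
have [a [A [a0 A0 HA]]] := density_cube_bounds N.+1%:R.
have eA : 0 < e / A by rewrite divr_gt0.
have mQ : measurable (cube N.+1%:R : set 'rV[R]_n) by exact: measurable_cube.
have [d d0 Hd] := translate_L2 N.+1%:R mh ih.2 eA.
exists d => // eps eps0 epsd.
have L2 := mollify_L2 ih mh eps0 (fun z zs => Hd z (smallW epsd zs)).
have mv : measurable_fun setT (mollify eps h).
  apply: measurable_funM => //; apply: continuous_measurable_rV.
  apply: corr_continuous (@mollifier_continuous R n eps) (@mollifier_cube_supp R n eps).
  exact: sq_cube_integrable.
have md : measurable_fun setT (fun x => (mollify eps h x - h x) ^+ 2).
  by apply: measurable_funX; exact: measurable_funB.
have mi : measurable_fun setT (\1_(cube N.+1%:R) : 'rV[R]_n -> R).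
  exact: measurable_indic.
rewrite (@ge0_integral_density _ _ _ leb mu _ mden den0)//; last 2 first.
- by apply/measurable_EFinP; exact: measurable_funM.
- by move=> x; rewrite lee_fin mulr_ge0// sqr_ge0.
apply: (@le_trans _ _ (A%:E * \int[leb]_(x in cube N.+1%:R) ((mollify eps h x - h x) ^+ 2)%:E)%E).
  have A0' : (0 <= A%:E)%E by rewrite lee_fin ltW.
  rewrite -ge0_integralZl//; last 2 first.
  - by apply/measurable_EFinP; exact: measurable_funTS.
  - by move=> x _; rewrite lee_fin sqr_ge0.
  rewrite [leRHS]integral_mkcond; apply: ge0_le_integral => //.
  - by move=> x _; apply: mule_ge0; rewrite lee_fin// mulr_ge0// sqr_ge0.
  - by apply: emeasurable_funM; apply/measurable_EFinP => //; exact: measurable_funM.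
  - apply: (measurable_restrictT (fun x => (A%:E * ((mollify eps h x - h x) ^+ 2)%:E)%E) mQ).1.
    by apply: measurable_funTS; apply: measurable_funeM; exact/measurable_EFinP.
  move=> x _; rewrite patchE indicE; case: ifPn => xQ; last by rewrite mulr0 mul0e.
  rewrite mulr1 -!EFinM lee_fin mulrC ler_wpM2r ?sqr_ge0//.
  by have /andP[] := HA x (set_mem xQ).
have -> : e%:E = (A%:E * (e / A)%:E)%E.
  by rewrite -EFinM; congr EFin; field; rewrite gt_eqF.
by rewrite lee_pmul2l.
Qed.

(** Truncate first, at a level [N] that makes the tails of [u] and [g] and the term
[u grad chi] small, then mollify on a scale chosen for the cube of that level. *)
Lemma H1_approximation u (g : 'rV[R]_n -> 'rV[R]_n) (e : R) :
  H1_grad mu u g -> 0 < e -> exists f df B,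
  [/\ has_grad f df, cube_supp B f,
    (\int[mu]_x ((f x - u x) ^+ 2)%:E <= e%:E)%E &
    forall i, (\int[mu]_x ((df i x - g x ord0 i) ^+ 2)%:E <= e%:E)%E].
Proof.
move=> [u2 Hg] e0.
have g2 i : (fun x => g x ord0 i) \in Lfun mu 2%:E by case: (Hg i).
pose hh (j : option 'I_n) := if j is Some i then (fun x => g x ord0 i) else u.
have hh2 j : hh j \in Lfun mu 2%:E.
  by case: j => [i|]; [exact: g2|exact: u2].
have mhh j := Lfun2_measurable (hh2 j).
have iu2 := Lfun2_integrable_sqr u2.
pose U := fine (\int[mu]_x (u x ^+ 2)%:E).
have UE : (\int[mu]_x (u x ^+ 2)%:E = U%:E)%E.
  by rewrite /U fineK//; exact: (integrable_fin_num measurableT iu2).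
have U0 : 0 <= U by apply: fine_ge0; apply: integral_ge0 => x _; rewrite lee_fin sqr_ge0.
have [N [HN1 HN2]] : exists N,
   (forall j, (\int[mu]_x (((1 - chi N x) * hh j x) ^+ 2)%:E <= (e / 16)%:E)%E) /\
   16 * N.+1%:R ^- 2 * U <= e / 16.
  have n1 : \forall N \near \oo, forall j,
      (\int[mu]_x (((1 - chi N x) * hh j x) ^+ 2)%:E <= (e / 16)%:E)%E.
    apply: filter_forall => j.
    have e16 : 0 < e / 16 by rewrite divr_gt0.
    have /fine_cvgP[f1 f2] := tail_cvg (hh2 j).
    have /cvgr_le/(_ _ e16) f3 := f2.
    near=> N.
    have fN : (\int[mu]_x (((1 - chi N x) * hh j x) ^+ 2)%:E \is a fin_num)%E by near: N.
    by rewrite -(fineK fN) lee_fin; near: N.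
  have n2 : \forall N \near \oo, 16 * N.+1%:R ^- 2 * U <= e / 16.
    pose c := 256 * (U + 1) / e.
    have U1 : 0 < U + 1 by rewrite ltr_wpDl.
    near=> N.
    have cN : c <= N%:R by near: N; exact: nbhs_infty_ger.
    have N1 : 1 <= N.+1%:R :> R by rewrite ler1n.
    have cN' : c <= N.+1%:R ^+ 2.
      apply: (le_trans cN); apply: (@le_trans _ _ N.+1%:R); first by rewrite ler_nat.
      by rewrite expr2 ler_peMr.
    have Np : 0 < N.+1%:R ^+ 2 :> R by rewrite exprn_gt0.
    rewrite mulrAC ler_pdivrMr//.
    apply: (@le_trans _ _ (e / 16 * c)); last by rewrite ler_pM2l ?divr_gt0.
    have -> : e / 16 * c = 16 * (U + 1) by rewrite /c; field; rewrite gt_eqF.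
    by rewrite ler_pM2l// lerDl.
  exact: (filter_ex (filterI n1 n2)).
have e17 : 0 < e / (16 * 17) by rewrite divr_gt0.
have /choice[d Hd] : forall j, exists d, 0 < d /\ forall eps, 0 < eps -> eps <= d ->
    (\int[mu]_x ((mollify eps (hh j) x - hh j x) ^+ 2 * \1_(cube N.+1%:R) x)%:E
       <= (e / (16 * 17))%:E)%E.
  by move=> j; have [d d0 H] := cube_error N (hh2 j) e17; exists d.
pose eps := \big[Num.min/1]_j d j.
have eps0 : 0 < eps by apply: lt_bigmin => // j _; case: (Hd j).
have Heps j := (Hd j).2 eps eps0 (bigmin_le_cond _ _ (erefl : xpredT j)).
pose v := mollify eps u; pose dv i := mollify eps (fun x => g x ord0 i).
have gv : has_grad v dv.
  have sq (j : option 'I_n) : cube_integrable (hh j).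
    by apply: sq_cube_integrable => //; exact: Lfun2_sq_cube_integrable.
  have := has_gradM (has_grad_cst n (\int[leb]_y mollifier eps y)^-1)
    (mollify_has_grad eps (sq None) (fun i => sq (Some i)) (fun i => (Hg i).2)).
  by apply: has_grad_ext => // i x; rewrite mulr0 addr0.
have gf := has_gradM (chi_grad N) gv.
set df := (X in has_grad _ X) in gf.
pose dchi i x := dbump2 (N.+1%:R ^- 2 * sqn x) * (N.+1%:R ^- 2 * (2 * x ord0 i)).
have dfE i x : df i x = chi N x * dv i x + v x * dchi i x by [].
have mv : measurable_fun setT v by apply: continuous_measurable_rV; case: gv.
have mdf i : measurable_fun setT (df i).
  by apply: continuous_measurable_rV; case: gf => _ _ h; exact: h.
have mdv i : measurable_fun setT (dv i).
  by apply: continuous_measurable_rV; case: gv => _ _ h; exact: h.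
have mI : measurable_fun setT (\1_(cube N.+1%:R) : 'rV[R]_n -> R).
  by apply: measurable_indic; exact: measurable_cube.
have m1 (w : 'rV[R]_n -> R) : measurable_fun setT w ->
    measurable_fun setT (fun x => ((1 - chi N x) * w x) ^+ 2).
  move=> mw; apply: measurable_funX; apply: measurable_funM => //.
  exact: measurable_funB.
have m2 (w w' : 'rV[R]_n -> R) : measurable_fun setT w -> measurable_fun setT w' ->
    measurable_fun setT (fun x => (w' x - w x) ^+ 2 * \1_(cube N.+1%:R) x).
  move=> mw mw'; apply: measurable_funM => //; apply: measurable_funX.
  exact: measurable_funB.
have p1 (w : 'rV[R]_n -> R) x : 0 <= ((1 - chi N x) * w x) ^+ 2 by exact: sqr_ge0.
have p2 (w w' : 'rV[R]_n -> R) x : 0 <= (w' x - w x) ^+ 2 * \1_(cube N.+1%:R) x.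
  by rewrite mulr_ge0 ?sqr_ge0.
have out x : ~ cube N.+1%:R x -> 1 <= N.+1%:R ^- 2 * sqn x.
  by move=> /existsNP[i /negP]; rewrite -ltNge => /out_cube.
have chi1 x : chi N x ^+ 2 <= \1_(cube N.+1%:R) x.
  rewrite indicE; case: (boolP (x \in _)) => [_|/negP xQ].
    by rewrite expr_le1//; have /andP[] := chi01 N x.
  have /out h : ~ cube N.+1%:R x by move=> /mem_set.
  by rewrite /chi /bump2 max_l ?subr_le0// !expr0n.
have N2 : N.+1%:R ^- 2 <= 1 :> R.
  by rewrite invf_le1 ?exprn_gt0// -natrX ler1n expn_gt0.
have dchi1 i x : dchi i x ^+ 2 <= 16 * N.+1%:R ^- 2 * \1_(cube N.+1%:R) x.
  rewrite indicE; case: (boolP (x \in _)) => [_|/negP xQ]; first by rewrite mulr1; exact: dchi_bound.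
  have /out h : ~ cube N.+1%:R x by move=> /mem_set.
  by rewrite /dchi /dbump2 max_l ?subr_le0// mulr0 mul0r expr0n/= mulr0.
exists (fun x => chi N x * v x), df, N.+1%:R; split.
- exact: gf.
- by move=> x i xi; rewrite (chi_supp xi) mul0r.
- apply: (@le_trans _ _ (2 * (e / (16 * 17)) + 2 * (e / 16))%:E); last first.
    by rewrite lee_fin; lra.
  apply: (ge0_integral_le_comb _ (m2 _ _ (mhh None) mv) (m1 _ (mhh None)) _
    (p2 _ _) (p1 _) _ _ _ (Heps None) (HN1 None)) => //.
  - apply: measurable_funX; apply: measurable_funB; last exact: (mhh None).
    exact: measurable_funM.
  - by move=> x; exact: sqr_ge0.
  move=> x; rewrite /hh; set I := \1_(cube N.+1%:R) x.
  have h1 : (chi N x * (v x - u x)) ^+ 2 <= (v x - u x) ^+ 2 * I.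
    by rewrite exprMn mulrC ler_wpM2l ?sqr_ge0// chi1.
  have -> : chi N x * v x - u x = chi N x * (v x - u x) - (1 - chi N x) * u x by ring.
  move: h1; set a := chi N x * _; set b := (1 - chi N x) * _ => h1.
  apply: (@le_trans _ _ (2 * a ^+ 2 + 2 * b ^+ 2)); first by have := sqr_ge0 (a + b); nra.
  by rewrite lerD2r ler_pM2l.
move=> i.
apply: (@le_trans _ _ (4 * (1 * (e / (16 * 17)) + 1 * (e / 16)) +
    4 * (16 * (e / (16 * 17)) + 16 * N.+1%:R ^- 2 * U))%:E); last first.
  move: HN2; set q := 16 * _ * U => HN2; rewrite lee_fin; lra.
pose A x := (dv i x - g x ord0 i) ^+ 2 * \1_(cube N.+1%:R) x.
pose B x := ((1 - chi N x) * g x ord0 i) ^+ 2.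
pose C x := (v x - u x) ^+ 2 * \1_(cube N.+1%:R) x.
have mA : measurable_fun setT A := m2 _ _ (mhh (Some i)) (mdv i).
have mB : measurable_fun setT B := m1 _ (mhh (Some i)).
have mC : measurable_fun setT C := m2 _ _ (mhh None) mv.
have mu2 : measurable_fun setT (fun x => u x ^+ 2).
  by apply: measurable_funX; exact: (mhh None).
have A0 x : 0 <= A x by exact: (p2 (fun x => g x ord0 i)).
have B0 x : 0 <= B x by exact: sqr_ge0.
have C0 x : 0 <= C x by exact: (p2 u v).
have q0 : 0 <= 16 * N.+1%:R ^- 2 :> R by rewrite mulr_ge0// ltW.
have IAB : (\int[mu]_x (A x + B x)%:E <= (1 * (e / (16 * 17)) + 1 * (e / 16))%:E)%E.
  apply: (ge0_integral_le_comb _ mA mB _ A0 B0 _ _ _ (Heps (Some i)) (HN1 (Some i))) => //.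
  - exact: measurable_funD.
  - by move=> x; rewrite addr_ge0.
  - by move=> x; rewrite !mul1r.
have ICU : (\int[mu]_x (16 * C x + 16 * N.+1%:R ^- 2 * u x ^+ 2)%:E <=
    (16 * (e / (16 * 17)) + 16 * N.+1%:R ^- 2 * U)%:E)%E.
  apply: (ge0_integral_le_comb _ mC mu2 _ C0 _ _ q0 _ (Heps None)) => //.
  - by apply: measurable_funD; apply: measurable_funM => //; exact: measurable_cst.
  - by move=> x; apply: addr_ge0; apply: mulr_ge0 => //; exact: sqr_ge0.
  - by move=> x; exact: sqr_ge0.
  - by rewrite UE.
apply: (ge0_integral_le_comb _ _ _ _ _ _ _ _ _ IAB ICU) => //.
- by apply: measurable_funX; apply: measurable_funB => //; exact: (mhh (Some i)).
- exact: measurable_funD.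
- by apply: measurable_funD; apply: measurable_funM => //; exact: measurable_cst.
- by move=> x; exact: sqr_ge0.
- by move=> x; rewrite addr_ge0.
- by move=> x; apply: addr_ge0; apply: mulr_ge0 => //; exact: sqr_ge0.
move=> x; rewrite dfE /A /B /C.
set I := \1_(cube N.+1%:R) x.
have I0 : 0 <= I by [].
have h1 : (chi N x * (dv i x - g x ord0 i)) ^+ 2 <= (dv i x - g x ord0 i) ^+ 2 * I.
  by rewrite exprMn mulrC ler_wpM2l ?sqr_ge0// chi1.
have h2 : (dchi i x * (v x - u x)) ^+ 2 <= 16 * ((v x - u x) ^+ 2 * I).
  rewrite exprMn [leRHS]mulrCA [leLHS]mulrC; apply: ler_wpM2l; first exact: sqr_ge0.
  apply: le_trans (dchi1 i x) _.
  by rewrite -mulrA ler_pM2l// ler_piMl.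
have h3 : (dchi i x * u x) ^+ 2 <= 16 * N.+1%:R ^- 2 * u x ^+ 2.
  by rewrite exprMn ler_wpM2r ?sqr_ge0//; exact: dchi_bound.
have -> : chi N x * dv i x + v x * dchi i x - g x ord0 i =
   chi N x * (dv i x - g x ord0 i) - (1 - chi N x) * g x ord0 i +
   dchi i x * (v x - u x) + dchi i x * u x by ring.
move: h1 h2 h3; rewrite -mulrDr.
set a := chi N x * _; set b := (1 - chi N x) * _; set c1 := dchi i x * _.
set c2 := dchi i x * _ => h1 h2 h3.
apply: (@le_trans _ _ (4 * (a ^+ 2 + b ^+ 2 + (c1 ^+ 2 + c2 ^+ 2)))).
  have := sqr_ge0 (a + b); have := sqr_ge0 (a - c1); have := sqr_ge0 (a - c2).
  have := sqr_ge0 (b + c1); have := sqr_ge0 (b + c2); have := sqr_ge0 (c1 - c2).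
  nra.
by rewrite ler_pM2l//; apply: lerD; [exact: lerD|exact: lerD].
Unshelve. all: by end_near. Qed.

End sobolev_approximation.

(** * The spectral gap *)

Section poincare_of_C1.
Variables (R : realType) (n : nat) (mu : probability 'rV[R]_n R).
Variables (V : 'rV[R]_n -> R) (Z La : R).
Hypotheses (Z0 : 0 < Z) (cV : continuous V) (muV : has_gibbs_density mu V Z).
Hypothesis La0 : 0 < La.
Hypothesis C1_poincare : forall (B : R) f g, has_grad f g -> cube_supp B f ->
  exists m : R, \int[mu]_x ((f x - m) ^+ 2) <=
    La * \int[mu]_x (\sum_i g i x ^+ 2).
Implicit Types (u : 'rV[R]_n -> R).

Let L2_integrable u : u \in Lfun mu 2%:E -> mu.-integrable setT (EFin \o u).
Proof.
move=> u2; apply/Lfun1_integrable.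
by apply: Lfun_subset12 => //; exact: fin_num_measure.
Qed.

(** The quadratic deviation from [m] exceeds that from the mean by the square of
their difference. *)
Lemma variance_le u (m : R) : u \in Lfun mu 2%:E ->
  (\int[mu]_x ((u x - \int[mu]_y u y) ^+ 2)%:E <= \int[mu]_x ((u x - m) ^+ 2)%:E)%E.
Proof.
move=> u2; have i1 := L2_integrable u2; have i2 := Lfun2_integrable_sqr u2.
have ic (c : R) : mu.-integrable setT (EFin \o (fun _ : 'rV[R]_n => c)).
  by apply: bounded_mfun_integrable; exact: bounded_mfun_cst.
set M := \int[mu]_y u y.
have E (k : R) : (\int[mu]_x ((u x - k) ^+ 2)%:E =
    (\int[mu]_x (u x ^+ 2) + (- 2 * k) * M + k ^+ 2)%:E)%E.
  have j1 : mu.-integrable setT (EFin \o (fun x => - 2 * k * u x)).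
    exact: (integrableZl measurableT (- 2 * k) i1).
  have j2 : mu.-integrable setT (EFin \o (fun x => u x ^+ 2 + - 2 * k * u x)).
    exact: (integrableD measurableT i2 j1).
  have sqE x : (u x - k) ^+ 2 = u x ^+ 2 + - 2 * k * u x + k ^+ 2 by ring.
  under eq_integral do rewrite sqE.
  have j3 := integrableD measurableT j2 (ic (k ^+ 2)).
  rewrite -(fineK (integrable_fin_num measurableT j3)) -/(Rintegral _ _ _).
  rewrite RintegralD// RintegralD// RintegralZl//.
  by rewrite Rintegral_cst//= probability_setT/= mulr1.
rewrite !E lee_fin; have := sqr_ge0 (M - m); nra.
Qed.

(** The variance of [u] is at most twice that of an approximation plus twice the
error, and likewise for the gradient: hence the factor [4], the errors tending
to [0]. *)
Lemma poincare_of_C1 : poincare mu (4 * La)^-1.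
Proof.
move=> u g Hug; have [u2 Hg] := Hug.
have g2 i : (fun x => g x ord0 i) \in Lfun mu 2%:E by case: (Hg i).
have mu_ := Lfun2_measurable u2.
have mg i := Lfun2_measurable (g2 i).
have mS (w : 'I_n -> 'rV[R]_n -> R) : (forall i, measurable_fun setT (w i)) ->
    measurable_fun setT (fun x => \sum_i w i x ^+ 2).
  by move=> mw; apply: measurable_sum => i; exact: measurable_funX.
have SE (w : 'I_n -> 'rV[R]_n -> R) : (forall i, measurable_fun setT (w i)) ->
    (\int[mu]_x (\sum_i w i x ^+ 2)%:E = \sum_i \int[mu]_x (w i x ^+ 2)%:E)%E.
  move=> mw; under eq_integral do rewrite -sumEFin.
  rewrite ge0_integral_sum//.
  - by move=> i; apply/measurable_EFinP; exact: measurable_funX.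
  - by move=> i x _; rewrite lee_fin sqr_ge0.
pose G := \int[mu]_x (\sum_i g x ord0 i ^+ 2).
have GE : (\int[mu]_x (\sum_i g x ord0 i ^+ 2)%:E = G%:E)%E.
  rewrite /G /Rintegral fineK// (SE (fun i x => g x ord0 i))// sum_fin_num.
  apply/allP => /= y /mapP[i _ ->].
  exact: (integrable_fin_num measurableT (Lfun2_integrable_sqr (g2 i))).
have -> : (\int[mu]_x (enorm (g x) ^+ 2)%:E = G%:E)%E.
  by rewrite -GE; apply: eq_integral => x _; rewrite enorm2.
set X := (\int[mu]_x _)%E.
have X0 : (0 <= X)%E by apply: integral_ge0 => x _; rewrite lee_fin sqr_ge0.
suff XG : (X <= (4 * La * G)%:E)%E.
  have -> : G%:E = ((4 * La)^-1%:E * (4 * La * G)%:E)%E.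
    by rewrite -EFinM mulrA mulVf ?mul1r// gt_eqF// mulr_gt0.
  by apply: lee_wpmul2l => //; rewrite lee_fin invr_ge0 mulr_ge0// ltW.
apply/lee_addgt0Pr => e e0.
pose k := 4 * La * n%:R + 2.
have k0 : 0 < k by rewrite ltr_wpDl// !mulr_ge0// ltW.
have ek : 0 < e / k by rewrite divr_gt0.
have [f [df [B [gf fB fu dfg]]]] := H1_approximation Z0 cV muV Hug ek.
have [m Hm] := C1_poincare gf fB.
have cf : continuous f by case: gf.
have cdf i : continuous (df i) by case: gf.
have bf : bounded_mfun f by exact: continuous_bounded_mfun fB.
have bdf i : bounded_mfun (df i).
  by apply: (@continuous_bounded_mfun _ _ B) => //; exact: has_grad_supp gf fB.
have bF : bounded_mfun (fun x => (f x - m) ^+ 2).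
  by under eq_fun do rewrite expr2; apply: bounded_mfunM;
    apply: bounded_mfunD => //; exact: bounded_mfun_cst.
have bD : bounded_mfun (fun x => \sum_i df i x ^+ 2).
  apply: bounded_mfun_sum => i; under eq_fun do rewrite expr2.
  exact: bounded_mfunM.
have Idfg : (\int[mu]_x (\sum_i (df i x - g x ord0 i) ^+ 2)%:E <= (n%:R * (e / k))%:E)%E.
  rewrite (SE (fun i x => df i x - g x ord0 i)); last first.
    by move=> i; apply: measurable_funB => //; case: (bdf i).
  have -> : (n%:R * (e / k))%:E = (\sum_(i < n) (e / k)%:E)%E.
    by rewrite sumEFin sumr_const card_ord mulr_natl.
  by apply: lee_sum => i _; exact: dfg.
have ID : (\int[mu]_x (\sum_i df i x ^+ 2)%:E <= (2 * G + 2 * (n%:R * (e / k)))%:E)%E.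
  apply: (ge0_integral_le_comb (G := fun x => \sum_i g x ord0 i ^+ 2)
    _ _ _ _ _ _ _ _ _ _ Idfg) => //; last first.
  - by rewrite /= GE.
  - move=> x /=; rewrite !mulr_sumr -big_split /=; apply: ler_sum => i _.
    have := sqr_ge0 (df i x - 2 * g x ord0 i); nra.
  - by move=> x; apply: sumr_ge0 => i _; exact: sqr_ge0.
  - by move=> x; apply: sumr_ge0 => i _; exact: sqr_ge0.
  - by move=> x; apply: sumr_ge0 => i _; exact: sqr_ge0.
  - apply: (mS (fun i x => df i x - g x ord0 i)) => i.
    by apply: measurable_funB => //; case: (bdf i).
  - exact: (mS (fun i x => g x ord0 i)).
  - by apply: mS => i; case: (bdf i).
have IF : (\int[mu]_x ((f x - m) ^+ 2)%:E <=
    (La * (2 * G + 2 * (n%:R * (e / k))))%:E)%E.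
  rewrite (bounded_integralE mu bF) lee_fin; apply: le_trans Hm _.
  by rewrite ler_pM2l// -lee_fin -(bounded_integralE mu bD).
apply: le_trans (variance_le m u2) _.
have -> : ((4 * La * G)%:E + e%:E)%E =
    (2 * (La * (2 * G + 2 * (n%:R * (e / k)))) + 2 * (e / k))%:E.
  by rewrite -EFinD; congr EFin; rewrite /k; field; rewrite -/k gt_eqF.
have mf : measurable_fun setT f by case: bf.
apply: (ge0_integral_le_comb _ _ _ _ _ _ _ _ _ IF fu) => //.
- by apply: measurable_funX; exact: measurable_funB.
- by apply: measurable_funX; exact: measurable_funB.
- by apply: measurable_funX; exact: measurable_funB.
- by move=> x; exact: sqr_ge0.
- by move=> x; exact: sqr_ge0.
- by move=> x; exact: sqr_ge0.
- by move=> x /=; have := sqr_ge0 (f x - m + (f x - u x)); nra.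
Qed.

End poincare_of_C1.

Section spectral_gap_bounds.
Variables (R : realType) (n : nat) (mu : probability 'rV[R]_n R).

Lemma lambda1_ge (l : R) : 0 <= l -> poincare mu l -> (l%:E <= lambda1 mu)%E.
Proof. by move=> l0 Pl; apply: ereal_sup_ubound; exists l. Qed.

Lemma lambda1_ge0 : (0 <= lambda1 mu)%E.
Proof.
apply: lambda1_ge => // u g _; rewrite mul0e.
by apply: integral_ge0 => x _; rewrite lee_fin sqr_ge0.
Qed.

End spectral_gap_bounds.

(** The radius [rho], with [rho `^ al = dl * n], is of the order of [Ra] but small
enough for [x . grad V <= n / 2] on that ball. The curvature [K] is below the
curvature outside [Ra] and below [2 / al * r `^ (al - 2)], for which the
paraboloid lies above [V] on the ball of radius [r = rho / 4]. Both [1 / K] and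
[rho^2 / n^2] are then bounded by multiples of [n `^ (2 / al - 1)]. *)
Lemma spectral_gap_lower_bound (R : realType) (al a c : R) :
  2 <= al -> 0 < a -> 0 < c -> exists2 l : R, 0 < l &
    forall (n : nat) (V : 'rV[R]_n -> R) (Z : R) (mu : probability 'rV[R]_n R),
      (0 < n)%N -> Ck 2 V ->
      (forall x, enorm x <= (a * n%:R) `^ al^-1 -> V x = enorm x `^ al / al) ->
      (forall x, (a * n%:R) `^ al^-1 <= enorm x ->
         form_ge (hessian V x) (c * (a * n%:R) `^ (1 - 2 / al))) ->
      0 < Z -> has_gibbs_density mu V Z ->
      ((l * n%:R `^ (1 - 2 / al))%:E <= lambda1 mu)%E.
Proof.
move=> al2 a0 c0; have al0 : 0 < al by lra.
set b := 1 - 2 / al.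
have b0 : 0 <= b by rewrite subr_ge0 ler_pdivrMr// mul1r.
pose dl := Num.min a 2^-1.
have dl0 : 0 < dl by rewrite lt_min a0 invr_gt0 ltr0n.
have dla : dl <= a by rewrite ge_min lexx.
have dl2 : dl <= 2^-1 by rewrite ge_min lexx orbT.
(* [q] carries the factor [(rho / r)^2 = 16] to the relevant power *)
pose q := (16^-1 : R) `^ (al / 2 - 1).
have q0 : 0 < q by rewrite powR_gt0.
pose k1 := c * a `^ b; pose k2 := 2 / al * (dl `^ b * q).
have k10 : 0 < k1 by rewrite mulr_gt0// powR_gt0.
have k20 : 0 < k2 by rewrite mulr_gt0 ?divr_gt0// mulr_gt0 ?powR_gt0.
pose ka := Num.min k1 k2 / 2.
have ka0 : 0 < ka by rewrite divr_gt0// lt_min k10.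
have m1 : Num.min k1 k2 <= k1 by rewrite ge_min lexx.
have m2 : Num.min k1 k2 <= k2 by rewrite ge_min lexx orbT.
have kak1 : ka < k1 by rewrite /ka; lra.
have kak2 : ka < k2 by rewrite /ka; lra.
pose L0 := 72 / ka + 80 * dl `^ (2 / al).
have L00 : 0 < L0.
  have h1 : 0 < 72 / ka by rewrite divr_gt0.
  by have := powR_ge0 dl (2 / al); rewrite /L0; lra.
exists (4 * L0)^-1; first by rewrite invr_gt0 mulr_gt0.
move=> n V Z mu n0 C2V V_in V_out Z0 muV.
set N := n%:R : R.
have N1 : 1 <= N by rewrite ler1n.
have N0 : 0 < N by lra.
have Nb0 : 0 < N `^ b by rewrite powR_gt0.
pose rho := (dl * N) `^ al^-1; pose Ra := (a * N) `^ al^-1.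
have rho0 : 0 < rho by rewrite powR_gt0// mulr_gt0.
have rhoRa : rho <= Ra.
  apply: ge0_ler_powR; rewrite ?nnegrE ?invr_ge0 ?mulr_ge0 ?(ltW al0) ?(ltW a0) ?(ltW dl0)// ?(ltW N0)//.
  by rewrite ler_pM2r.
have rho2E : rho ^+ 2 = dl `^ (2 / al) * N `^ (2 / al).
  rewrite -powR_mulrn ?(ltW rho0)// -powRrM -powRM ?(ltW dl0) ?(ltW N0)//.
  by congr powR; rewrite mulrC.
pose r := rho / 4.
have r0 : 0 < r by rewrite divr_gt0.
have rRa : r < Ra by apply: lt_le_trans rhoRa; rewrite /r; lra.
pose K := ka * N `^ b.
have K0 : 0 < K by rewrite mulr_gt0.
have LE : c * (a * N) `^ b = k1 * N `^ b.
  by rewrite powRM ?(ltW a0) ?(ltW N0)// mulrA.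
have KL : K < c * (a * N) `^ b by rewrite LE ltr_pM2r.
have Kr : K < 2 / al * (r ^+ 2) `^ (al / 2 - 1).
  have -> : (r ^+ 2) `^ (al / 2 - 1) = dl `^ b * q * N `^ b.
    have -> : r ^+ 2 = dl `^ (2 / al) * N `^ (2 / al) * 16^-1.
      by rewrite -rho2E /r; field.
    rewrite !powRM ?mulr_ge0 ?powR_ge0// -!powRrM.
    have -> : 2 / al * (al / 2 - 1) = b by rewrite /b; field; rewrite gt_eqF.
    by rewrite -/q mulrAC.
  by rewrite mulrA ltr_pM2r.
have gV : has_grad V (fun i => partial i V) by exact: Ck1_has_grad C2V.
have cV : continuous V by case: gV.
pose La := 72 / K + 80 * rho ^+ 2 / N ^+ 2.
have La0 : 0 < La by rewrite addr_gt0 ?divr_gt0// !mulr_gt0 ?invr_gt0 ?exprn_gt0.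
have hC1 : forall (B : R) f g, has_grad f g -> cube_supp B f ->
    exists m : R, \int[mu]_x ((f x - m) ^+ 2) <=
      La * \int[mu]_x (\sum_i g i x ^+ 2).
  move=> B f g gf fB.
  have cW : continuous (convexified V al r K) by exact: convexified_continuous.
  apply: (c1_poincare n0 Z0 K0 rho0 gV cW muV
    (convexified_ge V al r K)
    (convexified_midpoint al2 r0 rRa C2V V_in V_out KL Kr) _ _ gf fB) => x rx.
    apply: (convexified_out al2 r0 rRa C2V V_in V_out KL Kr).
    by apply: le_trans rx; rewrite /r; lra.
  have rR2 : rho ^+ 2 <= Ra ^+ 2 by rewrite lerXn2r ?nnegrE ?powR_ge0.
  rewrite (euler_identity al2 r0 rRa C2V V_in (lt_le_trans rx rR2)).
  apply: (@le_trans _ _ ((rho ^+ 2) `^ (al / 2))).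
    apply: ge0_ler_powR; rewrite ?nnegrE ?sqn_ge0 ?sqr_ge0 ?divr_ge0 ?(ltW al0)//.
    exact: ltW.
  have -> : (rho ^+ 2) `^ (al / 2) = dl * N.
    rewrite -powR_mulrn ?(ltW rho0)// -!powRrM.
    have -> : al^-1 * (2%:R * (al / 2)) = 1 by field; rewrite gt_eqF.
    by rewrite powRr1// mulr_ge0 ?ltW.
  by rewrite mulrC ler_pM2l.
have LaN : La * N `^ b <= L0.
  have NN : N `^ (2 / al) * N `^ b = N.
    rewrite -powRD; last by rewrite (gt_eqF N0) implybT.
    by rewrite /b addrC subrK powRr1// ltW.
  have -> : La * N `^ b = 72 / ka + 80 * dl `^ (2 / al) * N^-1.
    rewrite /La rho2E /K.
    have -> : 72 / (ka * N `^ b) + 80 * (dl `^ (2 / al) * N `^ (2 / al)) / N ^+ 2 =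
      72 / (ka * N `^ b) + 80 * dl `^ (2 / al) * N `^ (2 / al) / N ^+ 2 by ring.
    have -> : N `^ (2 / al) = N / N `^ b by rewrite -[X in _ = X / _]NN mulfK ?gt_eqF.
    by field; rewrite !gt_eqF.
  rewrite /L0 lerD2l ler_piMr ?mulr_ge0 ?powR_ge0//.
  by rewrite invf_le1.
apply: (@le_trans _ _ ((4 * La)^-1)%:E).
  rewrite lee_fin mulrC ler_pdivrMr ?mulr_gt0//.
  by rewrite mulrC ler_pdivlMr ?mulr_gt0//; lra.
apply: lambda1_ge; first by rewrite invr_ge0 mulr_ge0 ?ltW.
exact: poincare_of_C1 Z0 cV muV La0 hC1.
Qed.

Theorem proposition7p1 (R : realType) (alpha a c : R) :
  2 <= alpha -> 0 < a -> c <= 1 ->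
  exists C : R, 0 < C /\
    forall (n : nat) (V : 'rV[R]_n -> R) (Z : R) (mu : probability 'rV[R]_n R),
      (1 <= n)%N ->
      let Ra := (a * n%:R) `^ alpha^-1 in
      Ck 2 V ->
      (forall x, enorm x <= Ra -> V x = enorm x `^ alpha / alpha) ->
      (forall x, Ra <= enorm x ->
         form_ge (hessian V x) (c * (a * n%:R) `^ (1 - 2 / alpha))) ->
      0 < Z -> has_gibbs_density mu V Z ->
      (a <= 1 ->
         ((C * Num.min (Num.min (4 * a)^-1 2^-1) c
             * (a * n%:R) `^ (1 - 2 / alpha))%:E <= lambda1 mu)%E) /\
      (1 < a ->
         ((C * Num.min 4^-1 (c * a `^ (1 - 2 / alpha))
             * n%:R `^ (1 - 2 / alpha))%:E <= lambda1 mu)%E).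
Proof.
move=> al2 a0 c1; set b := 1 - 2 / alpha.
have al0 : 0 < alpha by lra.
have b0 : 0 <= b by rewrite subr_ge0 ler_pdivrMr// mul1r.
have ab0 : 0 < a `^ b by rewrite powR_gt0.
have [c0|c0] := leP c 0.
  exists 1; split => // n V Z mu n1 Ra C2V V_in V_out Z0 muV.
  split=> [_|_]; apply: le_trans (lambda1_ge0 mu); rewrite lee_fin mul1r.
    by rewrite mulr_le0_ge0 ?powR_ge0// ge_min c0 orbT.
  by rewrite mulr_le0_ge0 ?powR_ge0// ge_min mulr_le0_ge0 ?orbT ?powR_ge0.
have [l l0 Hl] := spectral_gap_lower_bound al2 a0 c0.
(* one constant for both regimes, whichever of [n] and [a n] is the scale *)
pose m := Num.max 1 (a `^ b).
have m1 : 1 <= m by rewrite le_max lexx.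
have ma : a `^ b <= m by rewrite le_max lexx orbT.
have m0 : 0 < m by lra.
have C0 : 0 < l / m by rewrite divr_gt0.
exists (l / m); split => // n V Z mu n1 Ra C2V V_in V_out Z0 muV.
have nb0 := powR_ge0 (n%:R : R) b.
have gap := Hl n V Z mu n1 C2V V_in V_out Z0 muV.
split=> _; apply: le_trans gap; rewrite lee_fin -/b.
  rewrite powRM ?(ltW a0)// mulrA ler_wpM2r//.
  apply: (@le_trans _ _ (l / m * 1 * a `^ b)).
    rewrite ler_pM2r// ler_pM2l// ge_min ge_min; apply/orP; left; apply/orP; right.
    by rewrite invf_le1// ler1n.
  by rewrite mulr1 mulrAC ler_pdivrMr// ler_pM2l.
rewrite ler_wpM2r//; apply: (@le_trans _ _ (l / m * 1)).
  rewrite ler_pM2l// ge_min; apply/orP; left.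
  by rewrite invf_le1// ler1n.
by rewrite mulr1 ler_pdivrMr// ler_peMr// ltW.
Qed.
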